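(* Let $m\ge 1$ and $n\ge k\ge 1$ be integers. (a) For all $p\ge 2$, $\pi_p(W_{k,n}(\mathbb{R}P^m))\cong\pi_p(W_{k,n}(S^m))$. (b) \[ \pi_1(W_{k,n}(\mathbb{R}P^m))\cong \begin{cases} (\mathbb{Z}_2)^n, & k=n\le m-1,\\ Q_8, & k=n=m=2,\\ Q_8\oplus\mathbb{Z}_2, & k=n=m=3,\\ Q_8\ast_{Z}D_8, & k=n=m=4. \end{cases} \]
   Context: $S^m\subset\mathbb{R}^{m+1}$ is the unit sphere and $\mathbb{R}P^m=P(\mathbb{R}^{m+1})$ is real projective space; $[v]$ is the class of a nonzero vector $v$. Points $[v_1],\dots,[v_k]$ of $\mathbb{R}P^m$ are called linearly independent if $v_1,\dots,v_k$ are linearly independent. For $M=S^m$ or $\mathbb{R}P^m$, the generalized configuration space is \[ W_{k,n}(M)=\{(p_1,\dots,p_n)\in M^n \mid \text{for every } k\text{-element subset } \{i_1,\dots,i_k\}\subset\{1,\dots,n\},\ p_{i_1},\dots,p_{i_k}\text{ are linearly independent}\}, \] with the topology induced from $M^n$. $Q_8=\langle a,b\mid a^4=1,\ b^2=a^2,\ b^{-1}ab=a^3\rangle$ is the quaternion group of order 8; $D_8=\langle a,b\mid a^4=b^2=1,\ b^{-1}ab=a^3\rangle$ is the dihedral group of order 8; $Q_8\ast_Z D_8$ is the central product of $Q_8$ and $D_8$ (the quotient of $Q_8\times D_8$ identifying the two centers of order 2), an extraspecial 2-group of order $2^5$. The symbol $\oplus$ denotes the direct product of groups. Base points: in (a),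 any base point $(x_1,\dots,x_n)\in W_{k,n}(S^m)$ and its image $([x_1],\dots,[x_n])\in W_{k,n}(\mathbb{R}P^m)$; in (b), $([e_1],\dots,[e_n])$ where $e_i$ are the standard basis vectors of $\mathbb{R}^{m+1}$. *)

(* Defs.v *)
From HB Require Import structures.
From mathcomp Require Import all_boot all_order all_algebra all_fingroup all_solvable.
From mathcomp Require Import generic_quotient.
From mathcomp Require Import all_classical all_reals topology normedtype.
From mathcomp Require Import lra.

Set Implicit Arguments.
Unset Strict Implicit.
Unset Printing Implicit Defensive.

Import Order.TTheory GRing.Theory Num.Theory.
Import numFieldNormedType.Exports.

Local Open Scope classical_set_scope.
Local Open Scope ring_scope.
Local Open Scope quotient_scope.

Definition isomorphic (G H : groupType) : Prop :=
  exists f : {multiplicative G -> H}, bijective f.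

Local Ltac min_lra :=
  rewrite ?minEle ?maxEle;
  repeat match goal with |- context [if ?a <= ?b then _ else _] =>
    lazymatch a with context [if _ then _ else _] => fail | _ =>
    lazymatch b with context [if _ then _ else _] => fail | _ =>
      case: (lerP a b) => ? /= end end end; lra.

Section ContinuityLemmas.
Context {R : realType}.
Implicit Types X Y Z : topologicalType.

Lemma cts_comp X Y Z (f : X -> Y) (g : Y -> Z) :
  continuous f -> continuous g -> continuous (fun x => g (f x)).
Proof. by move=> cf cg x; exact: (continuous_comp (cf x) (cg (f x))). Qed.

Lemma cts_pair X Y Z (f : X -> Y) (g : X -> Z) :
  continuous f -> continuous g -> continuous (fun x => (f x, g x)).
Proof. by move=> cf cg x; exact: (cvg_pair (cf x) (cg x)). Qed.

Lemma cts_fst Y Z : continuous (fst : Y * Z -> Y).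
Proof. by move=> x; exact: cvg_fst. Qed.

Lemma cts_snd Y Z : continuous (snd : Y * Z -> Z).
Proof. by move=> x; exact: cvg_snd. Qed.

Lemma cts_cst Y Z (z : Z) : continuous (fun _ : Y => z).
Proof. by move=> x; exact: cvg_cst. Qed.

Lemma cts_add Y (f g : Y -> R) :
  continuous f -> continuous g -> continuous (fun y => f y + g y).
Proof. by move=> cf cg y; apply: cvgD; [exact: cf|exact: cg]. Qed.

Lemma cts_opp Y (f : Y -> R) : continuous f -> continuous (fun y => - f y).
Proof. by move=> cf y; apply: cvgN; exact: cf. Qed.

Lemma cts_mul Y (f g : Y -> R) :
  continuous f -> continuous g -> continuous (fun y => f y * g y).
Proof. by move=> cf cg y; apply: cvgM; [exact: cf|exact: cg]. Qed.

Lemma cts_min Y (f g : Y -> R) :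
  continuous f -> continuous g -> continuous (fun y => Num.min (f y) (g y)).
Proof.
by move=> cf cg; exact: (cts_comp (cts_pair cf cg) (@min_continuous _ R)).
Qed.

Lemma cts_max Y (f g : Y -> R) :
  continuous f -> continuous g -> continuous (fun y => Num.max (f y) (g y)).
Proof.
by move=> cf cg; exact: (cts_comp (cts_pair cf cg) (@max_continuous _ R)).
Qed.

Lemma cts_paste Y X (u : Y -> R) (a : R) (F G : Y -> X) :
  continuous u -> continuous F -> continuous G ->
  (forall y, u y = a -> F y = G y) ->
  continuous (fun y => if u y <= a then F y else G y).
Proof.
move=> cu cF cG FG.
set h := fun y => _.
have cA : closed [set y | u y <= a].
  by apply: (@preimage_closed _ _ u [set x | x <= a]) => [y _|]; [exact: cu|exact: closed_le].
have cB : closed [set y | a <= u y].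
  by apply: (@preimage_closed _ _ u [set x | a <= x]) => [y _|]; [exact: cu|exact: closed_ge].
have AB : [set y | u y <= a] `|` [set y | a <= u y] = setT.
  by apply/seteqP; split=> // y _ /=; case/orP: (le_total (u y) a); [left|right].
have : {within [set y | u y <= a] `|` [set y | a <= u y], continuous h}.
  apply: withinU_continuous => //.
  - apply: (@subspace_eq_continuous _ _ _ F); last exact: continuous_subspaceT.
    by move=> y; rewrite inE => /= uy; rewrite /from_subspace /h uy.
  - apply: (@subspace_eq_continuous _ _ _ G); last exact: continuous_subspaceT.
    move=> y; rewrite inE => /= ay; rewrite /from_subspace /h; case: ifP => // ya.
    by rewrite FG //; apply/eqP; rewrite eq_le ya ay.
by rewrite AB => hc; apply/continuous_subspace_setT.
Qed.

Lemma cts_ptws (I : Type) Y (K : I -> topologicalType) (f : Y -> prod_topology K) :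
  (forall i, continuous (fun y => f y i)) -> continuous f.
Proof.
move=> cf x; apply/(@cvg_sup (prod_topology K) I
  (fun i => Topological.class (initial_topology (fun g : (forall i, K i) => g i)))
  (f @ x) (f x)) => i.
move: x; apply/(@continuousP _ (initial_topology (@^~ i))) => A [B oB <-].
by have /continuousP := cf i; apply.
Qed.

End ContinuityLemmas.

Section Cubes.
Context {R : realType}.

Definition unit_interval : topologicalType := (`[0%R, 1%R]%classic : set R).

Definition unit_val (x : unit_interval) : R := val x.

Definition cube (p : nat) : topologicalType :=
  prod_topology (fun _ : 'I_p => unit_interval).

Definition cube_boundary (p : nat) : set (cube p) :=
  [set t | exists i : 'I_p, unit_val (t i) = 0 \/ unit_val (t i) = 1].

Fact to_unit_subproof (x : R) :
  Num.max 0 (Num.min x 1) \in (`[0%R, 1%R]%classic : set R).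
Proof.
by apply: mem_set; rewrite /= in_itv /= le_max lexx ge_max ler01 ge_min lexx orbT.
Qed.

(* Clamping to [0, 1]; in the definitions below it only repackages, as points of
   the interval, reals that already lie in [0, 1]. *)
Definition to_unit (x : R) : unit_interval :=
  exist (fun z => z \in (`[0%R, 1%R]%classic : set R)) _ (to_unit_subproof x).

Lemma to_unitK (x : R) : 0 <= x <= 1 -> unit_val (to_unit x) = x.
Proof. by move=> /andP[x0 x1]; rewrite /unit_val /= min_l // max_r. Qed.

Lemma unitP (x : unit_interval) : 0 <= unit_val x <= 1.
Proof. by have := set_mem (valP x); rewrite /unit_val /= in_itv. Qed.

Lemma valK_unit (x : unit_interval) : to_unit (unit_val x) = x.
Proof. by apply: val_inj; rewrite -/(unit_val _) -/(unit_val x) to_unitK ?unitP. Qed.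

Lemma cts_val : continuous (unit_val : unit_interval -> R).
Proof. exact: initial_continuous. Qed.

Lemma cts_to_unit : continuous to_unit.
Proof.
apply: continuous_comp_initial.
have ci : continuous (fun x : R => x) by move=> x; exact: cvg_id.
exact: (cts_max (@cts_cst R R 0) (cts_min ci (@cts_cst R R 1))).
Qed.

Lemma cts_coord p i : continuous (fun t : cube p => t i).
Proof. exact: proj_continuous. Qed.

Definition set_first (p : nat) (t : cube p.+1) (x : unit_interval) : cube p.+1 :=
  fun i => if i == ord0 then x else t i.

Lemma cts_set_first (Y : topologicalType) p (f : Y -> cube p.+1) g :
  continuous f -> continuous g -> continuous (fun y => set_first (f y) (g y)).
Proof.
move=> cf cg; apply: cts_ptws => i; rewrite /set_first.
by case: (i == ord0) => //; exact: (cts_comp cf (@cts_coord _ i)).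
Qed.

End Cubes.

Section HomotopyGroup.
Context (R : realType) (p : nat) (X : topologicalType) (x0 : X).
Local Notation I := (@unit_interval R).
Local Notation cube := (@cube R).

Structure loop := Loop {
  loop_fun :> cube p -> X;
  loop_continuous : continuous loop_fun;
  loop_boundary : forall t, cube_boundary t -> loop_fun t = x0 }.

HB.instance Definition _ := gen_eqMixin loop.
HB.instance Definition _ := gen_choiceMixin loop.

Definition homotopic (f g : cube p -> X) : Prop :=
  exists H : I * cube p -> X,
    [/\ continuous H, forall t, H (to_unit 0, t) = f t,
        forall t, H (to_unit 1, t) = g t
      & forall s t, cube_boundary t -> H (s, t) = x0].

Lemma to_unit0 : unit_val (to_unit 0 : I) = 0.
Proof. by rewrite to_unitK // lexx ler01. Qed.

Lemma to_unit1 : unit_val (to_unit 1 : I) = 1.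
Proof. by rewrite to_unitK // lexx ler01. Qed.

Lemma homotopic_refl (f : loop) : homotopic f f.
Proof.
exists (fun z => f z.2); split=> //.
  exact: (cts_comp (@cts_snd _ _) (@loop_continuous f)).
by move=> s t; exact: loop_boundary.
Qed.

Lemma homotopic_sym (f g : cube p -> X) : homotopic f g -> homotopic g f.
Proof.
case=> H [cH H0 H1 Hb].
exists (fun z => H (to_unit (1 - unit_val z.1), z.2)); split.
- apply: cts_comp cH; apply: cts_pair; last exact: cts_snd.
  apply: cts_comp cts_to_unit; apply: cts_add; first exact: cts_cst.
  by apply: cts_opp; exact: (cts_comp (@cts_fst _ _) cts_val).
- by move=> t; rewrite [(_, _).1]/= to_unit0 subr0.
- by move=> t; rewrite [(_, _).1]/= to_unit1 subrr.
- by move=> s t; exact: Hb.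
Qed.

Lemma homotopic_trans (f g h : cube p -> X) :
  homotopic f g -> homotopic g h -> homotopic f h.
Proof.
case=> H [cH H0 H1 Hb] [K [cK K0 K1 Kb]].
exists (fun z => if unit_val z.1 <= 2^-1 then H (to_unit (2 * unit_val z.1), z.2)
                 else K (to_unit (2 * unit_val z.1 - 1), z.2)).
have c1 := cts_comp (@cts_fst I (cube p)) (@cts_val R).
have c2 := cts_mul (@cts_cst (I * cube p)%type R 2) c1.
split.
- apply: (cts_paste c1 (F := fun z => H (to_unit (2 * unit_val z.1), z.2))
                   (G := fun z => K (to_unit (2 * unit_val z.1 - 1), z.2))).
  + by apply: cts_comp cH; apply: cts_pair (@cts_snd _ _); exact: (cts_comp c2 cts_to_unit).
  + apply: cts_comp cK; apply: cts_pair (@cts_snd _ _); apply: cts_comp cts_to_unit.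
    by apply: (cts_add c2); exact: cts_cst.
  + move=> [s t] /= sE; have -> : 2 * unit_val s = 1 by lra.
    by rewrite subrr K0 H1.
- move=> t; rewrite /fst /snd to_unit0 ifT; last by lra.
  by rewrite mulr0 H0.
- move=> t; rewrite /fst /snd to_unit1 ifF; last by apply/negbTE; lra.
  by rewrite (_ : 2 * 1 - 1 = 1) ?K1 //; lra.
- by move=> s t bt; case: ifP => _; [exact: Hb|exact: Kb].
Qed.

Definition homotopic_rel (f g : loop) : bool := `[< homotopic f g >].

Fact homotopic_rel_refl : reflexive homotopic_rel.
Proof. by move=> f; apply/asboolP; exact: homotopic_refl. Qed.

Fact homotopic_rel_sym : symmetric homotopic_rel.
Proof.
by move=> f g; apply/idP/idP => /asboolP h; apply/asboolP; exact: homotopic_sym.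
Qed.

Fact homotopic_rel_trans : transitive homotopic_rel.
Proof.
move=> g f h /asboolP fg /asboolP gh; apply/asboolP.
exact: homotopic_trans fg gh.
Qed.

Definition homotopic_equiv :=
  EquivRel homotopic_rel homotopic_rel_refl homotopic_rel_sym homotopic_rel_trans.

(* Classes of maps (I^p, boundary) -> (X, x0) up to homotopy relative to the
   boundary. The group structure, for p > 0, is given after [hmulrV]. *)
Definition homotopy_group := {eq_quot homotopic_equiv}.

HB.instance Definition _ := Choice.on homotopy_group.
HB.instance Definition _ := Quotient.on homotopy_group.

Lemma homotopy_classP (f g : loop) :
  \pi_homotopy_group f = \pi_homotopy_group g <-> homotopic f g.
Proof.
split=> [/eqmodP/asboolP //|fg]; apply/eqmodP/asboolP; exact: fg.
Qed.

End HomotopyGroup.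

Section HomotopyGroupLaw.
Context (R : realType) (p : nat) (X : topologicalType) (x0 : X).
Local Notation I := (@unit_interval R).
Local Notation cube := (@cube R p.+1).
Local Notation loop := (@loop R p.+1 X x0).
Local Notation hpi := (@homotopy_group R p.+1 X x0).

(* Concatenation along the first coordinate *)
Definition concat_fun (f g : cube -> X) (t : cube) : X :=
  if unit_val (t ord0) <= 2^-1
  then f (set_first t (to_unit (2 * unit_val (t ord0))))
  else g (set_first t (to_unit (2 * unit_val (t ord0) - 1))).

Definition reverse_fun (f : cube -> X) (t : cube) : X :=
  f (set_first t (to_unit (1 - unit_val (t ord0)))).

Lemma set_firstE (t : cube) x : set_first t x ord0 = x.
Proof. by rewrite /set_first eqxx. Qed.

Lemma set_first_set_first (t : cube) x y :
  set_first (set_first t x) y = set_first t y.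
Proof. by apply/funext => i; rewrite /set_first; case: (i == ord0). Qed.

Lemma set_first_id (t : cube) : set_first t (t ord0) = t.
Proof. by apply/funext => i; rewrite /set_first; case: eqP => [->|]. Qed.

Lemma boundary_set_first (t : cube) x :
  unit_val x = 0 \/ unit_val x = 1 -> cube_boundary (set_first t x).
Proof. by move=> h; exists ord0; rewrite set_firstE. Qed.

Lemma boundary_cases (t : cube) (P : Prop) :
  (unit_val (t ord0) = 0 -> P) -> (unit_val (t ord0) = 1 -> P) ->
  ((forall x, cube_boundary (set_first t x)) -> P) -> cube_boundary t -> P.
Proof.
move=> h0 h1 h [i ti]; have [i0|i0] := eqVneq i ord0.
  by rewrite i0 in ti; case: ti.
by apply: h => x; exists i; rewrite /set_first (negbTE i0).
Qed.

Lemma cts_first : continuous (fun t : cube => unit_val (t ord0)).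
Proof. exact: (cts_comp (@cts_coord R p.+1 ord0) (@cts_val R)). Qed.

Lemma cts_double (Y : topologicalType) (u : Y -> R) (a : R) :
  continuous u -> continuous (fun y => to_unit (2 * u y + a)).
Proof.
move=> cu; apply: cts_comp (@cts_to_unit R); apply: cts_add (@cts_cst _ _ a).
exact: (cts_mul (@cts_cst _ R 2) cu).
Qed.

Lemma cts_double0 (Y : topologicalType) (u : Y -> R) :
  continuous u -> continuous (fun y => to_unit (2 * u y)).
Proof.
move=> /(cts_double (a := 0)).
by under [X in continuous X -> _]eq_fun do rewrite addr0.
Qed.

Lemma cts_concat_param (Y : topologicalType) (F G : Y * cube -> X) :
  continuous F -> continuous G ->
  (forall y t, cube_boundary t -> F (y, t) = x0) ->
  (forall y t, cube_boundary t -> G (y, t) = x0) ->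
  continuous (fun z : Y * cube =>
    concat_fun (fun t => F (z.1, t)) (fun t => G (z.1, t)) z.2).
Proof.
move=> cF cG bF bG.
have c1 := cts_comp (@cts_snd Y cube) cts_first.
rewrite /concat_fun.
apply: (@cts_paste R _ _ (fun z : Y * cube => unit_val (z.2 ord0)) 2^-1
  (fun z => F (z.1, set_first z.2 (to_unit (2 * unit_val (z.2 ord0)))))
  (fun z => G (z.1, set_first z.2 (to_unit (2 * unit_val (z.2 ord0) - 1))))) => //.
- apply: cts_comp cF; apply: cts_pair (@cts_fst _ _) _.
  exact: (cts_set_first (@cts_snd _ _) (cts_double0 c1)).
- apply: cts_comp cG; apply: cts_pair (@cts_fst _ _) _.
  exact: (cts_set_first (@cts_snd _ _) (cts_double (a := -1) c1)).
- move=> [y t] /= tE; have -> : 2 * unit_val (t ord0) = 1 by lra.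
  rewrite subrr bF ?bG //.
    by apply: boundary_set_first; left; rewrite to_unit0.
  by apply: boundary_set_first; right; rewrite to_unit1.
Qed.

Lemma concat_boundary (f g : cube -> X) :
  (forall t, cube_boundary t -> f t = x0) ->
  (forall t, cube_boundary t -> g t = x0) ->
  forall t, cube_boundary t -> concat_fun f g t = x0.
Proof.
move=> bf bg t; rewrite /concat_fun; apply: boundary_cases => [->|->|bt].
- rewrite mulr0 ifT ?bf //; last by lra.
  by apply: boundary_set_first; left; rewrite to_unit0.
- rewrite ifF ?bg //; last by apply/negbTE; lra.
  by apply: boundary_set_first; right; rewrite to_unitK; lra.
- by case: ifP => _; [exact: bf|exact: bg].
Qed.

Fact concat_continuous (f g : loop) : continuous (concat_fun f g).
Proof.
have cF (h : loop) : continuous (fun z : I * cube => h z.2).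
  exact: (cts_comp (@cts_snd _ _) (@loop_continuous _ _ _ _ h)).
have cid : continuous (fun t : cube => t) by move=> t; exact: cvg_id.
exact: (cts_comp (cts_pair (@cts_cst cube I (to_unit 0)) cid)
  (cts_concat_param (cF f) (cF g) (fun _ t => @loop_boundary _ _ _ _ f t)
    (fun _ t => @loop_boundary _ _ _ _ g t))).
Qed.

Definition concat (f g : loop) : loop :=
  Loop (@concat_continuous f g)
    (concat_boundary (@loop_boundary _ _ _ _ f) (@loop_boundary _ _ _ _ g)).

Fact reverse_continuous (f : loop) : continuous (reverse_fun f).
Proof.
have cid : continuous (fun t : cube => t) by move=> t; exact: cvg_id.
apply: cts_comp (@loop_continuous _ _ _ _ f); apply: (cts_set_first cid).
apply: cts_comp (@cts_to_unit R); apply: (cts_add (@cts_cst _ R 1)).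
exact: (cts_opp cts_first).
Qed.

Fact reverse_boundary (f : cube -> X) :
  (forall t, cube_boundary t -> f t = x0) ->
  forall t, cube_boundary t -> reverse_fun f t = x0.
Proof.
move=> bf t; rewrite /reverse_fun; apply: boundary_cases => [->|->|bt].
- by rewrite subr0 bf //; apply: boundary_set_first; right; rewrite to_unit1.
- by rewrite subrr bf //; apply: boundary_set_first; left; rewrite to_unit0.
- exact: bf.
Qed.

Definition reverse (f : loop) : loop :=
  Loop (@reverse_continuous f) (reverse_boundary (@loop_boundary _ _ _ _ f)).

Fact const_continuous : continuous (fun _ : cube => x0).
Proof. exact: cts_cst. Qed.

Definition const_loop : loop := Loop const_continuous (fun _ _ => erefl).

Lemma concat_homotopic (f f' g g' : cube -> X) :
  homotopic x0 f f' -> homotopic x0 g g' ->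
  homotopic x0 (concat_fun f g) (concat_fun f' g').
Proof.
case=> H [cH H0 H1 Hb] [K [cK K0 K1 Kb]].
exists (fun z => concat_fun (fun t => H (z.1, t)) (fun t => K (z.1, t)) z.2); split.
- exact: cts_concat_param.
- by move=> t; rewrite /concat_fun /= H0 K0.
- by move=> t; rewrite /concat_fun /= H1 K1.
- by move=> s t; apply: concat_boundary; [exact: Hb|exact: Kb].
Qed.

Lemma reverse_homotopic (f f' : cube -> X) :
  homotopic x0 f f' -> homotopic x0 (reverse_fun f) (reverse_fun f').
Proof.
case=> H [cH H0 H1 Hb].
exists (fun z => reverse_fun (fun t => H (z.1, t)) z.2); split.
- apply: cts_comp cH; apply: cts_pair (@cts_fst _ _) _.
  apply: (cts_set_first (@cts_snd _ _)); apply: cts_comp (@cts_to_unit R).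
  apply: (cts_add (@cts_cst _ R 1)); apply: cts_opp.
  exact: (cts_comp (@cts_snd _ _) cts_first).
- by move=> t; rewrite /reverse_fun /= H0.
- by move=> t; rewrite /reverse_fun /= H1.
- by move=> s t; apply: reverse_boundary; exact: Hb.
Qed.

Definition reparam (f : cube -> X) (phi : R -> R) (t : cube) : X :=
  f (set_first t (to_unit (phi (unit_val (t ord0))))).

Lemma homotopic_reparam (f : loop) (phi psi : R -> R) :
  continuous phi -> continuous psi ->
  (forall x, 0 <= x <= 1 -> 0 <= phi x <= 1) ->
  (forall x, 0 <= x <= 1 -> 0 <= psi x <= 1) ->
  phi 0 = psi 0 -> phi 1 = psi 1 ->
  phi 0 = 0 \/ phi 0 = 1 -> phi 1 = 0 \/ phi 1 = 1 ->
  homotopic x0 (reparam f phi) (reparam f psi).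
Proof.
move=> cphi cpsi phiI psiI e0 e1 b0 b1.
exists (fun z => reparam f (fun x => (1 - unit_val z.1) * phi x + unit_val z.1 * psi x) z.2).
split.
- apply: cts_comp (@loop_continuous _ _ _ _ f).
  apply: (cts_set_first (@cts_snd _ _)); apply: cts_comp (@cts_to_unit R).
  have c1 := cts_comp (@cts_fst I cube) (@cts_val R).
  have c2 := cts_comp (@cts_snd I cube) cts_first.
  apply: cts_add; apply: cts_mul.
  + by apply: cts_add; [exact: cts_cst|exact: cts_opp].
  + exact: (cts_comp c2 cphi).
  + exact: c1.
  + exact: (cts_comp c2 cpsi).
- by move=> t; rewrite /reparam /= to_unit0 subr0 mul1r mul0r addr0.
- by move=> t; rewrite /reparam /= to_unit1 subrr mul1r mul0r add0r.
- move=> s t; rewrite /reparam /=; apply: boundary_cases => [->|->|bt].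
  + rewrite -e0 -mulrDl subrK mul1r; apply: loop_boundary; apply: boundary_set_first.
    by rewrite to_unitK // phiI // lexx ler01.
  + rewrite -e1 -mulrDl subrK mul1r; apply: loop_boundary; apply: boundary_set_first.
    by rewrite to_unitK // phiI // lexx ler01.
  + exact: loop_boundary.
Qed.

Lemma reparam_id (f : cube -> X) : reparam f id = f.
Proof. by apply/funext => t; rewrite /reparam valK_unit set_first_id. Qed.

Definition hmul (a b : hpi) : hpi := \pi_hpi (concat (repr a) (repr b)).
Definition hinv (a : hpi) : hpi := \pi_hpi (reverse (repr a)).
Definition hone : hpi := \pi_hpi const_loop.

Lemma hmulE (f g : loop) : hmul (\pi_hpi f) (\pi_hpi g) = \pi_hpi (concat f g).
Proof.
apply/homotopy_classP; apply: concat_homotopic; apply/homotopy_classP; exact: reprK.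
Qed.

Lemma hinvE (f : loop) : hinv (\pi_hpi f) = \pi_hpi (reverse f).
Proof.
apply/homotopy_classP; apply: reverse_homotopic; apply/homotopy_classP; exact: reprK.
Qed.

Lemma cts_twice : continuous (fun x : R => 2 * x).
Proof. by apply: cts_mul; [exact: cts_cst|move=> x; exact: cvg_id]. Qed.

Lemma concat_funE (f g : cube -> X) (t : cube) (x : R) : 0 <= x <= 1 ->
  concat_fun f g (set_first t (to_unit x)) =
  if x <= 2^-1 then f (set_first t (to_unit (2 * x)))
  else g (set_first t (to_unit (2 * x - 1))).
Proof. by move=> xI; rewrite /concat_fun set_firstE to_unitK // !set_first_set_first. Qed.

Lemma reverse_funE (f : cube -> X) (t : cube) (x : R) : 0 <= x <= 1 ->
  reverse_fun f (set_first t (to_unit x)) = f (set_first t (to_unit (1 - x))).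
Proof. by move=> xI; rewrite /reverse_fun set_firstE to_unitK // !set_first_set_first. Qed.

Fact hmulA : associative hmul.
Proof.
elim/quotW => f; elim/quotW => g; elim/quotW => h.
rewrite (hmulE g h) (hmulE f g) (hmulE f (concat g h)) (hmulE (concat f g) h).
apply/homotopy_classP.
pose phi (x : R) := Num.min (2 * x) (Num.min (x + 4^-1) (2^-1 * (x + 1))).
have phiI (x : R) : 0 <= x <= 1 -> 0 <= phi x <= 1.
  by move=> xI; rewrite /phi; min_lra.
have cid : continuous (fun x : R => x) by move=> x; exact: cvg_id.
have cphi : continuous phi.
  apply: (cts_min cts_twice); apply: cts_min.
    exact: (cts_add cid (@cts_cst R R 4^-1)).
  exact: (cts_mul (@cts_cst R R 2^-1) (cts_add cid (@cts_cst R R 1))).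
change (homotopic x0 (concat_fun f (concat_fun g h)) (concat_fun (concat_fun f g) h)).
rewrite -(reparam_id (concat_fun f (concat_fun g h))).
have -> : concat_fun (concat_fun f g) h = reparam (concat_fun f (concat_fun g h)) phi.
  apply/funext => t; have := unitP (t ord0).
  rewrite /reparam {1}/concat_fun; move: (unit_val _) => u uI.
  rewrite [RHS]concat_funE ?phiI //.
  case: (lerP u 2^-1) => u2.
  - rewrite [LHS]concat_funE; last by lra.
    case: (lerP (2 * u) 2^-1) => u4.
    + have -> : phi u = 2 * u by rewrite /phi; min_lra.
      by rewrite u4.
    + have -> : phi u = u + 4^-1 by rewrite /phi; min_lra.
      rewrite ifF; last by apply/negbTE; lra.
      rewrite [RHS]concat_funE; last by lra.
      rewrite ifT; last by lra.
      by congr (g (set_first t (to_unit _))); lra.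
  - have -> : phi u = 2^-1 * (u + 1) by rewrite /phi; min_lra.
    rewrite ifF; last by apply/negbTE; lra.
    rewrite [RHS]concat_funE; last by lra.
    rewrite ifF; last by apply/negbTE; lra.
    by congr (h (set_first t (to_unit _))); lra.
have e0 : phi 0 = 0 by rewrite /phi; min_lra.
have e1 : phi 1 = 1 by rewrite /phi; min_lra.
apply: (@homotopic_reparam (concat f (concat g h)) id phi) => //.
  by left.
by right.
Qed.

Lemma homotopic_reparam_id (f : loop) (phi : R -> R) :
  continuous phi -> (forall x, 0 <= x <= 1 -> 0 <= phi x <= 1) ->
  phi 0 = 0 -> phi 1 = 1 -> homotopic x0 (reparam f phi) f.
Proof.
move=> cphi phiI e0 e1; rewrite -[X in homotopic _ _ X]reparam_id.
have cid : continuous (fun x : R => x) by move=> x; exact: cvg_id.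
by apply: homotopic_reparam => //; rewrite ?e0 ?e1; [left|right].
Qed.

Lemma homotopic_reparam_cst (f : loop) (phi : R -> R) (e : R) :
  continuous phi -> (forall x, 0 <= x <= 1 -> 0 <= phi x <= 1) ->
  e = 0 \/ e = 1 -> phi 0 = e -> phi 1 = e ->
  homotopic x0 (reparam f phi) const_loop.
Proof.
move=> cphi phiI ee e0 e1.
have eI : 0 <= e <= 1 by case: ee => ->; rewrite lexx ler01.
have -> : loop_fun const_loop = reparam f (fun=> e).
  apply/funext => t; rewrite /reparam; symmetry; apply: loop_boundary.
  by apply: boundary_set_first; rewrite to_unitK.
by apply: homotopic_reparam => //; rewrite ?e0 ?e1 //; exact: cts_cst.
Qed.

Lemma concat_constl (f : loop) :
  concat_fun const_loop f = reparam f (fun x => Num.max 0 (2 * x - 1)).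
Proof.
apply/funext => t; rewrite /reparam /concat_fun.
have := unitP (t ord0); move: (unit_val _) => u uI.
case: (lerP u 2^-1) => u2.
  rewrite max_l; last by lra.
  by rewrite [RHS]loop_boundary //; apply: boundary_set_first; left; rewrite to_unit0.
by rewrite max_r //; lra.
Qed.

Lemma concat_constr (f : loop) :
  concat_fun f const_loop = reparam f (fun x => Num.min 1 (2 * x)).
Proof.
apply/funext => t; rewrite /reparam /concat_fun.
have := unitP (t ord0); move: (unit_val _) => u uI.
case: (lerP u 2^-1) => u2.
  by rewrite min_r //; lra.
rewrite min_l; last by lra.
by rewrite [RHS]loop_boundary //; apply: boundary_set_first; right; rewrite to_unit1.
Qed.

Lemma concat_reversel (f : loop) :
  concat_fun (reverse_fun f) f = reparam f (fun x => Num.max (1 - 2 * x) (2 * x - 1)).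
Proof.
apply/funext => t; rewrite /reparam /concat_fun.
have := unitP (t ord0); move: (unit_val _) => u uI.
case: (lerP u 2^-1) => u2.
  rewrite [LHS]reverse_funE; last by lra.
  by rewrite max_l //; lra.
by rewrite max_r //; lra.
Qed.

Lemma concat_reverser (f : loop) :
  concat_fun f (reverse_fun f) = reparam f (fun x => Num.min (2 * x) (2 - 2 * x)).
Proof.
apply/funext => t; rewrite /reparam /concat_fun.
have := unitP (t ord0); move: (unit_val _) => u uI.
case: (lerP u 2^-1) => u2.
  by rewrite min_l //; lra.
rewrite [LHS]reverse_funE; last by lra.
rewrite min_r; last by lra.
by congr (f (set_first t (to_unit _))); lra.
Qed.

Fact hmul1 : left_id hone hmul.
Proof.
elim/quotW => f; rewrite hmulE; apply/homotopy_classP.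
change (homotopic x0 (concat_fun const_loop f) f); rewrite concat_constl.
apply: homotopic_reparam_id.
- apply: cts_max; first exact: cts_cst.
  apply: cts_add (@cts_cst R R _); apply: cts_mul; first exact: cts_cst.
  by move=> x; exact: cvg_id.
- by move=> x xI; min_lra.
- by min_lra.
- by min_lra.
Qed.

Fact hmulr1 : right_id hone hmul.
Proof.
elim/quotW => f; rewrite hmulE; apply/homotopy_classP.
change (homotopic x0 (concat_fun f const_loop) f); rewrite concat_constr.
apply: homotopic_reparam_id.
- apply: cts_min; first exact: cts_cst.
  apply: cts_mul; first exact: cts_cst.
  by move=> x; exact: cvg_id.
- by move=> x xI; min_lra.
- by min_lra.
- by min_lra.
Qed.

Fact hmulV : left_inverse hone hinv hmul.
Proof.
elim/quotW => f; rewrite hinvE hmulE; apply/homotopy_classP.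
change (homotopic x0 (concat_fun (reverse_fun f) f) const_loop).
rewrite concat_reversel; apply: (@homotopic_reparam_cst _ _ 1).
- apply: cts_max.
  + by apply: (cts_add (@cts_cst R R 1)); apply: cts_opp; exact: cts_twice.
  + exact: (cts_add cts_twice (@cts_cst R R (-1))).
- by move=> x xI; min_lra.
- by right.
- by min_lra.
- by min_lra.
Qed.

Fact hmulrV : right_inverse hone hinv hmul.
Proof.
elim/quotW => f; rewrite hinvE hmulE; apply/homotopy_classP.
change (homotopic x0 (concat_fun f (reverse_fun f)) const_loop).
rewrite concat_reverser; apply: (@homotopic_reparam_cst _ _ 0).
- apply: (cts_min cts_twice).
  by apply: (cts_add (@cts_cst R R 2)); apply: cts_opp; exact: cts_twice.
- by move=> x xI; min_lra.
- by left.
- by min_lra.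
- by min_lra.
Qed.

HB.instance Definition _ := isGroup.Build hpi hmulA hmul1 hmulr1 hmulV hmulrV.

End HomotopyGroupLaw.

Section ConfigurationSpaces.
Context (R : realType) (m : nat).

Definition sphere : topologicalType :=
  [set v : 'rV[R]_m.+1 | \sum_j v 0 j ^+ 2 = 1].

Definition nonzero_vector : topologicalType := [set v : 'rV[R]_m.+1 | v != 0].

Definition sphere_vec (x : sphere) : 'rV[R]_m.+1 := val x.

Definition nonzero_vec (v : nonzero_vector) : 'rV[R]_m.+1 := val v.

Lemma nonzero_vec_neq0 (v : nonzero_vector) : nonzero_vec v != 0.
Proof. exact: (set_mem (valP v)). Qed.

Lemma sphere_vec_neq0 (x : sphere) : sphere_vec x != 0.
Proof.
apply/eqP => x0; have := set_mem (valP x); rewrite /= -/(sphere_vec x) x0.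
rewrite big1 => [/esym/eqP|j _]; first by rewrite oner_eq0.
by rewrite mxE expr0n.
Qed.

Definition mk_nonzero (v : 'rV[R]_m.+1) (v0 : v != 0) : nonzero_vector :=
  exist (fun z => z \in [set v : 'rV[R]_m.+1 | v != 0]) v (mem_set v0).

Definition proportional (v w : nonzero_vector) : bool :=
  `[< exists2 c : R, c != 0 & nonzero_vec w = c *: nonzero_vec v >].

Fact proportional_refl : reflexive proportional.
Proof. by move=> v; apply/asboolP; exists 1; rewrite ?oner_eq0 // scale1r. Qed.

Fact proportional_sym : symmetric proportional.
Proof.
suff h v w : proportional v w -> proportional w v by move=> v w; apply/idP/idP; exact: h.
move=> /asboolP[c c0 wE]; rewrite /proportional wE; apply/asboolP; exists c^-1.
  by rewrite invr_eq0.
by rewrite scalerA mulVf // scale1r.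
Qed.

Fact proportional_trans : transitive proportional.
Proof.
move=> w v u /asboolP[c c0 cE] /asboolP[d d0 dE]; apply/asboolP.
by exists (d * c); rewrite ?mulf_neq0 // dE cE scalerA.
Qed.

Definition proportional_equiv :=
  EquivRel proportional proportional_refl proportional_sym proportional_trans.

(* P(R^(m+1)), with the quotient topology from R^(m+1) minus the origin *)
Definition projective_space : topologicalType :=
  quotient_topology {eq_quot proportional_equiv}.

Definition proj_class (v : nonzero_vector) : projective_space :=
  \pi_({eq_quot proportional_equiv}) v.

Definition proj_repr (q : projective_space) : nonzero_vector :=
  repr (q : {eq_quot proportional_equiv}).

Definition proj_vec (q : projective_space) : 'rV[R]_m.+1 := nonzero_vec (proj_repr q).

Lemma proj_reprK (q : projective_space) : proj_class (proj_repr q) = q.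
Proof. exact: reprK. Qed.

Lemma proj_classP (v w : nonzero_vector) :
  proj_class v = proj_class w <->
  exists2 c : R, c != 0 & nonzero_vec w = c *: nonzero_vec v.
Proof. by split=> [/eqmodP/asboolP //|h]; apply/eqmodP/asboolP; exact: h. Qed.

Definition sphere_proj (x : sphere) : projective_space :=
  proj_class (mk_nonzero (sphere_vec_neq0 x)).

(* Instantiated below with [vec] sending a point of the sphere to itself as a
   vector, and a point of projective space to a chosen spanning vector; by
   [config_projectiveP] the choice does not matter. *)
Definition config_set (k n : nat) (M : topologicalType) (vec : M -> 'rV[R]_m.+1) :
    set (prod_topology (fun _ : 'I_n => M)) :=
  [set x | forall A : {set 'I_n}, #|A| = k -> free [seq vec (x i) | i <- enum A]].

Definition config_sphere (k n : nat) : topologicalType := @config_set k n sphere sphere_vec.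

Definition config_projective (k n : nat) : topologicalType :=
  @config_set k n projective_space proj_vec.

Lemma free_scaled (T : eqType) (s : seq T) (v w : T -> 'rV[R]_m.+1) :
  (forall i, exists2 c : R, c != 0 & w i = c *: v i) ->
  free [seq v i | i <- s] = free [seq w i | i <- s].
Proof.
move=> vw; have spanE r : <<[seq v i | i <- r]>>%VS = <<[seq w i | i <- r]>>%VS.
  elim: r => [//|i r IH] /=; rewrite !span_cons IH; congr (_ + _)%VS.
  have [c c0 ->] := vw i; apply/eqP; rewrite eqEsubv -!memvE.
  apply/andP; split; last by rewrite memvZ ?memv_line.
  by rewrite -{1}[v i](scalerK c0) memvZ ?memv_line.
elim: s => [//|i s IH] /=; rewrite !free_cons IH spanE; congr (~~ _ && _).
have [c c0 ->] := vw i; apply/idP/idP; first exact: memvZ.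
by move=> h; rewrite -[v i](scalerK c0) memvZ.
Qed.

Lemma config_projectiveP (k n : nat) (q : 'I_n -> nonzero_vector) :
  @config_set k n projective_space proj_vec
    (fun i => proj_class (q i)) <->
  forall A : {set 'I_n}, #|A| = k -> free [seq nonzero_vec (q i) | i <- enum A].
Proof.
split=> h A cA; have := h A cA; rewrite (@free_scaled _ _
  (fun i => proj_vec (proj_class (q i))) (fun i => nonzero_vec (q i))) // => i;
  by apply/proj_classP; rewrite proj_reprK.
Qed.

Fact config_image_subproof (k n : nat) (x : config_sphere k n) :
  @config_set k n projective_space proj_vec
    (fun i => sphere_proj (val x i)).
Proof. by apply/config_projectiveP => A cA; exact: (set_mem (valP x)). Qed.

Definition config_image (k n : nat) (x : config_sphere k n) : config_projective k n :=
  exist (fun y => y \in @config_set k n projective_space proj_vec)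
    (fun i => sphere_proj (val x i)) (mem_set (config_image_subproof x)).

Fact delta_neq0 (j : 'I_m.+1) : delta_mx 0 j != 0 :> 'rV[R]_m.+1.
Proof.
apply/eqP => /rowP/(_ j); rewrite !mxE !eqxx => /eqP; rewrite oner_eq0.
by [].
Qed.

Definition basis_vector (j : 'I_m.+1) : nonzero_vector := mk_nonzero (delta_neq0 j).

Lemma free_delta (s : seq 'I_m.+1) :
  uniq s -> free [seq (delta_mx 0 j : 'rV[R]_m.+1) | j <- s].
Proof.
elim: s => [_|j s IH /= /andP[js us]]; first exact: nil_free.
rewrite free_cons IH // andbT; apply/negP => jX.
have /rowP/(_ j) := coord_span (X := in_tuple [seq delta_mx 0 i | i <- s]) jX.
rewrite mxE !eqxx summxE big1 => [/eqP|i _]; first by rewrite oner_eq0.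
have isz : (i < size s)%N by case: i => i /=; rewrite size_map.
rewrite mxE (nth_map j) // mxE andTb; case: eqP => [jE|]; last by rewrite mulr0.
by rewrite jE mem_nth in js.
Qed.

Fact basis_config_subproof (k n : nat) (nm : (n <= m.+1)%N) :
  @config_set k n projective_space proj_vec
    (fun i => proj_class (basis_vector (widen_ord nm i))).
Proof.
apply/config_projectiveP => A _.
have := @free_delta [seq widen_ord nm i | i <- enum A].
rewrite -map_comp; apply; rewrite map_inj_uniq ?enum_uniq //.
by move=> i j /(congr1 val) /= /val_inj.
Qed.

Arguments basis_config_subproof : clear implicits.

Definition basis_config (k n : nat) (nm : (n <= m.+1)%N) : config_projective k n :=
  exist (fun y => y \in @config_set k n projective_space proj_vec)
    (fun i => proj_class (basis_vector (widen_ord nm i)))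
    (mem_set (basis_config_subproof k n nm)).

End ConfigurationSpaces.

Lemma isog_center_Q8_D8 : ('Z('Q_8) \isog 'Z('D_8))%g.
Proof.
have [[x y] gQ _] := @generators_quaternion _ 'Q_8%G 3 isT (isog_refl _).
have [_ _ [_ cQ _ _ _] _ _] := @quaternion_structure _ _ 3 _ _ isT gQ (isog_refl _).
have [[x' y'] gD _] := @generators_2dihedral _ 'D_8%G 3 isT (isog_refl _).
have [_ _ _ _ [_ cD _ _ _]] := @dihedral2_structure _ _ 3 _ _ isT gD (isog_refl _).
by rewrite isog_cyclic_card ?prime_cyclic ?cQ ?cD.
Qed.

(* [xcprod] identifies the two centers only when they are isomorphic, which is
   [isog_center_Q8_D8]; having order 2 they are isomorphic in a unique way. *)
Definition Q8_central_D8 : finGroupType := xcprod 'Q_8%G 'D_8%G.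

(* Main.v *)
Require Import Defs.
From HB Require Import structures.
From mathcomp Require Import all_boot all_order all_algebra all_fingroup all_solvable.
From mathcomp Require Import generic_quotient.
From mathcomp Require Import all_classical all_reals topology normedtype realfun.
From mathcomp Require Import ring lra.

Set Implicit Arguments.
Unset Strict Implicit.
Unset Printing Implicit Defensive.

Import Order.TTheory GRing.Theory Num.Theory.
Import numFieldNormedType.Exports.

Local Open Scope classical_set_scope.
Local Open Scope ring_scope.
Local Open Scope quotient_scope.

(** Sending a configuration of unit vectors to the lines that they span is a covering
    ([config_covering]), and a covering induces isomorphisms on homotopy groups of
    dimension at least two ([covering_higher_homotopy]): a map from a cube lifts from a corner, and its lift
    is constant on the boundary because the boundary of a cube of dimension at least two
    is connected. This is (a).

    For (b), let a group [G] act on the total space [E] of a covering of [X], simply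
    transitively on the fibres. If the base point of [E] is joined to all its translates,
    and if the loops of [E] become trivial in [X], then the fundamental group of [X] is
    [G] ([fundamental_group_of_covering]). The total spaces are as follows.

    Gram-Schmidt orthonormalisation deforms a loop of [n] independent unit vectors of
    Euclidean space of dimension [m + 1] to a loop of orthonormal frames
    ([homotopic_gram_schmidt]). The first vector of a loop of frames is a loop in a
    sphere; if that sphere has dimension at least two the loop is null-homotopic
    ([supp_sphere_loop_null]), and the whole frame can be carried along the homotopy, after
    which the first vector is constant and the next one can be treated in its orthogonal
    complement. In this way the first [m - 1] vectors become constant ([config_reduce]).

    If [n < m] nothing else is left: spherical configurations are simply connected, the
    group of the [n] sign changes acts on them, and this gives the first case
    ([fundamental_group_few_points]).

    If [n = m <= 4], spherical configurations retract to the frames of [m] vectors, that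
    is, to the rotation group of dimension [m + 1], which has a double covering by the spin
    group. Adding [o = 4 - m] fixed vectors puts all the cases inside Euclidean
    five-space, the span of the five letters of the Clifford algebra on four generators of
    square one, the fifth letter being the product of the generators. A configuration is
    covered by the unitary elements [U] of the algebra that conjugate the letters to its
    frame; there are two of them, [U] and [- U], and [spin_covering] shows that this is a
    covering. A lift to the spin group of a loop whose first [m - 2] vectors are constant
    takes its values in the unit quaternions, a three-sphere, so it is null-homotopic
    ([spin_loop_null]). The group [G] now consists of the signed products of letters
    (signed blades) that commute with the [o] added letters: conjugation by a blade changes
    the signs of letters, and any sign change arises from such an element and its opposite
    only. Hence [fundamental_group_spin].

    It remains to recognise these finite groups. The sixteen blades with their signs form
    a group of order 32, in which the blades that commute with the first two letters are a
    quaternion group and the commutant of the latter is a dihedral group; the whole group is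
    their central product ([signed_isog], [m = 4]). With two letters fixed the quaternion
    group remains ([m = 2]), and with one fixed letter the quaternion group times the group
    of order two generated by that letter ([m = 3]). *)

(** * Lifting homotopies along a transport *)

Section Lifting.
Context {R : realType}.
Local Notation I := (@unit_interval R).
Local Notation cube := (@Defs.cube R).

Lemma cts_id (X : topologicalType) : continuous (fun x : X => x).
Proof. by move=> x; exact: cvg_id. Qed.

Lemma unit_ge0 (x : I) : 0 <= unit_val x.
Proof. by have /andP[] := Defs.unitP x. Qed.

Lemma unit_le1 (x : I) : unit_val x <= 1.
Proof. by have /andP[] := Defs.unitP x. Qed.

Lemma unit_compact : compact [set: I].
Proof.
have <- : @to_unit R @` [set` `[0 : R, 1]] = setT.
  apply/seteqP; split=> // x _; exists (unit_val x); last exact: valK_unit.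
  by rewrite /= in_itv /= Defs.unitP.
apply: continuous_compact; last exact: segment_compact.
by apply: continuous_subspaceT; exact: cts_to_unit.
Qed.

Lemma cube_compact p : compact [set: cube p].
Proof.
have := @tychonoff 'I_p (fun=> I) (fun=> setT) (fun=> unit_compact).
by congr (compact _); apply/seteqP; split.
Qed.

Lemma min_unit (x y : R) : 0 <= x <= 1 -> 0 <= y <= 1 -> 0 <= Num.min x y <= 1.
Proof. by move=> /andP[a b] /andP[c d]; rewrite le_min a c ge_min b. Qed.

(** The cylinder is compact, so a relation that holds near the diagonal of [B] holds
    uniformly between the values of [H] at two close times. *)
Lemma uniform_step (B : topologicalType) (U : B -> B -> Prop) p (H : I * cube p -> B) :
  continuous H -> (forall z, \forall w \near (H z, H z), U w.1 w.2) ->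
  exists N : nat, forall y, `|y| <= N.+1%:R^-1 -> forall z : I * cube p,
    U (H z) (H (to_unit (unit_val z.1 + y), z.2)).
Proof.
move=> cH hU.
have [e e0 small] : exists2 e : R, 0 < e & forall y, `|y| < e -> forall z : I * cube p,
    U (H z) (H (to_unit (unit_val z.1 + y), z.2)).
  have ccube : compact [set: I * cube p].
    by rewrite -setXTT; apply: compact_setX; [exact: unit_compact|exact: cube_compact].
  have /(_ R (nbhs (0 : R)) (fun y z => U (H z) (H (to_unit (unit_val z.1 + y), z.2)))
    _ _) := (compact_near_coveringP _).1 ccube.
  case.
    move=> z0 _.
    have cPhi : continuous (fun zy : (I * cube p) * R =>
        (H zy.1, H (to_unit (unit_val zy.1.1 + zy.2), zy.1.2))).
      apply: cts_pair; first exact: (cts_comp (@cts_fst _ _) cH).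
      apply: cts_comp cH; apply: cts_pair.
        apply: cts_comp (@cts_to_unit R); apply: cts_add (@cts_snd _ _).
        exact: (cts_comp (cts_comp (@cts_fst _ _) (@cts_fst _ _)) (@cts_val R)).
      exact: (cts_comp (@cts_fst _ _) (@cts_snd _ _)).
    have := cPhi (z0, 0); rewrite /continuous_at /= addr0 valK_unit -surjective_pairing.
    by move=> /(_ _ (hU z0)).
  move=> e /= e0 he; exists e => // y ye z.
  by apply: he => //=; rewrite sub0r normrN.
have [N Ne] : exists N : nat, N.+1%:R^-1 < e.
  exists (Num.truncn e^-1); rewrite invf_plt ?posrE ?ltr0n //.
  exact: truncnS_gt.
exists N => y yN; apply: small; exact: le_lt_trans Ne.
Qed.

(** [tau e b] moves [e] to the fibre over a point [b] close to [proj e]. Time is cut into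
    steps so small that successive values of [H] are close, and [f] is transported from
    each value to the next. A transport to the fibre of [e] leaves [e] unchanged, so the
    lift rests wherever [H] does. The sets [P] and [Q] let transports be given by formulas
    in an ambient vector space. *)
Lemma homotopy_lifting_transport (E B : topologicalType) (proj : E -> B)
    (P : set E) (Q : set B) (U : B -> B -> Prop) (tau : E -> B -> E) :
  (forall b, Q b -> \forall z \near (b, b), U z.1 z.2) ->
  (forall e b, P e -> Q b -> U (proj e) b ->
    [/\ {for (e, b), continuous (fun z => tau z.1 z.2)}, P (tau e b)
      & proj (tau e b) = b]) ->
  (forall e, P e -> tau e (proj e) = e) ->
  forall p (H : I * cube p -> B) (f : cube p -> E),
    continuous H -> continuous f -> (forall z, Q (H z)) -> (forall t, P (f t)) ->
    (forall t, H (to_unit 0, t) = proj (f t)) ->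
  exists L : I * cube p -> E,
    [/\ continuous L, forall t, L (to_unit 0, t) = f t, forall z, proj (L z) = H z,
        forall z, P (L z)
      & forall t, (forall s, H (s, t) = H (to_unit 0, t)) -> forall s, L (s, t) = f t].
Proof.
move=> hU htau hid p H f cH cf QH Pf Hf.
have [|N small] := @uniform_step _ U p H cH; first by move=> z; exact: hU.
(* [H \o g i] is [H] stopped at time [i / (N + 1)]. *)
pose g (i : nat) (z : I * cube p) : I * cube p :=
  (to_unit (Num.min (unit_val z.1) (i%:R / N.+1%:R)), z.2).
have cg i : continuous (g i).
  apply: cts_pair (@cts_snd _ _); apply: cts_comp (@cts_to_unit R).
  by apply: cts_min; [exact: (cts_comp (@cts_fst _ _) (@cts_val R))|exact: cts_cst].
suff {}main i : (i <= N.+1)%N -> exists L : I * cube p -> E,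
    [/\ continuous L, forall t, L (to_unit 0, t) = f t, forall z, proj (L z) = H (g i z),
        forall z, P (L z)
      & forall t, (forall s, H (s, t) = H (to_unit 0, t)) -> forall s, L (s, t) = f t].
  have [L [cL L0 LH LP Lc]] := main _ (leqnn _); exists L; split=> // z.
  rewrite LH /g divff ?pnatr_eq0 // min_l ?valK_unit -?surjective_pairing //.
  exact: unit_le1.
elim: i => [_|i IH iN].
  exists (fun z => f z.2); split=> //; first exact: (cts_comp (@cts_snd _ _) cf).
  move=> z; rewrite /g mul0r min_r -?Hf //.
  exact: unit_ge0.
have [L [cL L0 LH LP Lc]] := IH (ltnW iN).
have iI k : (k <= N.+1)%N -> 0 <= (k%:R / N.+1%:R : R) <= 1.
  by move=> kN; rewrite divr_ge0 ?ler0n // ler_pdivrMr ?ltr0n // mul1r ler_nat.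
have step z : U (proj (L z)) (H (g i.+1 z)).
  rewrite LH; have uI := Defs.unitP z.1.
  set b := Num.min (unit_val z.1) (i.+1%:R / N.+1%:R).
  set a := Num.min (unit_val z.1) (i%:R / N.+1%:R).
  have ab : `|b - a| <= N.+1%:R^-1.
    rewrite /a /b -[i.+1%:R]natr1 mulrDl mul1r.
    have : 0 < (N.+1%:R : R)^-1 by rewrite invr_gt0 ltr0n.
    move: (unit_val z.1) (i%:R / _ : R) => x y; move: (_^-1 : R) => d d0; rewrite ler_norml.
    by rewrite !minEle; case: (lerP x (y + d)); case: (lerP x y) => ? ?; lra.
  have := small _ ab (g i z); rewrite /g /=.
  rewrite [unit_val (to_unit (Num.min _ _))]to_unitK; last by apply: min_unit; rewrite ?iI ?(ltnW iN).
  by rewrite addrC subrK.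
have props z := htau _ _ (LP z) (QH _) (step z).
exists (fun z => tau (L z) (H (g i.+1 z))); split.
- move=> z; have [ctau _ _] := props z.
  have := @continuous_comp _ _ _ (fun z => (L z, H (g i.+1 z))) (fun z => tau z.1 z.2) z.
  by apply=> //; apply: cvg_pair; [exact: cL|exact: (cts_comp (cg i.+1) cH)].
- move=> t; have -> : H (g i.+1 (to_unit 0, t)) = proj (L (to_unit 0, t)).
    rewrite L0 -Hf /g /= to_unit0 min_l //.
    by have /andP[] := iI _ iN.
  by rewrite hid ?L0.
- by move=> z; case: (props z).
- by move=> z; case: (props z).
- move=> t Ht s; have -> : H (g i.+1 (s, t)) = proj (L (s, t)).
    by rewrite LH /g /= Ht [RHS]Ht.
  by rewrite hid ?Lc.
Qed.

End Lifting.

(** * Coverings and their effect on homotopy groups *)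

Lemma isomorphic_intro (G H : groupType) (f : G -> H) :
  {morph f : x y / (x * y)%g} -> bijective f -> isomorphic G H.
Proof.
move=> fM bf.
pose F : {multiplicative G -> H} := HB.pack f (isMultiplicative.Build G H f fM).
by exists F.
Qed.

Lemma isomorphic_sym (G H : groupType) : isomorphic G H -> isomorphic H G.
Proof.
move=> [f [g fK gK]]; apply: (@isomorphic_intro _ _ g); last by exists f.
by move=> x y; apply: (can_inj fK); rewrite gmulfM !gK.
Qed.

Lemma bijective_of (A B : Type) (f : A -> B) :
  injective f -> (forall y, exists x, f x = y) -> bijective f.
Proof.
move=> fI /choice[g gK]; exists g => // x.
by apply: fI; rewrite gK.
Qed.

Section Coverings.
Context {R : realType}.
Local Notation I := (@unit_interval R).
Local Notation cube := (@Defs.cube R).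
Implicit Types E B C X : topologicalType.

(** Coverings are given by their lifting properties: homotopies of maps from cubes lift,
    in such a way that points at rest have resting lifts, and paths have at most one lift
    with a given start. *)
Record covering E B (proj : E -> B) : Prop := Covering {
  covering_continuous : continuous proj;
  covering_lift : forall p (H : I * cube p -> B) (f : cube p -> E),
    continuous H -> continuous f -> (forall t, H (to_unit 0, t) = proj (f t)) ->
    exists L : I * cube p -> E,
    [/\ continuous L, forall t, L (to_unit 0, t) = f t, forall z, proj (L z) = H z
      & forall t, (forall s, H (s, t) = H (to_unit 0, t)) -> forall s, L (s, t) = f t];
  covering_unique : forall u v : I -> E, continuous u -> continuous v ->
    (forall s, proj (u s) = proj (v s)) -> u (to_unit 0) = v (to_unit 0) -> u =1 v }.

Lemma covering_comp E B C (f : E -> B) (g : B -> C) :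
  covering f -> covering g -> covering (g \o f).
Proof.
move=> [cf lf uf] [cg lg ug]; split.
- exact: (cts_comp cf cg).
- move=> p H h cH ch Hh.
  have [K [cK K0 KH Kc]] := lg p H (f \o h) cH (cts_comp ch cf) Hh.
  have [L [cL L0 LK Lc]] := lf p K h cK ch K0.
  exists L; split=> // [z|t Ht s]; first by rewrite /= LK KH.
  by apply: Lc => s'; rewrite K0 Kc.
- move=> u v cu cv uv uv0; apply: uf => //.
  apply: ug => //; [exact: (cts_comp cu cf)|exact: (cts_comp cv cf)|by rewrite uv0].
Qed.

Definition segment p (t0 t1 : cube p) (s : I) : cube p :=
  fun i => to_unit ((1 - unit_val s) * unit_val (t0 i) + unit_val s * unit_val (t1 i)).

Lemma segment_val p (t0 t1 : cube p) s i : unit_val (segment t0 t1 s i) =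
  (1 - unit_val s) * unit_val (t0 i) + unit_val s * unit_val (t1 i).
Proof.
rewrite to_unitK //.
have := unit_ge0 s; have := unit_le1 s; have := unit_ge0 (t0 i); have := unit_le1 (t0 i).
have := unit_ge0 (t1 i); have := unit_le1 (t1 i).
move: (unit_val _) (unit_val _) (unit_val _) => a b c *; apply/andP; split; nra.
Qed.

Lemma segment0 p (t0 t1 : cube p) : segment t0 t1 (to_unit 0) = t0.
Proof. by apply/funext => i; rewrite /segment to_unit0 subr0 mul1r mul0r addr0 valK_unit. Qed.

Lemma segment1 p (t0 t1 : cube p) : segment t0 t1 (to_unit 1) = t1.
Proof. by apply/funext => i; rewrite /segment to_unit1 subrr mul1r mul0r add0r valK_unit. Qed.

Lemma segment_face p (t0 t1 : cube p) i s :
  unit_val (t0 i) = unit_val (t1 i) -> unit_val (segment t0 t1 s i) = unit_val (t1 i).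
Proof. by move=> e; rewrite segment_val e -mulrDl subrK mul1r. Qed.

Lemma cts_segment_param X p (t0 t1 : X -> cube p) (s : X -> I) :
  continuous t0 -> continuous t1 -> continuous s ->
  continuous (fun x => segment (t0 x) (t1 x) (s x)).
Proof.
move=> c0 c1 cs; apply: cts_ptws => i; apply: cts_comp (@cts_to_unit R).
have cs' := cts_comp cs (@cts_val R).
apply: cts_add; apply: cts_mul => //.
- exact: (cts_add (@cts_cst _ R 1) (cts_opp cs')).
- exact: (cts_comp (cts_comp c0 (@cts_coord R p i)) (@cts_val R)).
- exact: (cts_comp (cts_comp c1 (@cts_coord R p i)) (@cts_val R)).
Qed.

Lemma cts_segment p (t0 t1 : cube p) : continuous (segment t0 t1).
Proof.
exact: (cts_segment_param (@cts_cst _ _ t0) (@cts_cst _ _ t1) (@cts_id _)).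
Qed.

Definition corner p : cube p := fun=> to_unit 0.

Arguments corner : clear implicits.

Lemma corner_boundary p : cube_boundary (corner p.+1).
Proof. by exists ord0; left; rewrite to_unit0. Qed.

Section OneCovering.
Context E B (proj : E -> B) (cov : covering proj).

(** The cube contracts to its corner along segments, which are lifted. *)
Lemma lift_cube p (q : cube p -> B) (e : E) : continuous q -> proj e = q (corner p) ->
  exists F : cube p -> E, [/\ continuous F, forall t, proj (F t) = q t & F (corner p) = e].
Proof.
move=> cq qe.
pose H (z : I * cube p) := q (segment (corner p) z.2 z.1).
have cH : continuous H.
  apply: cts_comp cq; apply: cts_segment_param; [exact: cts_cst|exact: cts_snd|exact: cts_fst].
have [t|L [cL L0 LH Lc]] := covering_lift cov cH (@cts_cst _ _ e).
  by rewrite /H segment0.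
exists (fun t => L (to_unit 1, t)); split.
- by apply: cts_comp cL; apply: cts_pair; [exact: cts_cst|exact: cts_id].
- by move=> t; rewrite LH /H segment1.
- rewrite Lc // => s; congr q; apply/funext => i.
  by apply: val_inj; rewrite -!/(unit_val _) !segment_val /= !to_unit0; lra.
Qed.

Lemma unique_cube p (u v : cube p -> E) t0 : continuous u -> continuous v ->
  (forall t, proj (u t) = proj (v t)) -> u t0 = v t0 -> u =1 v.
Proof.
move=> cu cv uv uv0 t; rewrite -(segment1 t0 t).
apply: (covering_unique cov (u := u \o segment t0 t) (v := v \o segment t0 t)).
- exact: (cts_comp (@cts_segment _ _ _) cu).
- exact: (cts_comp (@cts_segment _ _ _) cv).
- by move=> s; apply: uv.
- by rewrite /= segment0.
Qed.

Lemma lift_constant_segment p (F : cube p -> E) t0 t1 b : continuous F ->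
  (forall s, proj (F (segment t0 t1 s)) = b) -> F t1 = F t0.
Proof.
move=> cF Fb; rewrite -(segment1 t0 t1).
apply: (covering_unique cov (u := F \o segment t0 t1) (v := fun=> F t0)).
- exact: (cts_comp (@cts_segment _ _ _) cF).
- exact: cts_cst.
- by move=> s; rewrite /= Fb -(Fb (to_unit 0)) segment0.
- by rewrite /= segment0.
Qed.

(** A lift of the homotopy rests on the boundary; it ends at [g] because both ends are
    lifts of one map. *)
Lemma lift_homotopic p (e0 : E) (b0 : B) (f g : cube p.+1 -> E) :
  proj e0 = b0 -> continuous f -> continuous g -> f (corner _) = e0 -> g (corner _) = e0 ->
  homotopic b0 (proj \o f) (proj \o g) ->
  exists H : I * cube p.+1 -> E,
    [/\ continuous H, forall t, H (to_unit 0, t) = f t, forall t, H (to_unit 1, t) = g t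
      & forall s t, cube_boundary t -> H (s, t) = f t].
Proof.
move=> eb cf cg f0 g0 [H [cH H0 H1 Hb]].
have [L [cL L0 LH Lc]] := covering_lift cov cH cf H0.
have bL s t : cube_boundary t -> L (s, t) = f t.
  by move=> bt; apply: Lc => s'; rewrite !Hb.
exists L; split=> // t.
apply: (@unique_cube _ (fun t => L (to_unit 1, t)) g (corner _)) => //.
- by apply: cts_comp cL; apply: cts_pair; [exact: cts_cst|exact: cts_id].
- by move=> t'; rewrite LH H1.
- by rewrite bL ?f0 ?g0 //; exact: corner_boundary.
Qed.

End OneCovering.

Section InducedMap.
Context E B (proj : E -> B) (cproj : continuous proj) (e0 : E).

Definition map_loop p (f : loop R p e0) : loop R p (proj e0).
Proof.
apply: (@Loop R p B (proj e0) (proj \o f)).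
- exact: (cts_comp (@loop_continuous _ _ _ _ f) cproj).
- by move=> t bt; rewrite /= loop_boundary.
Defined.

Lemma homotopic_map p (f g : cube p -> E) :
  homotopic e0 f g -> homotopic (proj e0) (proj \o f) (proj \o g).
Proof.
move=> [H [cH H0 H1 Hb]]; exists (proj \o H); split=> /=.
- exact: (cts_comp cH cproj).
- by move=> t; rewrite H0.
- by move=> t; rewrite H1.
- by move=> s t bt; rewrite Hb.
Qed.

Definition induced p (a : homotopy_group R p.+1 e0) : homotopy_group R p.+1 (proj e0) :=
  \pi_(homotopy_group R p.+1 (proj e0)) (map_loop (repr a)).

Lemma inducedE p (f : loop R p.+1 e0) :
  induced (\pi_(homotopy_group R p.+1 e0) f) = \pi_(homotopy_group R p.+1 (proj e0)) (map_loop f).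
Proof.
apply/homotopy_classP; apply: (@homotopic_map p.+1).
by apply/homotopy_classP; exact: reprK.
Qed.

Lemma induced_morph p : {morph @induced p : a b / (a * b)%g}.
Proof.
elim/quotW => f; elim/quotW => g.
have -> : (\pi_(homotopy_group R p.+1 e0) f * \pi_(homotopy_group R p.+1 e0) g)%g =
    \pi_(homotopy_group R p.+1 e0) (concat f g) by exact: hmulE.
rewrite !inducedE [RHS]hmulE; apply/homotopy_classP.
have -> : map_loop (concat f g) = concat (map_loop f) (map_loop g) :> (_ -> _).
  by apply/funext => t; rewrite /= /concat_fun; case: ifP.
exact: homotopic_refl.
Qed.

End InducedMap.

(** The boundary of a cube of dimension at least two is connected, so a lift of a
    map that is constant there is again constant there. *)
Theorem covering_higher_homotopy E B (proj : E -> B) (cov : covering proj) (e0 : E) p :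
  isomorphic (homotopy_group R p.+2 e0) (homotopy_group R p.+2 (proj e0)).
Proof.
have cproj := covering_continuous cov.
apply: (@isomorphic_intro _ _ (@induced _ _ _ cproj e0 p.+1)); first exact: induced_morph.
apply: bijective_of.
  elim/quotW => f; elim/quotW => g; rewrite !inducedE => /homotopy_classP fg.
  have corner_e0 (h : loop R p.+2 e0) : h (corner p.+2) = e0.
    by apply: loop_boundary; exact: corner_boundary.
  have [//|||||H [cH H0 H1 Hb]] := @lift_homotopic _ _ _ cov p.+1 e0 (proj e0) f g _ _ _ _ _ fg;
    rewrite ?corner_e0 //; try exact: loop_continuous.
  apply/homotopy_classP; exists H; split=> // s t bt.
  by rewrite Hb // loop_boundary.
elim/quotW => f.
have [|F [cF Ff F0]] := @lift_cube _ _ _ cov p.+2 f e0 (@loop_continuous _ _ _ _ f).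
  by rewrite loop_boundary //; exact: corner_boundary.
have bF t : cube_boundary t -> F t = e0.
  move=> [i ti]; have [j ji] : exists j : 'I_p.+2, j != i.
    have [i0|i0] := eqVneq i ord0; last by exists ord0; rewrite eq_sym.
    by exists ord_max; rewrite i0.
  (* [t] is joined to [t'] inside the face of [t] of direction [i], and [t'] to the
     corner inside a face of direction [j]. *)
  pose t' : cube p.+2 := fun k => if k == j then to_unit 0 else t k.
  have -> : F t = F t'.
    apply: (lift_constant_segment cov cF (b := proj e0)) => s.
    rewrite Ff loop_boundary //; exists i; rewrite segment_face //.
    by rewrite /t' eq_sym (negbTE ji).
  rewrite -F0; apply: (lift_constant_segment cov cF (b := proj e0)) => s.
  rewrite Ff loop_boundary //; exists j; left; rewrite segment_face /t' eqxx //.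
  exact: to_unit0.
pose Fl := Loop cF bF; exists (\pi_(homotopy_group R p.+2 e0) Fl).
rewrite inducedE; apply/homotopy_classP.
have -> : map_loop cproj Fl = f :> (_ -> _) by apply/funext.
exact: homotopic_refl.
Qed.

End Coverings.

Arguments corner {R} p _ : rename.

(** * The fundamental group of the base of a covering with a group action *)

Section Monodromy.
Context {R : realType}.
Local Notation I := (@unit_interval R).
Local Notation cube := (@Defs.cube R).

Definition top : cube 1 := fun=> to_unit 1.

Lemma top_boundary : cube_boundary top.
Proof. by exists ord0; right; rewrite to_unit1. Qed.

Lemma cube1_boundary (t : cube 1) : cube_boundary t -> t = corner 1 \/ t = top.
Proof.
move=> [i ti]; have E (x : R) : unit_val (t i) = x -> t = fun=> to_unit x.
  by move=> <-; apply/funext => j; rewrite valK_unit (ord1 i) (ord1 j).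
by case: ti => /E ->; [left|right].
Qed.

Context (E X : topologicalType) (proj : E -> X) (cov : covering (R := R) proj) (e0 : E).
Context (G : groupType) (act : G -> E -> E).
Hypothesis act_continuous : forall g, continuous (act g).
Hypothesis actM : forall g h e, act (g * h)%g e = act g (act h e).
Hypothesis act_proj : forall g e, proj (act g e) = proj e.

(** A path from the base point to its translate by [g]; its image in [X] is a loop of
    monodromy [g]. *)
Definition reaches (g : G) : Prop :=
  exists F : cube 1 -> E, [/\ continuous F, F (corner 1) = e0 & F top = act g e0].

Lemma concat_lift (F K : cube 1 -> E) : continuous F -> continuous K ->
  F top = K (corner 1) ->
  [/\ continuous (concat_fun F K), concat_fun F K (corner 1) = F (corner 1)
    & concat_fun F K top = K top].
Proof.
move=> cF cK FK; rewrite /concat_fun; split.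
- have c1 := @cts_first R 0.
  have csub (Y : cube 1 -> I) : continuous Y -> continuous (fun t : cube 1 => set_first t (Y t)).
    by move=> cY; exact: (cts_set_first (@cts_id _) cY).
  apply: (@cts_paste R _ _ (fun t : cube 1 => unit_val (t ord0)) 2^-1
    (fun t => F (set_first t (to_unit (2 * unit_val (t ord0)))))
    (fun t => K (set_first t (to_unit (2 * unit_val (t ord0) - 1))))) => //.
  + exact: (cts_comp (csub _ (cts_double0 c1)) cF).
  + exact: (cts_comp (csub _ (cts_double (a := -1) c1)) cK).
  + move=> t /= tE; have -> : 2 * unit_val (t ord0) = 1 by lra.
    rewrite subrr.
    have -> : set_first t (to_unit 1) = top by apply/funext => i; rewrite (ord1 i).
    by rewrite FK; congr K; apply/funext => i; rewrite (ord1 i).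
- rewrite to_unit0 mulr0 ifT; last by lra.
  by congr F; apply/funext => i; rewrite (ord1 i).
- rewrite to_unit1 ifF; last by apply/negbTE; lra.
  congr K; apply/funext => i; rewrite (ord1 i) /= /top.
  by apply: val_inj; rewrite -!/(unit_val _) !to_unitK; lra.
Qed.

(** The path for [g] is followed by the translate by [g] of the path for [h]. *)
Lemma reachesM g h : reaches g -> reaches h -> reaches (g * h)%g.
Proof.
move=> [F [cF F0 F1]] [K [cK K0 K1]].
have [||c c0 c1] := @concat_lift F (act g \o K) cF.
- exact: (cts_comp cK (@act_continuous g)).
- by rewrite F1 /= K0.
- by exists (concat_fun F (act g \o K)); rewrite c0 c1 F0 /= K1 actM.
Qed.

Hypothesis act1 : forall e, act 1%g e = e.
Hypothesis act_free : forall g h, act g e0 = act h e0 -> g = h.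
Hypothesis act_trans : forall e, proj e = proj e0 -> exists g, e = act g e0.
Hypothesis act_reaches : forall g, reaches g.
Hypothesis loops_null : forall F : cube 1 -> E, continuous F ->
  F (corner 1) = e0 -> F top = e0 ->
  homotopic (proj e0) (proj \o F) (fun=> proj e0).

Let x0 := proj e0.
Let pi1 := homotopy_group R 1 x0.

Let monodromy (f : cube 1 -> X) (g : G) : Prop :=
  exists F : cube 1 -> E, [/\ continuous F, forall t, proj (F t) = f t,
    F (corner 1) = e0 & F top = act g e0].

Let loop_corner (f : loop R 1 x0) : f (corner 1) = x0.
Proof. by apply: loop_boundary; exact: corner_boundary. Qed.

Let loop_top (f : loop R 1 x0) : f top = x0.
Proof. by apply: loop_boundary; exact: top_boundary. Qed.

Let monodromy_exists (f : loop R 1 x0) : exists g, monodromy f g.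
Proof.
have [|F [cF Ff F0]] := @lift_cube _ _ _ _ cov 1 f e0 (@loop_continuous _ _ _ _ f).
  by rewrite loop_corner.
have [g Fg] : exists g, F top = act g e0 by apply: act_trans; rewrite Ff loop_top.
by exists g, F.
Qed.

Let monodromy_homotopic (f f' : loop R 1 x0) g g' :
  homotopic x0 f f' -> monodromy f g -> monodromy f' g' -> g = g'.
Proof.
move=> ff' [F [cF Ff F0 F1]] [F' [cF' Ff' F0' F1']].
have Ef : loop_fun f = proj \o F by apply/funext => t; rewrite /= Ff.
have Ef' : loop_fun f' = proj \o F' by apply/funext => t; rewrite /= Ff'.
rewrite Ef Ef' in ff'.
have [H [cH H0 H1 Hb]] := lift_homotopic cov (erefl _) cF cF' F0 F0' ff'.
apply: act_free; rewrite -F1 -F1' -H1 Hb //; exact: top_boundary.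
Qed.

Let monodromyM (f f' : loop R 1 x0) g g' :
  monodromy f g -> monodromy f' g' -> monodromy (concat f f') (g * g')%g.
Proof.
move=> [F [cF Ff F0 F1]] [K [cK Kf K0 K1]].
have [||c c0 c1] := @concat_lift F (act g \o K) cF.
- exact: (cts_comp cK (@act_continuous g)).
- by rewrite F1 /= K0.
- exists (concat_fun F (act g \o K)); rewrite c0 c1 F0 /= K1 actM; split=> // t.
  by rewrite /= /concat_fun; case: ifP => _ /=; rewrite ?act_proj ?Ff ?Kf.
Qed.

(** The lift of a loop of [X] from [e0] ends at a translate [act g e0], and [g] depends on
    the homotopy class only. This is a morphism, since the lift of a product is the lift
    of the first loop followed by a translate of the lift of the second. It is injective
    because loops of [E] are trivial in [X], surjective because [e0] is joined to all its
    translates. *)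
Theorem fundamental_group_of_covering : isomorphic pi1 G.
Proof.
have [theta thetaP] := choice (fun a : pi1 => monodromy_exists (repr a)).
have thetaE (f : loop R 1 x0) g : monodromy f g -> theta (\pi_pi1 f) = g.
  move=> fg; apply: (monodromy_homotopic _ (thetaP _) fg).
  by apply/homotopy_classP; exact: reprK.
have thetaK (f : loop R 1 x0) : monodromy f (theta (\pi_pi1 f)).
  by have [g fg] := monodromy_exists f; rewrite (thetaE _ _ fg).
have thetaM : {morph theta : a b / (a * b)%g}.
  elim/quotW => f; elim/quotW => f'.
  rewrite [(_ * _)%g](_ : _ = \pi_pi1 (concat f f')); last exact: hmulE.
  by apply: thetaE; exact: monodromyM.
have theta_inj1 a : theta a = 1%g -> a = 1%g.
  elim/quotW: a => f f1; have := thetaK f; rewrite f1 => -[F [cF Ff F0]].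
  rewrite act1 => F1; apply/homotopy_classP.
  have -> : loop_fun f = proj \o F by apply/funext => t; rewrite /= Ff.
  exact: loops_null.
have theta1 : theta 1%g = 1%g by apply: (@mulgI _ (theta 1%g)); rewrite -thetaM !mulg1.
apply: (isomorphic_intro thetaM); apply: bijective_of.
- move=> a b ab; apply: (@mulgI _ a^-1%g); rewrite mulVg; symmetry; apply: theta_inj1.
  by rewrite thetaM -ab -thetaM mulVg.
- move=> g; have [F [cF F0 F1]] := act_reaches g.
  have bF (t : cube 1) : cube_boundary t -> (proj \o F) t = x0.
    by move=> /cube1_boundary[] ->; rewrite /= ?F0 // F1 act_proj.
  pose f := Loop (cts_comp cF (covering_continuous cov)) bF.
  by exists (\pi_pi1 f); apply: thetaE; exists F.
Qed.

End Monodromy.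

(** * Coordinates, inner products and normalisation *)

Section PointwiseContinuity.
Context {R : realType} {Y : topologicalType}.
Implicit Types (f g : Y -> R) (y : Y).

(** Transports are quotients whose denominators vanish somewhere, hence continuity at a
    point. *)
Lemma at_cts (X : topologicalType) (f : Y -> X) y : continuous f -> {for y, continuous f}.
Proof. by move=> cf; exact: cf. Qed.

Lemma at_comp (X Z : topologicalType) (f : Y -> X) (g : X -> Z) y :
  {for y, continuous f} -> continuous g -> {for y, continuous (fun x => g (f x))}.
Proof. by move=> cf cg; exact: (continuous_comp cf (cg (f y))). Qed.

Lemma at_add f g y : {for y, continuous f} -> {for y, continuous g} ->
  {for y, continuous (fun x => f x + g x)}.
Proof. by move=> cf cg; exact: (cvgD cf cg). Qed.

Lemma at_mul f g y : {for y, continuous f} -> {for y, continuous g} ->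
  {for y, continuous (fun x => f x * g x)}.
Proof. by move=> cf cg; exact: (cvgM cf cg). Qed.

Lemma at_inv f y : {for y, continuous f} -> f y != 0 ->
  {for y, continuous (fun x => (f x)^-1)}.
Proof. by move=> cf f0; exact: (cvgV f0 cf). Qed.

Lemma at_sum (T : finType) (P : pred T) (F : T -> Y -> R) y :
  (forall i, {for y, continuous (F i)}) ->
  {for y, continuous (fun x => \sum_(i | P i) F i x)}.
Proof.
move=> cF; apply: (@cvg_big _ _ _ _ P _ _ (nbhs y) _ F (fun i => F i y)) => [|i _].
  exact: add_continuous.
exact: cF.
Qed.

Lemma at_mx a b (F : Y -> 'M[R]_(a, b)) y :
  (forall i j, {for y, continuous (fun x => F x i j)}) -> {for y, continuous F}.
Proof.
move=> cF A [P hP PA]; apply: (filterS (P := [set x | forall i j, P i j (F x i j)])).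
  by move=> x Px; exact: PA.
apply: filter_forall => i; apply: filter_forall => j; exact: cF (hP i j).
Qed.

Lemma cts_sum (T : finType) (P : pred T) (F : T -> Y -> R) :
  (forall i, continuous (F i)) -> continuous (fun x => \sum_(i | P i) F i x).
Proof. by move=> cF y; apply: at_sum => i; exact: cF. Qed.

Lemma cts_mx a b (F : Y -> 'M[R]_(a, b)) :
  (forall i j, continuous (fun x => F x i j)) -> continuous F.
Proof. by move=> cF y; apply: at_mx => i j; exact: cF. Qed.

Lemma cts_entry a b (F : Y -> 'M[R]_(a, b)) i j :
  continuous F -> continuous (fun x => F x i j).
Proof. move=> cF; exact: (cts_comp cF (@coord_continuous R a b i j)). Qed.

Lemma cts_inv f : continuous f -> (forall y, f y != 0) -> continuous (fun x => (f x)^-1).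
Proof. by move=> cf f0 y; apply: at_inv => //; exact: cf. Qed.

Lemma cts_sqrt f : continuous f -> continuous (fun x => Num.sqrt (f x)).
Proof. move=> cf; exact: (cts_comp cf (@sqrt_continuous R)). Qed.

End PointwiseContinuity.

Section Dot.
Context {R : realType} {T : finType}.
Implicit Types x y z : T -> R.

Definition dot x y : R := \sum_i x i * y i.

Lemma dotC x y : dot x y = dot y x.
Proof. by apply: eq_bigr => i _; rewrite mulrC. Qed.

Lemma dotDl x y z : dot (fun i => x i + y i) z = dot x z + dot y z.
Proof. by rewrite -big_split; apply: eq_bigr => i _; rewrite mulrDl. Qed.

Lemma dotZl a x z : dot (fun i => a * x i) z = a * dot x z.
Proof. by rewrite mulr_sumr; apply: eq_bigr => i _; rewrite mulrA. Qed.

Lemma dotDr x y z : dot z (fun i => x i + y i) = dot z x + dot z y.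
Proof. by rewrite dotC dotDl !(dotC z). Qed.

Lemma dotZr a x z : dot z (fun i => a * x i) = a * dot z x.
Proof. by rewrite dotC dotZl dotC. Qed.

Lemma dot_ge0 x : 0 <= dot x x.
Proof. by apply: sumr_ge0 => i _; rewrite -expr2 sqr_ge0. Qed.

Lemma dot_eq0 x : dot x x = 0 -> x = fun=> 0.
Proof.
move=> x0; apply/funext => i.
have : \sum_i x i * x i == 0 by apply/eqP.
rewrite psumr_eq0 => [/allP/(_ i (mem_index_enum i))/=|j _]; last by rewrite -expr2 sqr_ge0.
by rewrite mulf_eq0 orbb => /eqP.
Qed.

Definition unitize x : T -> R := fun i => x i / Num.sqrt (dot x x).

Lemma unitize_norm x : dot x x != 0 -> dot (unitize x) (unitize x) = 1.
Proof.
move=> x0; have -> : unitize x = fun i => (Num.sqrt (dot x x))^-1 * x i.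
  by apply/funext => i; rewrite mulrC.
rewrite dotZl dotZr mulrA -invfM -expr2 sqr_sqrtr ?dot_ge0 // mulVf //.
Qed.

Lemma unitize_id x : dot x x = 1 -> unitize x = x.
Proof. by move=> x1; apply/funext => i; rewrite /unitize x1 sqrtr1 divr1. Qed.

Lemma sqrt_dot_neq0 x : dot x x != 0 -> Num.sqrt (dot x x) != 0.
Proof. by move=> x0; rewrite sqrtr_eq0 -ltNge lt_neqAle eq_sym x0 dot_ge0. Qed.

Lemma at_dot (Y : topologicalType) (f g : Y -> T -> R) (w : Y) :
  (forall i, {for w, continuous (fun u => f u i)}) ->
  (forall i, {for w, continuous (fun u => g u i)}) ->
  {for w, continuous (fun u => dot (f u) (g u))}.
Proof. by move=> cf cg; apply: at_sum => i; apply: at_mul. Qed.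

Lemma cts_dot (Y : topologicalType) (f g : Y -> T -> R) :
  (forall i, continuous (fun u => f u i)) -> (forall i, continuous (fun u => g u i)) ->
  continuous (fun u => dot (f u) (g u)).
Proof. by move=> cf cg w; apply: at_dot => i; [exact: cf|exact: cg]. Qed.

Lemma at_unitize (Y : topologicalType) (f : Y -> T -> R) (w : Y) i :
  (forall i, {for w, continuous (fun u => f u i)}) -> dot (f w) (f w) != 0 ->
  {for w, continuous (fun u => unitize (f u) i)}.
Proof.
move=> cf f0; apply: at_mul => //; apply: at_inv; last exact: sqrt_dot_neq0.
apply: at_comp (@sqrt_continuous R); exact: at_dot.
Qed.

Lemma cts_unitize (Y : topologicalType) (f : Y -> T -> R) :
  (forall i, continuous (fun u => f u i)) -> (forall w, dot (f w) (f w) != 0) ->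
  forall i, continuous (fun u => unitize (f u) i).
Proof. by move=> cf f0 i w; apply: at_unitize => // j; exact: cf. Qed.

End Dot.

(** A continuous sign cannot change without vanishing. *)
Lemma square_one_constant (R : realType) (g : @unit_interval R -> R) : continuous g ->
  (forall s, g s ^+ 2 = 1) -> g (to_unit 0) = 1 -> forall s, g s = 1.
Proof.
move=> cg g2 g0 s; have /eqP := g2 s; rewrite sqrf_eq1 => /orP[/eqP //|/eqP gs].
have cG : {within `[0, unit_val s], continuous (g \o @to_unit R)}.
  by apply: continuous_subspaceT; exact: (cts_comp (@cts_to_unit R) cg).
have [||c _ /= gc] := @IVT R (g \o @to_unit R) 0 (unit_val s) 0 _ cG.
- exact: unit_ge0.
- by rewrite /= valK_unit g0 gs ge_min le_max oppr_le0 !ler01 orbT.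
- by have /eqP := g2 (to_unit c); rewrite gc expr0n /= eq_sym oner_eq0.
Qed.

(** * The covering of projective configurations by spherical ones *)

Section ProjectiveCovering.
Context {R : realType} {m : nat}.
Local Notation I := (@unit_interval R).
Local Notation cube := (@Defs.cube R).
Local Notation RP := (projective_space R m).
Local Notation V := ('rV[R]_m.+1).

Lemma dot_vec_neq0 (v : V) : (dot (v 0) (v 0) != 0) = (v != 0).
Proof.
apply/idP/idP; apply: contra => /eqP v0.
  by rewrite v0; apply/eqP; apply: big1 => i _; rewrite mxE mul0r.
by apply/eqP/rowP => j; rewrite mxE; move: v0 => /dot_eq0 ->.
Qed.

Lemma sphere_norm (x : sphere R m) : dot (sphere_vec x 0) (sphere_vec x 0) = 1.
Proof. by rewrite -[RHS](set_mem (valP x)); apply: eq_bigr => i _; rewrite expr2. Qed.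

Fact mk_sphere_subproof (v : V) :
  dot (v 0) (v 0) = 1 -> v \in [set v : V | \sum_j v 0 j ^+ 2 = 1].
Proof. by move=> <-; apply/mem_set/eq_bigr => i _; rewrite expr2. Qed.

Definition mk_sphere (v : V) (v1 : dot (v 0) (v 0) = 1) : sphere R m :=
  exist (fun z => z \in [set v : V | \sum_j v 0 j ^+ 2 = 1]) v (mk_sphere_subproof v1).

(** The line spanned by a vector; the value at the zero vector is arbitrary. *)
Definition line (v : V) : RP :=
  if @idP (v != 0) is ReflectT v0 then proj_class (mk_nonzero v0)
  else proj_class (basis_vector R ord0).

Lemma lineE (v : V) (v0 : v != 0) : line v = proj_class (mk_nonzero v0).
Proof.
rewrite /line; case: {-}_ / idP => // v0'.
by rewrite (bool_irrelevance v0 v0').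
Qed.

Lemma lineP (v : V) (q : RP) : v != 0 ->
  line v = q <-> exists2 c : R, c != 0 & proj_vec q = c *: v.
Proof. by move=> v0; rewrite lineE -{1}(proj_reprK q) proj_classP. Qed.

(** Entries of the orthogonal projection onto a line: they do not depend on a spanning
    vector, hence are continuous on the quotient, and they embed projective space in a
    space of matrices. *)
Definition proj_entry (q : RP) i j : R :=
  let r := proj_vec q 0 in r i * r j / dot r r.

Lemma proj_entry_class v i j : proj_entry (proj_class v) i j =
  nonzero_vec v 0 i * nonzero_vec v 0 j / dot (nonzero_vec v 0) (nonzero_vec v 0).
Proof.
have [c c0 cE] : exists2 c : R, c != 0 & proj_vec (proj_class v) = c *: nonzero_vec v.
  by apply/proj_classP; rewrite proj_reprK.
have v0 : dot (nonzero_vec v 0) (nonzero_vec v 0) != 0.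
  by rewrite dot_vec_neq0 nonzero_vec_neq0.
rewrite /proj_entry cE.
have -> : (c *: nonzero_vec v) 0 = (fun j => c * nonzero_vec v 0 j).
  by apply/funext => k; rewrite mxE.
by rewrite dotZl dotZr; field; apply/andP.
Qed.

Lemma cts_proj_entry i j : continuous (fun q => proj_entry q i j).
Proof.
apply/quotient_continuous => v.
have cv : continuous (fun v : nonzero_vector R m => nonzero_vec v).
  exact: initial_continuous.
have ce k : continuous (fun v : nonzero_vector R m => nonzero_vec v 0 k).
  exact: cts_entry cv.
move: v; rewrite (_ : _ \o _ = (fun v : nonzero_vector R m =>
  nonzero_vec v 0 i * nonzero_vec v 0 j / dot (nonzero_vec v 0) (nonzero_vec v 0))).
  apply: cts_mul; first exact: cts_mul.
  apply: cts_inv; first exact: cts_dot.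
  by move=> v; rewrite dot_vec_neq0 nonzero_vec_neq0.
by apply/funext => v; exact: proj_entry_class.
Qed.

Definition project (a : V) (q : RP) : 'I_m.+1 -> R := fun j => \sum_i a 0 i * proj_entry q i j.

Lemma projectE a q : project a q =
  fun j => dot (a 0) (proj_vec q 0) / dot (proj_vec q 0) (proj_vec q 0) * proj_vec q 0 j.
Proof.
apply/funext => j; rewrite /project /proj_entry /= /dot !mulr_suml; apply: eq_bigr => i _.
by rewrite -!mulrA; congr (_ * (_ * _)); rewrite mulrC.
Qed.

(** Transport of a unit vector to a line: the unit vector of that line on its side. *)
Definition line_transport (a : V) (q : RP) : V := \row_j unitize (project a q) j.

Lemma line_transportP (a : V) (q : RP) : dot (a 0) (proj_vec q 0) != 0 ->
  [/\ {for (a, q), continuous (fun z => line_transport z.1 z.2)},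
      dot (line_transport a q 0) (line_transport a q 0) = 1 & line (line_transport a q) = q].
Proof.
move=> aq; have q0 : dot (proj_vec q 0) (proj_vec q 0) != 0.
  by rewrite dot_vec_neq0 nonzero_vec_neq0.
have p0 : dot (project a q) (project a q) != 0.
  by rewrite projectE dotZl dotZr !mulf_neq0 // invr_neq0.
have tE : line_transport a q 0 = unitize (project a q) by apply/funext => j; rewrite mxE.
have t1 : dot (line_transport a q 0) (line_transport a q 0) = 1 by rewrite tE unitize_norm.
split=> //.
  apply: at_mx => i j; rewrite (_ : (fun x => _) =
      (fun z : V * RP => unitize (project z.1 z.2) j)); last first.
    by apply/funext => z; rewrite mxE.
  apply: at_unitize => // k; apply: at_sum => l; apply: at_mul; apply: at_cts.
    exact: cts_entry (@cts_fst _ _).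
  exact: (cts_comp (@cts_snd _ _) (@cts_proj_entry _ _)).
apply/lineP; first by rewrite -dot_vec_neq0 t1 oner_neq0.
set d := dot (a 0) (proj_vec q 0) / dot (proj_vec q 0) (proj_vec q 0).
have d0 : d != 0 by rewrite mulf_neq0 // invr_neq0.
exists (Num.sqrt (dot (project a q) (project a q)) / d).
  by rewrite mulf_neq0 ?invr_neq0 // sqrt_dot_neq0.
have pj j : project a q j = d * proj_vec q 0 j by rewrite projectE.
apply/rowP => j; rewrite !mxE /unitize pj.
by field; rewrite d0 sqrt_dot_neq0.
Qed.

Lemma sphere_vec_line (x : sphere R m) : line (sphere_vec x) = sphere_proj x.
Proof. by rewrite (lineE (sphere_vec_neq0 x)). Qed.

(** Two lines are close when they are not orthogonal; then a unit vector of one of them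
    projects to a nonzero vector of the other. *)
Lemma lift_to_sphere p (H : I * cube p -> RP) (f : cube p -> V) :
  continuous H -> continuous f -> (forall t, dot (f t 0) (f t 0) = 1) ->
  (forall t, H (to_unit 0, t) = line (f t)) ->
  exists L : I * cube p -> V,
    [/\ continuous L, forall t, L (to_unit 0, t) = f t, forall z, line (L z) = H z,
        forall z, dot (L z 0) (L z 0) = 1
      & forall t, (forall s, H (s, t) = H (to_unit 0, t)) -> forall s, L (s, t) = f t].
Proof.
move=> cH cf f1 Hf.
pose U (q q' : RP) := \sum_i \sum_j proj_entry q i j * proj_entry q' i j != 0.
(* The trace of the product of two projections is the squared cosine of the angle. *)
have UE q q' : \sum_i \sum_j proj_entry q i j * proj_entry q' i j =
  dot (proj_vec q 0) (proj_vec q' 0) ^+ 2 /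
    (dot (proj_vec q 0) (proj_vec q 0) * dot (proj_vec q' 0) (proj_vec q' 0)).
  rewrite expr2 {1 2}/dot big_distrlr /= mulr_suml; apply: eq_bigr => i _.
  rewrite mulr_suml; apply: eq_bigr => j _; rewrite /proj_entry invfM; ring.
have n0 (q : RP) : dot (proj_vec q 0) (proj_vec q 0) != 0.
  by rewrite dot_vec_neq0 nonzero_vec_neq0.
apply: (@homotopy_lifting_transport R V RP line [set v | dot (v 0) (v 0) = 1] setT U
  line_transport) => //.
- move=> q _; have cU : continuous (fun z : RP * RP =>
      \sum_i \sum_j proj_entry z.1 i j * proj_entry z.2 i j).
    apply: cts_sum => i; apply: cts_sum => j; apply: cts_mul.
      exact: (cts_comp (@cts_fst _ _) (@cts_proj_entry _ _)).
    exact: (cts_comp (@cts_snd _ _) (@cts_proj_entry _ _)).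
  have := cU (q, q) [set x | x != 0]; apply.
  apply: open_nbhs_nbhs; split; first exact: open_neq.
  by rewrite /= UE mulf_neq0 ?sqrf_eq0 ?n0 // invr_neq0 // mulf_neq0.
- move=> a q /= a1 _ Uaq; have a0 : a != 0 by rewrite -dot_vec_neq0 a1 oner_neq0.
  apply: line_transportP; move: Uaq; rewrite /U UE mulf_eq0 negb_or => /andP[+ _].
  rewrite sqrf_eq0; have [//|c c0 cE] := (lineP (line a) a0).1.
  rewrite cE (_ : (c *: a) 0 = fun j => c * a 0 j); last by apply/funext => j; rewrite mxE.
  by rewrite dotZl mulf_eq0 negb_or => /andP[].
- move=> a /= a1; have a0 : a != 0 by rewrite -dot_vec_neq0 a1 oner_neq0.
  have pE : project a (line a) = a 0.
    rewrite (lineE a0) /project; apply/funext => j.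
    under eq_bigr do rewrite proj_entry_class /nonzero_vec /= a1 divr1 mulrA.
    by rewrite -mulr_suml -/(dot _ _) a1 mul1r.
  by apply/rowP => j; rewrite mxE pE unitize_id.
Qed.

Context (k n : nat).
Local Notation WS := (config_sphere R m k n).
Local Notation WP := (config_projective R m k n).

Definition config_vec (x : WS) (i : 'I_n) : V := sphere_vec (val x i).

Lemma cts_config_vec i : continuous (fun x : WS => config_vec x i).
Proof.
apply: (cts_comp (f := fun x : WS => val x i)); last exact: initial_continuous.
apply: (cts_comp (f := fun x : WS => val x) (g := fun y => y i)).
  exact: initial_continuous.
exact: proj_continuous.
Qed.

Lemma cts_to_config (Y : topologicalType) (f : Y -> WS) :
  (forall i j, continuous (fun y => config_vec (f y) i 0 j)) -> continuous f.
Proof.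
move=> cf; apply: continuous_comp_initial; apply: cts_ptws => i.
apply: continuous_comp_initial; apply: cts_mx => a j; rewrite (ord1 a); exact: cf.
Qed.

Lemma config_vec_inj (x y : WS) : config_vec x =1 config_vec y -> x = y.
Proof. by move=> xy; apply: val_inj; apply/funext => i; apply: val_inj; exact: xy. Qed.

Lemma config_vec_norm x i : dot (config_vec x i 0) (config_vec x i 0) = 1.
Proof. exact: sphere_norm. Qed.

Lemma config_image_line (x : WS) i : val (config_image x) i = line (config_vec x i).
Proof. by rewrite sphere_vec_line. Qed.

Lemma cts_line_of (i : 'I_n) : continuous (fun y : WP => val y i).
Proof.
apply: (cts_comp (f := fun y : WP => val y) (g := fun y => y i)).
  exact: initial_continuous.
exact: proj_continuous.
Qed.

Definition independent (v : 'I_n -> V) : Prop :=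
  forall A : {set 'I_n}, #|A| = k -> free [seq v i | i <- enum A].

Definition mk_config (v : 'I_n -> V) (v1 : forall i, dot (v i 0) (v i 0) = 1)
    (vfree : independent v) : WS :=
  exist (fun x => x \in @config_set R m k n (sphere R m) (@sphere_vec R m))
    (fun i => mk_sphere (v1 i)) (mem_set vfree).

Lemma config_vec_independent (x : WS) : independent (config_vec x).
Proof. exact: (set_mem (valP x)). Qed.

Lemma lines_independent (v : 'I_n -> V) (q : WP) : (forall i, v i != 0) ->
  (forall i, line (v i) = val q i) -> independent v.
Proof.
move=> v0 vq; have := set_mem (valP q).
have -> : \val q = fun i => proj_class (mk_nonzero (v0 i)).
  by apply/funext => i; rewrite -vq lineE.
by move=> /config_projectiveP.
Qed.

(** The points of a configuration are lifted one by one: independence is a condition on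
    the lines, so the lifts stay independent. For two lifts of a path, the inner products
    of corresponding vectors are continuous signs, equal to one at the start. *)
Theorem config_covering : covering (R := R) (@config_image R m k n).
Proof.
split.
- apply: continuous_comp_initial; apply: cts_ptws => i.
  apply: (cts_comp (g := @proj_class R m) (f := fun x : WS =>
    mk_nonzero (sphere_vec_neq0 (val x i)))); last exact: pi_continuous.
  by apply: continuous_comp_initial; exact: cts_config_vec.
- move=> p H f cH cf Hf.
  have lifts i : exists L : I * cube p -> V,
    [/\ continuous L, forall t, L (to_unit 0, t) = config_vec (f t) i,
        forall z, line (L z) = val (H z) i, forall z, dot (L z 0) (L z 0) = 1
      & forall t, (forall s, val (H (s, t)) i = val (H (to_unit 0, t)) i) ->
          forall s, L (s, t) = config_vec (f t) i].
    apply: (@lift_to_sphere p (fun z => val (H z) i) (fun t => config_vec (f t) i)).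
    + exact: (cts_comp cH (@cts_line_of i)).
    + exact: (cts_comp cf (@cts_config_vec i)).
    + by move=> t; exact: config_vec_norm.
    + by move=> t; rewrite Hf config_image_line.
  have [L LP] := choice lifts.
  have L1 z i : dot (L i z 0) (L i z 0) = 1 by have [_ _ _ ->] := LP i.
  have L0 z i : L i z != 0 by rewrite -dot_vec_neq0 L1 oner_neq0.
  have Ll z i : line (L i z) = val (H z) i by have [_ _ ->] := LP i.
  have LF z : independent (fun i => L i z) by exact: (lines_independent (L0 z) (Ll z)).
  exists (fun z => mk_config (L1 z) (LF z)); split.
  + apply: cts_to_config => i j; apply: cts_entry; by have [] := LP i.
  + move=> t; apply: config_vec_inj => i; rewrite /config_vec /sphere_vec /=.
    by have [_ -> _ _ _] := LP i.
  + move=> z; apply: val_inj; apply/funext => i.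
    by rewrite config_image_line /config_vec /sphere_vec /= Ll.
  + move=> t Ht s; apply: config_vec_inj => i; rewrite /config_vec /sphere_vec /=.
    by have [_ _ _ _ ->] := LP i => // s'; rewrite Ht.
- move=> u v cu cv uv uv0 s; apply: config_vec_inj => i.
  have prop s' : exists2 c : R, c != 0 & config_vec (v s') i = c *: config_vec (u s') i.
    have := congr1 (fun y : WP => val y i) (uv s'); rewrite /= => /proj_classP.
    by [].
  pose g s' := dot (config_vec (u s') i 0) (config_vec (v s') i 0).
  have gc s' c : config_vec (v s') i = c *: config_vec (u s') i -> g s' = c /\ c ^+ 2 = 1.
    move=> cE; have eE : (c *: config_vec (u s') i) 0 = fun j => c * config_vec (u s') i 0 j.
      by apply/funext => j; rewrite mxE.
    have := config_vec_norm (v s') i; rewrite /g cE eE !dotZr dotZl config_vec_norm !mulr1.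
    by rewrite -expr2.
  have g1 s' : g s' = 1.
    apply: (@square_one_constant R g).
    + apply: cts_dot => j; apply: cts_entry.
        exact: (cts_comp cu (@cts_config_vec i)).
      exact: (cts_comp cv (@cts_config_vec i)).
    + by move=> s''; have [c _ /gc[-> ->]] := prop s''.
    + by rewrite /g uv0 config_vec_norm.
  have [c _ cE] := prop s; have [gE _] := gc _ _ cE.
  by rewrite cE -gE g1 scale1r.
Qed.

End ProjectiveCovering.

(** * Spheres of dimension at least two are simply connected *)

Section Rotation.
Context {R : realType} {T : finType}.
Implicit Types a b x y : T -> R.

(** The rotation of the plane of two unit vectors that takes the first to the second;
    it fixes the orthogonal complement of the plane. *)
Definition rot a b x : T -> R := fun i =>
  x i - (dot a x + dot b x) / (1 + dot a b) * (a i + b i) + 2 * dot a x * b i.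

Lemma rot_id a x : dot a a = 1 -> rot a a x = x.
Proof. by move=> a1; apply/funext => i; rewrite /rot a1; field. Qed.

Lemma rot_move a b : dot a a = 1 -> 1 + dot a b != 0 -> rot a b a = b.
Proof.
by move=> a1 ab; apply/funext => i; rewrite /rot a1 (dotC b a); field.
Qed.

Lemma dot_rot a b x y : dot a a = 1 -> dot b b = 1 -> 1 + dot a b != 0 ->
  dot (rot a b x) (rot a b y) = dot x y.
Proof.
move=> a1 b1 ab.
have rE z : rot a b z = fun i => z i + (- ((dot a z + dot b z) / (1 + dot a b)) * a i +
    (2 * dot a z - (dot a z + dot b z) / (1 + dot a b)) * b i).
  by apply/funext => i; rewrite /rot; ring.
rewrite !rE !(dotDl, dotDr, dotZl, dotZr) a1 b1 (dotC b a) (dotC x a) (dotC x b).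
by field.
Qed.

Lemma rot_fix a b x : dot a x = 0 -> dot b x = 0 -> rot a b x = x.
Proof. by move=> ax bx; apply/funext => i; rewrite /rot ax bx; ring. Qed.

Lemma at_rot (Y : topologicalType) (a b x : Y -> T -> R) (w : Y) i :
  (forall i, {for w, continuous (fun u => a u i)}) ->
  (forall i, {for w, continuous (fun u => b u i)}) ->
  (forall i, {for w, continuous (fun u => x u i)}) -> 1 + dot (a w) (b w) != 0 ->
  {for w, continuous (fun u => rot (a u) (b u) (x u) i)}.
Proof.
move=> ca cb cx ab; have cc (r : R) : {for w, continuous (fun=> r)} by apply: at_cts; exact: cts_cst.
apply: at_add; [apply: at_add => //|apply: at_mul => //].
  rewrite (_ : (fun u => _) = (fun u => -1 * ((dot (a u) (x u) + dot (b u) (x u)) /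
      (1 + dot (a u) (b u)) * (a u i + b u i)))); last first.
    by apply/funext => u; rewrite mulN1r.
  apply: at_mul => //; apply: at_mul; last by apply: at_add.
  apply: at_mul; first by apply: at_add; exact: at_dot.
  by apply: at_inv => //; apply: at_add => //; exact: at_dot.
by apply: at_mul => //; exact: at_dot.
Qed.

Lemma antipode_dot a b : dot a a = 1 -> dot b b = 1 -> 1 + dot a b = 0 -> forall i, a i = - b i.
Proof.
move=> a1 b1 ab i; apply/eqP; rewrite -subr_eq0 opprK; apply/eqP.
have : dot (fun i => a i + b i) (fun i => a i + b i) = 0.
  by rewrite dotDl !dotDr a1 b1 (dotC b a); lra.
by move=> /dot_eq0/(congr1 (fun f => f i)).
Qed.

End Rotation.

Section PolygonalPath.
Context {R : realType}.

Definition clamp (x : R) := Num.max 0 (Num.min x 1).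

(** A single formula for the polygonal path makes continuity at the vertices immediate. *)
Definition polygon (N : nat) (v : nat -> R) (x : R) : R :=
  v 0%N + \sum_(k < N) clamp (x - k%:R) * (v k.+1 - v k).

Lemma polygonE N v (x : R) k : (k < N)%N -> k%:R <= x <= k.+1%:R ->
  polygon N v x = (1 - (x - k%:R)) * v k + (x - k%:R) * v k.+1.
Proof.
move=> kN /andP[kx xk]; rewrite /polygon.
have tele n : v 0%N + \sum_(j < n) (v j.+1 - v j) = v n.
  elim: n => [|n IH]; first by rewrite big_ord0 addr0.
  by rewrite big_ord_recr /= addrA IH addrC subrK.
suff -> : \sum_(j < N) clamp (x - j%:R) * (v j.+1 - v j) =
    \sum_(j < k) (v j.+1 - v j) + (x - k%:R) * (v k.+1 - v k).
  by rewrite addrA tele; ring.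
rewrite -(big_mkord xpredT (fun j => clamp (x - j%:R) * (v j.+1 - v j))).
rewrite (@big_cat_nat _ _ _ k) //=; last exact: ltnW.
congr (_ + _).
  rewrite big_mkord; apply: eq_bigr => j _; rewrite /clamp min_r ?max_r ?mul1r //.
  have : (j.+1%:R : R) <= k%:R by rewrite ler_nat.
  by rewrite -natr1; lra.
rewrite big_ltn // big_nat_cond big1 ?addr0 => [|j /andP[/andP[kj _] _]].
  rewrite /clamp min_l ?max_r //; first by lra.
  by move: xk; rewrite -natr1; lra.
rewrite /clamp max_l ?mul0r //.
have : (k.+1%:R : R) <= j%:R by rewrite ler_nat.
by rewrite ge_min; move=> kj'; apply/orP; left; lra.
Qed.

Lemma nat_interval N (x : R) : (0 < N)%N -> 0 <= x <= N%:R ->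
  exists2 k, (k < N)%N & k%:R <= x <= k.+1%:R.
Proof.
elim: N => // N IH _ /andP[x0 xN]; have [Nx|xN'] := lerP N%:R x.
  by exists N; rewrite // Nx.
have [N0|N0] := posnP N; first by move: xN'; rewrite N0; lra.
have [|k kN kx] := IH N0; first by rewrite x0 ltW.
by exists k => //; exact: ltnW.
Qed.

Lemma cts_clamp (Y : topologicalType) (u : Y -> R) :
  continuous u -> continuous (fun y => clamp (u y)).
Proof. by move=> cu; apply: cts_max; [exact: cts_cst|apply: cts_min => //; exact: cts_cst]. Qed.

Lemma cts_polygon (Y : topologicalType) N v (u : Y -> R) :
  continuous u -> continuous (fun y => polygon N v (u y)).
Proof.
move=> cu; apply: cts_add; first exact: cts_cst.
apply: cts_sum => k; apply: cts_mul; last exact: cts_cst.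
by apply: cts_clamp; apply: cts_add => //; exact: cts_cst.
Qed.

End PolygonalPath.

Section AvoidPlanes.
Context {R : realType}.

Lemma nonroot (p : {poly R}) : p != 0 -> exists x, p.[x] != 0.
Proof.
move=> p0; apply: contrapT => nr.
have rp x : p.[x] = 0 by apply/eqP/negPn/negP => h; apply: nr; exists x.
have := @max_poly_roots _ p [seq i%:R | i <- iota 0 (size p)] p0.
have -> : all (root p) [seq i%:R | i <- iota 0 (size p)].
  by apply/allP => x _; apply/rootP.
by rewrite size_map size_iota ltnn map_inj_uniq ?iota_uniq; [move=> /(_ isT isT)|exact: mulrIn (oner_neq0 R)].
Qed.

Lemma annihilator (u v : 'I_3 -> R) : exists2 phi : 'I_3 -> R,
  (exists i, phi i != 0) & (\sum_i phi i * u i = 0) /\ (\sum_i phi i * v i = 0).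
Proof.
pose M : 'M[R]_(3, 2) := \matrix_(i, j) (if j == ord0 then u i else v i).
have : kermx M != 0.
  by rewrite kermx_eq0 -row_leq_rank -ltnNge ltnS rank_leq_col.
case/rowV0Pn => w /sub_kermxP wM w0; exists (w 0).
  apply: contrapT => w0'; case/eqP: w0; apply/rowP => i; rewrite mxE.
  by apply/eqP/negPn/negP => wi; apply: w0'; exists i.
have wMj j : (w *m M) 0 j = 0 by rewrite wM mxE.
split; [have := wMj ord0|have := wMj ord_max]; rewrite mxE => wM0; rewrite -[RHS]wM0;
  by apply: eq_bigr => i _; rewrite mxE.
Qed.

(** A plane is in the kernel of a nonzero linear form, which is a nonzero polynomial of
    degree at most two on the moment curve; the product of finitely many of these has only
    finitely many roots. *)
Lemma avoid_planes (N : nat) (u v : 'I_N -> 'I_3 -> R) :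
  exists y : R, forall k (a b : R),
    ~ (forall i : 'I_3, a * u k i + b * v k i = y ^+ i).
Proof.
have /choice[phi phiP] : forall k, exists phi : 'I_3 -> R, (exists i, phi i != 0) /\
    ((\sum_i phi i * u k i = 0) /\ (\sum_i phi i * v k i = 0)).
  by move=> k; have [phi ? ?] := annihilator (u k) (v k); exists phi.
pose P k : {poly R} := \poly_(i < 3) phi k (inord i).
have P0 k : P k != 0.
  have [[i phii] _] := phiP k; apply/eqP => /(congr1 (fun p : {poly R} => p`_i)).
  by rewrite coef_poly ltn_ord inord_val coef0 => /eqP; rewrite (negbTE phii).
have [y] : exists y, (\prod_k P k).[y] != 0 by apply: nonroot; apply/prodf_neq0 => k _.
rewrite horner_prod => /prodf_neq0 Py; exists y => k a b uv.
have [_ [pu pv]] := phiP k; case/eqP: (Py k isT).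
rewrite horner_poly; under eq_bigr => i _ do rewrite inord_val -uv mulrDr.
rewrite big_split /=.
have -> : \sum_(i < 3) phi k i * (a * u k i) = a * \sum_i phi k i * u k i.
  by rewrite mulr_sumr; apply: eq_bigr => i _; ring.
have -> : \sum_(i < 3) phi k i * (b * v k i) = b * \sum_i phi k i * v k i.
  by rewrite mulr_sumr; apply: eq_bigr => i _; ring.
by rewrite pu pv !mulr0 addr0.
Qed.

End AvoidPlanes.

Section LinearFacts.
Context {R : realType}.
Implicit Types a c e g r s x : R.

Lemma convex_dot_gt0 x a : 0 <= x -> x <= 1 -> 0 < a -> 1 - x + x * a <> 0.
Proof. by move=> *; nra. Qed.

Lemma combination_eq0 s g c : (1 - s) * g + s * - c = 0 -> s * c = (1 - s) * g.
Proof. by move=> h; lra. Qed.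

Lemma combination_eqN s e c r :
  (1 - s) * e + s * - c = - r * e -> s * c = (1 - s + r) * e.
Proof. by move=> h; lra. Qed.

Lemma eqN_eq0 x : x = - x -> x = 0.
Proof. by move=> h; lra. Qed.

End LinearFacts.

Section SupportedSphere.
Context {R : realType} {T : finType}.
Local Notation I := (@unit_interval R).
Local Notation cube := (@Defs.cube R).

(** The unit sphere of a coordinate subspace. *)
Definition supp_sphere (D : pred T) : topologicalType :=
  [set x : prod_topology (fun _ : T => R) | dot x x = 1 /\ forall i, ~~ D i -> x i = 0].

Variable D : pred T.
Local Notation S := (supp_sphere D).

Definition supp_vec (x : S) : T -> R := val x.

Lemma supp_vec_norm x : dot (supp_vec x) (supp_vec x) = 1.
Proof. by have [] := set_mem (valP x). Qed.

Lemma supp_vec_supp x i : ~~ D i -> supp_vec x i = 0.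
Proof. by have [_] := set_mem (valP x); apply. Qed.

Definition mk_supp (x : T -> R) (x1 : dot x x = 1) (xD : forall i, ~~ D i -> x i = 0) : S :=
  exist (fun z => z \in [set x : prod_topology (fun _ : T => R) |
    dot x x = 1 /\ forall i, ~~ D i -> x i = 0]) x (mem_set (conj x1 xD)).

Lemma cts_supp_vec i : continuous (fun x : S => supp_vec x i).
Proof.
apply: (cts_comp (f := fun x : S => val x) (g := fun y => y i)).
  exact: initial_continuous.
exact: proj_continuous.
Qed.

Lemma cts_to_supp (Y : topologicalType) (f : Y -> S) :
  (forall i, continuous (fun y => supp_vec (f y) i)) -> continuous f.
Proof. by move=> cf; apply: continuous_comp_initial; apply: cts_ptws => i; exact: cf. Qed.

Lemma unitize_scale (e : T -> R) r : dot e e = 1 -> 0 < r -> unitize (fun i => r * e i) = e.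
Proof.
move=> e1 r0; apply/funext => i.
by rewrite /unitize dotZl dotZr e1 mulr1 -expr2 sqrtr_sqr gtr0_norm //; field; exact: lt0r_neq0.
Qed.

Lemma unitizeK (x : T -> R) : dot x x != 0 ->
  x = fun i => Num.sqrt (dot x x) * unitize x i.
Proof.
by move=> x0; apply/funext => i; rewrite /unitize; field; exact: sqrt_dot_neq0.
Qed.

Lemma supp_homotopy (e : S) (f g : cube 1 -> S) (H : I * cube 1 -> T -> R) :
  (forall i, continuous (fun z => H z i)) -> (forall z, dot (H z) (H z) != 0) ->
  (forall z i, ~~ D i -> H z i = 0) ->
  (forall t, unitize (H (to_unit 0, t)) = supp_vec (f t)) ->
  (forall t, unitize (H (to_unit 1, t)) = supp_vec (g t)) ->
  (forall s t, cube_boundary t -> unitize (H (s, t)) = supp_vec e) ->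
  homotopic e f g.
Proof.
move=> cH H0 HD Hf Hg Hb.
have uD z i : ~~ D i -> unitize (H z) i = 0 by move=> Di; rewrite /unitize HD ?mul0r.
exists (fun z => mk_supp (unitize_norm (H0 z)) (uD z)); split.
- by apply: cts_to_supp => i; exact: cts_unitize.
- by move=> t; apply: val_inj => /=; rewrite Hf.
- by move=> t; apply: val_inj => /=; rewrite Hg.
- by move=> s t bt; apply: val_inj => /=; rewrite Hb.
Qed.

Lemma rot_moveZ (a b : T -> R) r : dot a a = 1 -> 1 + dot a b != 0 ->
  rot a b (fun i => r * a i) = fun i => r * b i.
Proof.
move=> a1 ab; have := rot_move a1 ab => /(congr1 (fun f i => r * f i)) <-.
by apply/funext => i; rewrite /rot !dotZr; ring.
Qed.

Lemma cts_s (Y : topologicalType) : continuous (fun z : I * Y => unit_val z.1).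
Proof. exact: (cts_comp (@cts_fst _ _) (@cts_val R)). Qed.

Lemma cts_1s (Y : topologicalType) : continuous (fun z : I * Y => 1 - unit_val z.1).
Proof. by apply: (cts_add (@cts_cst _ R 1)); apply: cts_opp; exact: cts_s. Qed.

Lemma cube1E (t : cube 1) : t = fun=> to_unit (unit_val (t ord0)).
Proof. by apply/funext => i; rewrite valK_unit (ord1 i). Qed.

Section NullHomotopy.
Variables (e : S) (f : cube 1 -> S).
Hypothesis cf : continuous f.
Hypothesis f_corner : f (corner 1) = e.
Hypothesis f_top : f top = e.

Let fv t := supp_vec (f t).
Let at_time (x : R) := fv (fun=> to_unit x).

(** A loop is homotopic to one that is made of finitely many arcs, each in the
    plane of two of its points. *)
Lemma polygonal_approximation : exists N (v : nat -> T -> R) (g : cube 1 -> T -> R),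
  [/\ [/\ forall i, continuous (fun t => g t i), forall t i, ~~ D i -> g t i = 0,
      v 0%N = supp_vec e & forall t, cube_boundary t -> g t = supp_vec e],
      forall t, exists2 k, (k < N.+1)%N &
        exists a b, forall i, g t i = a * v k i + b * v k.+1 i
    & forall t, 0 < dot (fv t) (g t)].
Proof.
have [|z|N small] := @uniform_step R S (fun x y => 0 < dot (supp_vec x) (supp_vec y)) 0
    (fun z => f (fun=> z.1)).
- by apply: cts_comp cf; apply: cts_ptws => i; exact: cts_fst.
- have cU : continuous (fun w : S * S => dot (supp_vec w.1) (supp_vec w.2)).
    apply: cts_dot => i; first exact: (cts_comp (@cts_fst _ _) (@cts_supp_vec i)).
    exact: (cts_comp (@cts_snd _ _) (@cts_supp_vec i)).
  have := cU (f (fun=> z.1), f (fun=> z.1)) [set x | 0 < x]; apply.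
  apply: open_nbhs_nbhs; split; first exact: open_gt.
  by rewrite /= supp_vec_norm.
pose v k := at_time (k%:R / N.+1%:R).
pose g (t : cube 1) i := polygon N.+1 (fun k => v k i) (N.+1%:R * unit_val (t ord0)).
have N0 : 0 < (N.+1%:R : R) by rewrite ltr0n.
have gE t : exists2 k, (k < N.+1)%N & exists l : R, [/\ 0 <= l <= 1,
    forall i, g t i = (1 - l) * v k i + l * v k.+1 i,
    0 < dot (fv t) (v k) & 0 < dot (fv t) (v k.+1)].
  set x := unit_val (t ord0).
  have x01 : 0 <= x <= 1 by rewrite unit_ge0 unit_le1.
  have [//||k kN kx] := @nat_interval R N.+1 (N.+1%:R * x).
    by case/andP: x01 => x0 x1; apply/andP; split; [rewrite mulr_ge0|rewrite -{2}[N.+1%:R]mulr1 ler_pM2l].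
  have close j : `|N.+1%:R * x - j%:R| <= 1 -> 0 < dot (fv t) (v j).
    move=> jx; have := small (j%:R / N.+1%:R - x) _ (to_unit x, fun=> to_unit 0).
    rewrite /= [unit_val (to_unit x)]to_unitK //.
    rewrite [x + _]addrC subrK {1}/fv (cube1E t); apply.
    have -> : j%:R / N.+1%:R - x = - ((N.+1%:R * x - j%:R) / N.+1%:R).
      by rewrite mulrBl [_ * x]mulrC -mulrA mulfV ?lt0r_neq0 // mulr1 opprB.
    by rewrite normrN normrM normfV (gtr0_norm N0) ler_pdivrMr // mulVf ?lt0r_neq0.
  exists k => //; exists (N.+1%:R * x - k%:R); move: kx; rewrite -natr1 => kx; split.
  - by lra.
  - by move=> i; rewrite /g (polygonE _ kN) // -natr1.
  - by apply: close; rewrite ler_norml; lra.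
  - by apply: close; rewrite -natr1 ler_norml; lra.
have v0 : v 0%N = supp_vec e by rewrite /v /at_time mul0r -f_corner.
have vN : v N.+1 = supp_vec e by rewrite /v /at_time divff ?lt0r_neq0 // -f_top.
exists N, v, g; split; first split => //.
- move=> i; apply: cts_polygon; apply: cts_mul; first exact: cts_cst.
  exact: cts_first.
- move=> t i Di; have [k _ [l [_ -> _ _]]] := gE t.
  by rewrite /v /at_time /fv !supp_vec_supp // !mulr0 addr0.
- move=> t /cube1_boundary[] ->; apply/funext => i.
    rewrite /g /= to_unit0 mulr0 (@polygonE _ _ _ _ 0%N) // ?lexx ?ler01 //.
    by rewrite v0; ring.
  rewrite /g /= to_unit1 mulr1 (@polygonE _ _ _ _ N) // ?lexx ?ler_nat ?leqnSn //.
  by rewrite vN -natr1; ring.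
- by move=> t; have [k kN [l [_ gl _ _]]] := gE t; exists k => //; exists (1 - l), l.
- move=> t; have [k _ [l [/andP[l0 l1] gl a b]]] := gE t.
  have -> : g t = fun i => (1 - l) * v k i + l * v k.+1 i by apply/funext.
  rewrite dotDr !dotZr; move: (dot _ _) (dot _ _) a b => a b a0 b0; nra.
Qed.

(** The loop is first replaced by a polygonal one. The latter lies in finitely many planes
    and so misses some point [c] of the moment curve, up to scaling, as well as its
    opposite. The segments to [- c] contract the rest of the sphere to a point. The base point moves
    during the contraction, and a rotation that follows it brings it back. *)
Theorem supp_sphere_loop_null (j : 'I_3 -> T) :
  injective j -> (forall k, D (j k)) -> homotopic e f (fun=> e).
Proof.
move=> jI jD.
have [N [v [g [[cg gD v0 gb] gE fg]]]] := polygonal_approximation.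
have g0 t : dot (g t) (g t) != 0.
  apply/eqP => /dot_eq0 g0; have := fg t; rewrite g0.
  by rewrite /dot big1 ?ltxx // => i _; rewrite mulr0.
have g1 t : dot (unitize (g t)) (unitize (g t)) = 1 by exact: unitize_norm.
have g1D t i : ~~ D i -> unitize (g t) i = 0 by move=> Di; rewrite /unitize gD ?mul0r.
pose f' t := mk_supp (g1 t) (g1D t).
have cfv i : continuous (fun z : I * cube 1 => fv z.2 i).
  exact: (cts_comp (cts_comp (@cts_snd _ _) cf) (@cts_supp_vec i)).
have cgv i : continuous (fun z : I * cube 1 => g z.2 i) := cts_comp (@cts_snd _ _) (cg i).
apply: (homotopic_trans (g := f')).
  apply: (@supp_homotopy _ _ _ (fun z i => (1 - unit_val z.1) * fv z.2 i + unit_val z.1 * g z.2 i)).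
  - move=> i; apply: cts_add; apply: cts_mul => //; [exact: cts_1s|exact: cts_s].
  - move=> [s t]; apply/eqP => /dot_eq0 H0.
    have : dot (fv t) (fun i => (1 - unit_val s) * fv t i + unit_val s * g t i) = 0.
      by rewrite H0; apply: big1 => i _; rewrite mulr0.
    rewrite dotDr !dotZr supp_vec_norm mulr1.
    exact: convex_dot_gt0 (unit_ge0 s) (unit_le1 s) (fg t).
  - by move=> z i Di; rewrite gD // /fv supp_vec_supp // !mulr0 addr0.
  - move=> t; rewrite -[RHS](unitize_id (supp_vec_norm _)); congr unitize.
    by apply/funext => i /=; rewrite to_unit0 subr0 mul1r mul0r addr0.
  - move=> t; congr unitize.
    by apply/funext => i /=; rewrite to_unit1 subrr mul1r mul0r add0r.
  - move=> s t bt; rewrite -[RHS](unitize_id (supp_vec_norm _)); congr unitize.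
    apply/funext => i /=; rewrite gb // /fv.
    have -> : f t = e by case/cube1_boundary: bt => ->.
    by ring.
have [y hy] := avoid_planes (fun (k : 'I_N.+1) i => v k (j i)) (fun (k : 'I_N.+1) i => v k.+1 (j i)).
pose c i : R := if [pick k | j k == i] is Some k then y ^+ k else 0.
have cj k : c (j k) = y ^+ k.
  by rewrite /c; case: pickP => [k' /eqP/jI -> //|/(_ k)]; rewrite eqxx.
have cD i : ~~ D i -> c i = 0.
  by rewrite /c; case: pickP => // k /eqP <-; rewrite jD.
have c_off t r : ~ (forall i, c i = r * g t i).
  move=> cg'; have [k kN [a [b gt]]] := gE t.
  apply: (hy (Ordinal kN) (r * a) (r * b)) => i.
  by rewrite -cj cg' gt; ring.
pose H (z : I * cube 1) i := (1 - unit_val z.1) * g z.2 i + unit_val z.1 * - c i.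
have cH i : continuous (fun z => H z i).
  apply: cts_add; apply: cts_mul => //; [exact: cts_1s|exact: cts_s|exact: cts_cst].
have H0 z : dot (H z) (H z) != 0.
  apply/eqP => /dot_eq0 /(congr1 (fun h => h _)) Hz.
  have [s0|s0] := eqVneq (unit_val z.1) 0.
    case/eqP: (g0 z.2); rewrite /dot big1 // => i _.
    by have := Hz i; rewrite /H s0 subr0 mul1r mul0r addr0 => ->; rewrite mul0r.
  apply: (c_off z.2 ((1 - unit_val z.1) / unit_val z.1)) => i.
  have /combination_eq0 h := Hz i; apply: (mulfI s0).
  by rewrite h mulrA mulrCA divff // mulr1.
have ge : g (corner 1) = supp_vec e by rewrite gb //; exact: corner_boundary.
(* [w] is the path of the base point. *)
pose w s := H (s, corner 1).
have w0 s : dot (w s) (w s) != 0 by exact: H0.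
have wn s := unitize_norm (w0 s).
have we s : 1 + dot (unitize (w s)) (supp_vec e) != 0.
  apply/eqP => /antipode_dot -/(_ (wn s) (supp_vec_norm _)) wE.
  have wE' i : w s i = - Num.sqrt (dot (w s) (w s)) * supp_vec e i.
    by rewrite [in LHS](unitizeK (w0 s)) wE mulrN mulNr.
  have [s0|s0] := eqVneq (unit_val s) 0.
    have wse : w s = supp_vec e.
      by apply/funext => i; rewrite /w /H /= s0 ge; ring.
    have : dot (supp_vec e) (supp_vec e) = 0.
      rewrite /dot big1 // => i _; have := wE i.
      by rewrite wse (unitize_id (supp_vec_norm e)) => /eqN_eq0 ->; rewrite mul0r.
    by rewrite supp_vec_norm => /eqP; rewrite oner_eq0.
  apply: (c_off (corner 1) ((1 - unit_val s + Num.sqrt (dot (w s) (w s))) / unit_val s)) => i.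
  have := wE' i; rewrite {1}/w /H /= ge; move: (Num.sqrt _) => r /combination_eqN h.
  by apply: (mulfI s0); rewrite h mulrA mulrCA divff // mulr1.
have wrot s t : H (s, t) = w s -> unitize (rot (unitize (w s)) (supp_vec e) (H (s, t))) = supp_vec e.
  move=> ->; rewrite {2}(unitizeK (w0 s)) rot_moveZ // unitize_scale ?supp_vec_norm //.
  by rewrite lt_neqAle eq_sym sqrt_dot_neq0 // sqrtr_ge0.
apply: (@supp_homotopy _ _ _ (fun z => rot (unitize (w z.1)) (supp_vec e) (H z))).
- have cw i : continuous (fun z : I * cube 1 => w z.1 i).
    apply: (cts_comp (f := fun z : I * cube 1 => (z.1, corner 1)) (g := fun z => H z i)) => //.
    by apply: cts_pair; [exact: cts_fst|exact: cts_cst].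
  move=> i z; apply: (@at_rot _ _ _ (fun z : I * cube 1 => unitize (w z.1))
    (fun=> supp_vec e) H z i) => [k|k|k|]; last exact: we.
  + exact: cts_unitize.
  + exact: cts_cst.
  + exact: cH.
- by move=> z; rewrite dot_rot ?supp_vec_norm.
- move=> z i Di; have HD z' : H z' i = 0 by rewrite /H gD // cD //; ring.
  by rewrite /rot HD /unitize /w HD supp_vec_supp //; ring.
- move=> t; have w00 : w (to_unit 0) = supp_vec e.
    by apply/funext => i; rewrite /w /H /= to_unit0 ge; ring.
  rewrite w00 (unitize_id (supp_vec_norm e)) rot_id ?supp_vec_norm //; congr unitize.
  by apply/funext => i; rewrite /H /= to_unit0; ring.
- move=> t; apply: wrot; apply/funext => i.
  by rewrite /w /H /= to_unit1; ring.
- move=> s t bt; apply: wrot; apply/funext => i.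
  by rewrite /w /H /= ge gb.
Qed.

End NullHomotopy.
End SupportedSphere.

(** * Orthonormalisation of configurations *)

Section Orthonormalisation.
Context {R : realType} {m n : nat}.
Local Notation cube := (@Defs.cube R).
Local Notation V := ('rV[R]_m.+1).
Local Notation W := (config_sphere R m n n).

Definition inner (u v : V) : R := dot (u 0) (v 0).

Lemma innerC u v : inner u v = inner v u. Proof. exact: dotC. Qed.

Lemma innerDl u v w : inner (u + v) w = inner u w + inner v w.
Proof. by rewrite -dotDl; congr dot; apply/funext => i; rewrite mxE. Qed.

Lemma innerZl a v w : inner (a *: v) w = a * inner v w.
Proof. by rewrite -dotZl; congr dot; apply/funext => i; rewrite mxE. Qed.

Lemma innerDr u v w : inner w (u + v) = inner w u + inner w v.
Proof. by rewrite innerC innerDl !(innerC w). Qed.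

Lemma innerZr a v w : inner w (a *: v) = a * inner w v.
Proof. by rewrite innerC innerZl innerC. Qed.

Definition normalize (v : V) : V := (Num.sqrt (inner v v))^-1 *: v.

Lemma normalizeE v j : normalize v 0 j = unitize (v 0) j.
Proof. by rewrite mxE mulrC. Qed.

Lemma normalize_norm v : v != 0 -> inner (normalize v) (normalize v) = 1.
Proof.
move=> v0; rewrite /inner (_ : normalize v 0 = unitize (v 0)) ?unitize_norm ?dot_vec_neq0 //.
by apply/funext => j; rewrite normalizeE.
Qed.

Lemma normalize_id v : inner v v = 1 -> normalize v = v.
Proof. by move=> v1; rewrite /normalize v1 sqrtr1 invr1 scale1r. Qed.

Lemma normalize_factor v : v != 0 -> (Num.sqrt (inner v v))^-1 != 0.
Proof. by move=> v0; rewrite invr_eq0 sqrt_dot_neq0 // dot_vec_neq0. Qed.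

Definition lin_indep (v : 'I_n -> V) : Prop :=
  forall c : 'I_n -> R, \sum_i c i *: v i = 0 -> forall i, c i = 0.

Lemma independentP (v : 'I_n -> V) : independent n v <-> lin_indep v.
Proof.
have freeE : free [seq v i | i <- enum 'I_n] <-> lin_indep v.
  have -> : [seq v i | i <- enum 'I_n] = mktuple v by [].
  have nthE (i : 'I_n) : (mktuple v)`_i = v i by rewrite -tnth_nth tnth_mktuple.
  split=> [/freeP h c cv i|h]; last apply/freeP => c cv i; apply: h.
    by rewrite -[RHS]cv; apply: eq_bigr => j _; rewrite nthE.
  by rewrite -[RHS]cv; apply: eq_bigr => j _; rewrite nthE.
rewrite -freeE; split=> [|h A cA].
  move=> /(_ (finset.setTfor 'I_n)); rewrite cardsT card_ord (eq_enum (B := 'I_n)).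
    by apply.
  by move=> i; rewrite inE.
have AT : A = finset.setTfor 'I_n by apply/eqP; rewrite eqEcard finset.subsetT cardsT card_ord cA leqnn.
by rewrite AT (eq_enum (B := 'I_n)) // => i; rewrite inE.
Qed.

Lemma lin_indep_neq0 v i : lin_indep v -> v i != 0.
Proof.
move=> hv; apply/eqP => vi.
have := hv (fun j => (j == i)%:R) _ i; rewrite eqxx => h; case/eqP: (oner_neq0 R); apply: h.
apply: big1 => j _; have [->|] := eqVneq j i; first by rewrite vi scaler0.
by rewrite scale0r.
Qed.

Lemma lin_indep_scale (v : 'I_n -> V) r : (forall i, r i != 0) ->
  lin_indep v -> lin_indep (fun i => r i *: v i).
Proof.
move=> r0 hv c cv i; apply: (mulIf (r0 i)); rewrite mul0r.
apply: (hv (fun i => c i * r i)); rewrite -[RHS]cv.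
by apply: eq_bigr => j _; rewrite scalerA.
Qed.

Lemma lin_indep_pivot (v : 'I_n -> V) k b : b k = 0 ->
  lin_indep v -> lin_indep (fun i => v i + b i *: v k).
Proof.
move=> bk hv c cv.
pose S := \sum_i c i * b i.
have h : forall i, c i + (i == k)%:R * S = 0.
  apply: hv; rewrite -[RHS]cv.
  under eq_bigr do rewrite scalerDl.
  under [in RHS]eq_bigr do rewrite scalerDr scalerA.
  rewrite !big_split /=; congr (_ + _).
  rewrite -scaler_suml -/S (bigD1 k) //= eqxx mul1r big1 ?addr0 // => j /negbTE ->.
  by rewrite mul0r scale0r.
have c0 i : i != k -> c i = 0 by move=> ik; have := h i; rewrite (negbTE ik) mul0r addr0.
move=> i; have [->|/c0 //] := eqVneq i k.
have := h k; rewrite eqxx mul1r /S (bigD1 k) //= bk mulr0 add0r big1 ?addr0 // => j /c0 ->.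
by rewrite mul0r.
Qed.

(** Removal, from the vectors after the [k]-th, of a fraction [s] of their
    components along the [k]-th. *)
Definition gs_vec (k : 'I_n) (s : R) (v : 'I_n -> V) (i : 'I_n) : V :=
  v i + (if (k < i)%N then - (s * inner (v i) (v k)) else 0) *: v k.

Lemma gs_vec_indep k s v : lin_indep v -> lin_indep (gs_vec k s v).
Proof. by move=> hv; apply: (lin_indep_pivot (k := k)); rewrite ?ltnn. Qed.

Lemma gs_vec_neq0 k s (x : W) i : gs_vec k s (config_vec x) i != 0.
Proof.
by apply: lin_indep_neq0; apply: gs_vec_indep; apply/independentP; exact: config_vec_independent.
Qed.

Fact gs_norm k s (x : W) i :
  dot (normalize (gs_vec k s (config_vec x) i) 0) (normalize (gs_vec k s (config_vec x) i) 0) = 1.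
Proof. exact/normalize_norm/gs_vec_neq0. Qed.

Fact gs_independent k s (x : W) :
  independent n (fun i => normalize (gs_vec k s (config_vec x) i)).
Proof.
apply/independentP; apply: lin_indep_scale => [i|].
  exact/normalize_factor/gs_vec_neq0.
by apply: gs_vec_indep; apply/independentP; exact: config_vec_independent.
Qed.

Definition gs_step (k : 'I_n) (s : R) (x : W) : W :=
  mk_config (gs_norm k s x) (@gs_independent k s x).

Lemma gs_stepE k s x i : config_vec (gs_step k s x) i = normalize (gs_vec k s (config_vec x) i).
Proof. by []. Qed.

Lemma cts_gs_step (Y : topologicalType) k (s : Y -> R) (x : Y -> W) :
  continuous s -> continuous x -> continuous (fun y => gs_step k (s y) (x y)).
Proof.
move=> cs cx; have cv i j : continuous (fun y => config_vec (x y) i 0 j).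
  exact: cts_entry (cts_comp cx (@cts_config_vec _ _ _ _ i)).
apply: cts_to_config => i j.
rewrite (_ : (fun y => _) = (fun y => unitize (gs_vec k (s y) (config_vec (x y)) i 0) j)); last first.
  by apply/funext => y; rewrite gs_stepE normalizeE.
apply: cts_unitize => [l|y]; last by rewrite dot_vec_neq0 gs_vec_neq0.
rewrite /gs_vec; case: (k < i)%N.
  rewrite (_ : (fun y => _) = (fun y => config_vec (x y) i 0 l +
    - (s y * inner (config_vec (x y) i) (config_vec (x y) k)) * config_vec (x y) k 0 l)); last first.
    by apply/funext => y; rewrite !mxE.
  apply: cts_add => //; apply: cts_mul => //; apply: cts_opp; apply: cts_mul => //.
  exact: cts_dot.
rewrite (_ : (fun y => _) = (fun y => config_vec (x y) i 0 l)) //.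
by apply/funext => y; rewrite scale0r addr0.
Qed.

Lemma gs_step0 k x : gs_step k 0 x = x.
Proof.
apply: config_vec_inj => i; rewrite gs_stepE /gs_vec mul0r oppr0 if_same scale0r addr0.
by apply: normalize_id; exact: config_vec_norm.
Qed.

Definition orthonormal_config (x : W) : Prop :=
  forall i j, i != j -> inner (config_vec x i) (config_vec x j) = 0.

Lemma gs_step_orthonormal k s x : orthonormal_config x -> gs_step k s x = x.
Proof.
move=> ox; apply: config_vec_inj => i; rewrite gs_stepE /gs_vec.
case: ltnP => ki; last by rewrite scale0r addr0; apply: normalize_id; exact: config_vec_norm.
rewrite ox; last by apply: contraTneq ki => ->; rewrite ltnn.
by rewrite mulr0 oppr0 scale0r addr0; apply: normalize_id; exact: config_vec_norm.
Qed.

Definition orthogonal_upto (k : nat) (x : W) : Prop :=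
  forall i j : 'I_n, (i < k)%N -> i != j -> inner (config_vec x i) (config_vec x j) = 0.

Lemma gs_step_orthogonal (k : 'I_n) x : orthogonal_upto k x -> orthogonal_upto k.+1 (gs_step k 1 x).
Proof.
move=> ox i j; rewrite ltnS !gs_stepE => ik ij.
rewrite /normalize innerZl innerZr.
suff -> : inner (gs_vec k 1 (config_vec x) i) (gs_vec k 1 (config_vec x) j) = 0 by rewrite !mulr0.
rewrite /gs_vec (ltnNge k i) ik /= scale0r addr0 innerDr innerZr.
case: (ltngtP k j) => kj /=.
- rewrite mul1r; have [<-|ik'] := eqVneq i k.
    by rewrite [inner (config_vec x i) (config_vec x i)]config_vec_norm innerC; ring.
  have lik : (i < k)%N by rewrite ltn_neqAle ik' ik.
  by rewrite !(ox i) // mulr0 addr0.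
- rewrite mul0r addr0; have [ik'|ik'] := eqVneq i k; last by apply: ox => //; rewrite ltn_neqAle ik' ik.
  by rewrite innerC; apply: ox => //; rewrite eq_sym.
- rewrite mul0r addr0; apply: ox => //; move: kj => /val_inj kj.
  by rewrite ltn_neqAle ik andbT kj.
Qed.

(** Gram-Schmidt orthonormalisation, one vector at a time. *)
Definition gram_schmidt (x : W) : W := foldl (fun x k => gs_step k 1 x) x (enum 'I_n).

Lemma gram_schmidt_orthonormal x : orthonormal_config (gram_schmidt x).
Proof.
suff h k : (k <= n)%N ->
    orthogonal_upto k (foldl (fun x k => gs_step k 1 x) x (take k (enum 'I_n))).
  move=> i j; have := h n (leqnn n); rewrite take_oversize ?size_enum_ord //.
  by move=> h'; apply: h'; exact: ltn_ord.
elim: k => [_ i j //|k IH kn].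
rewrite (take_nth (Ordinal kn)) ?size_enum_ord // foldl_rcons.
have -> : nth (Ordinal kn) (enum 'I_n) k = Ordinal kn by apply: val_inj; rewrite /= nth_enum_ord.
exact: (@gs_step_orthogonal (Ordinal kn) _ (IH (ltnW kn))).
Qed.

Lemma gram_schmidt_id x : orthonormal_config x -> gram_schmidt x = x.
Proof.
move=> ox; rewrite /gram_schmidt; elim: (enum 'I_n) => //= k s IH.
by rewrite gs_step_orthonormal.
Qed.

Lemma cts_gram_schmidt : continuous gram_schmidt.
Proof.
rewrite /gram_schmidt; elim/last_ind: (enum 'I_n) => [|s k IH]; first exact: cts_id.
rewrite (_ : (fun x => _) = (fun x => gs_step k 1 (foldl (fun x k => gs_step k 1 x) x s))).
  by apply: cts_gs_step => //; exact: cts_cst.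
by apply/funext => x; rewrite foldl_rcons.
Qed.

(** Each step of the process is a homotopy in its parameter, and all steps leave
    orthonormal configurations unchanged. *)
Lemma homotopic_gram_schmidt (x0 : W) (f : cube 1 -> W) : orthonormal_config x0 ->
  continuous f -> (forall t, cube_boundary t -> f t = x0) ->
  homotopic x0 f (fun t => gram_schmidt (f t)).
Proof.
move=> ox cf fb.
pose F (s : seq 'I_n) t := foldl (fun x k => gs_step k 1 x) (f t) s.
suff h s : [/\ continuous (F s), forall t, cube_boundary t -> F s t = x0 & homotopic x0 f (F s)].
  by have [] := h (enum 'I_n).
elim/last_ind: s => [|s k [cF Fb fF]].
  split; [exact: cf|exact: fb|exists (fun z => f z.2); split=> //].
    exact: (cts_comp (@cts_snd _ _) cf).
have Fr : F (rcons s k) = fun t => gs_step k 1 (F s t).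
  by apply/funext => t; rewrite /F foldl_rcons.
rewrite Fr; split.
- by apply: cts_gs_step => //; exact: cts_cst.
- by move=> t bt; rewrite Fb // gs_step_orthonormal.
- apply: homotopic_trans fF _.
  exists (fun z => gs_step k (unit_val z.1) (F s z.2)); split.
  + by apply: cts_gs_step; [exact: cts_s|exact: (cts_comp (@cts_snd _ _) cF)].
  + by move=> t; rewrite /= to_unit0 gs_step0.
  + by move=> t; rewrite /= to_unit1.
  + by move=> s' t bt; rewrite /= Fb // gs_step_orthonormal.
Qed.

Fact flip_norm (e : 'I_n -> bool) (x : W) i :
  dot (((-1) ^+ e i *: config_vec x i) 0) (((-1) ^+ e i *: config_vec x i) 0) = 1.
Proof.
rewrite -/(inner _ _) innerZl innerZr mulrA -signr_addb addbb mul1r; exact: config_vec_norm.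
Qed.

Fact flip_independent (e : 'I_n -> bool) (x : W) :
  independent n (fun i => (-1) ^+ e i *: config_vec x i).
Proof.
apply/independentP; apply: lin_indep_scale => [i|]; first by rewrite signr_eq0.
by apply/independentP; exact: config_vec_independent.
Qed.

(** Sign changes are the deck transformations of [config_image]. *)
Definition flip (e : 'I_n -> bool) (x : W) : W :=
  mk_config (flip_norm e x) (@flip_independent e x).

Lemma flipE e x i : config_vec (flip e x) i = (-1) ^+ e i *: config_vec x i.
Proof. by []. Qed.

Lemma cts_flip e : continuous (flip e).
Proof.
apply: cts_to_config => i j; rewrite (_ : (fun y => _) =
    (fun y => (-1) ^+ e i * config_vec y i 0 j)).
  by apply: cts_mul; [exact: cts_cst|exact: cts_entry (@cts_config_vec _ _ _ _ i)].
by apply/funext => y; rewrite flipE mxE.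
Qed.

Lemma flipM e e' x : flip e (flip e' x) = flip (fun i => e i (+) e' i) x.
Proof.
by apply: config_vec_inj => i; rewrite !flipE scalerA -signr_addb.
Qed.

Lemma flip0 x : flip (fun=> false) x = x.
Proof. by apply: config_vec_inj => i; rewrite flipE expr0 scale1r. Qed.

Lemma flip_image e x : config_image (flip e x) = config_image x.
Proof.
apply: val_inj; apply/funext => i; rewrite !config_image_line flipE.
have x0 : config_vec x i != 0 by exact: sphere_vec_neq0.
apply/lineP; first by rewrite scaler_eq0 signr_eq0.
have [//|c c0 cE] := (lineP (line (config_vec x i)) x0).1.
exists (c * (-1) ^+ e i); first by rewrite mulf_neq0 ?signr_eq0.
by rewrite scalerA -mulrA -signr_addb addbb mulr1 cE.
Qed.

Lemma flip_fiber x y : config_image y = config_image x -> exists e, y = flip e x.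
Proof.
move=> yx; have h i : exists b : bool, config_vec y i = (-1) ^+ b *: config_vec x i.
  have x0 : config_vec x i != 0 by exact: sphere_vec_neq0.
  have y0 : config_vec y i != 0 by exact: sphere_vec_neq0.
  have ly : line (config_vec y i) = line (config_vec x i).
    by rewrite -!config_image_line yx.
  have [c c0 cE] := (lineP _ y0).1 ly.
  have [d d0 dE] := (lineP _ x0).1 (erefl (line (config_vec x i))).
  have yE : config_vec y i = (d / c) *: config_vec x i.
    by rewrite mulrC -scalerA -dE cE scalerA mulVf // scale1r.
  have : (d / c) ^+ 2 = 1.
    have := config_vec_norm y i; rewrite -/(inner _ _) yE innerZl innerZr.
    by rewrite [inner _ _]config_vec_norm mulr1 expr2.
  move=> /eqP; rewrite sqrf_eq1 => /orP[] /eqP dc; rewrite yE dc.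
    by exists false; rewrite expr0.
  by exists true; rewrite expr1.
have [e eE] := choice h; exists e; apply: config_vec_inj => i.
by rewrite eE flipE.
Qed.

Lemma gs_step_flip k s e x : gs_step k s (flip e x) = flip e (gs_step k s x).
Proof.
apply: config_vec_inj => i; rewrite flipE !gs_stepE.
have -> : gs_vec k s (config_vec (flip e x)) i = (-1) ^+ e i *: gs_vec k s (config_vec x) i.
  rewrite /gs_vec !flipE innerZl innerZr scalerDr !scalerA; congr (_ + _ *: _).
  case: ifP => _; last by rewrite mul0r mulr0.
  rewrite mulNr mulrN; congr (- _).
  have e1 : (-1) ^+ e k * (-1) ^+ e k = 1 :> R by rewrite -signr_addb addbb.
  move: ((-1) ^+ e k) ((-1) ^+ e i) e1 => a b a1.
  transitivity (a * a * (b * (s * inner (config_vec x i) (config_vec x k)))); first by ring.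
  by rewrite a1 mul1r.
rewrite /normalize innerZl innerZr mulrA -signr_addb addbb mul1r scalerA mulrC.
by rewrite -scalerA.
Qed.

Lemma gram_schmidt_flip e x : gram_schmidt (flip e x) = flip e (gram_schmidt x).
Proof.
rewrite /gram_schmidt; elim/last_ind: (enum 'I_n) => //= s k IH.
by rewrite !foldl_rcons IH gs_step_flip.
Qed.

End Orthonormalisation.

(** * Loops of orthonormal frames *)

Section Stiefel.
Context {R : realType} {m n : nat}.
Local Notation cube := (@Defs.cube R).
Local Notation V := ('rV[R]_m.+1).
Local Notation W := (config_sphere R m n n).
Local Notation M := ('M[R]_(n, m.+1)).

Definition ortho_mx (A : M) : Prop := forall i j, dot (A i) (A j) = (i == j)%:R.

Definition stiefel : topologicalType := [set A : M | ortho_mx A].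

Definition frame_mx (x : stiefel) : M := val x.

Lemma frame_mx_ortho x : ortho_mx (frame_mx x).
Proof. exact: (set_mem (valP x)). Qed.

Definition mk_frame (A : M) (oA : ortho_mx A) : stiefel :=
  exist (fun z => z \in [set A : M | ortho_mx A]) A (mem_set oA).

Lemma cts_frame_mx : continuous frame_mx.
Proof. exact: initial_continuous. Qed.

Lemma cts_to_stiefel (Y : topologicalType) (f : Y -> stiefel) :
  continuous (fun y => frame_mx (f y)) -> continuous f.
Proof. by move=> cf; apply: continuous_comp_initial. Qed.

Lemma inner_row (A B : M) i j : inner (row i A) (row j B) = dot (A i) (B j).
Proof. by apply: eq_bigr => k _; rewrite !mxE. Qed.

Fact frame_config_norm (x : stiefel) i : dot (row i (frame_mx x) 0) (row i (frame_mx x) 0) = 1.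
Proof. by rewrite -/(inner _ _) inner_row frame_mx_ortho eqxx. Qed.

Fact frame_config_independent (x : stiefel) : independent n (fun i => row i (frame_mx x)).
Proof.
apply/independentP => c cx j; rewrite /= in cx.
have : inner (\sum_i c i *: row i (frame_mx x)) (row j (frame_mx x)) = 0.
  by rewrite cx; apply: big1 => k _; rewrite mxE mul0r.
have -> : inner (\sum_i c i *: row i (frame_mx x)) (row j (frame_mx x)) =
    \sum_i c i * inner (row i (frame_mx x)) (row j (frame_mx x)).
  elim/big_rec2: _ => [|i u v _ <-]; first by apply: big1 => k _; rewrite mxE mul0r.
  by rewrite innerDl innerZl.
rewrite (bigD1 j) //= inner_row frame_mx_ortho eqxx mulr1 big1 ?addr0 // => i ij.
by rewrite inner_row frame_mx_ortho (negbTE ij) mulr0.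
Qed.

Definition frame_config (x : stiefel) : W :=
  mk_config (frame_config_norm x) (@frame_config_independent x).

Lemma frame_configE x i : config_vec (frame_config x) i = row i (frame_mx x).
Proof. by []. Qed.

Lemma cts_frame_config : continuous frame_config.
Proof.
apply: cts_to_config => i j.
rewrite (_ : (fun y => _) = (fun y => frame_mx y i j)); last first.
  by apply/funext => y; rewrite frame_configE mxE.
exact: cts_entry cts_frame_mx.
Qed.

Lemma frame_config_orthonormal x : orthonormal_config (frame_config x).
Proof. by move=> i j ij; rewrite !frame_configE inner_row frame_mx_ortho (negbTE ij). Qed.

Fact config_frame_subproof (x : W) : orthonormal_config x -> ortho_mx (\matrix_(i, j) config_vec x i 0 j).
Proof.
move=> ox i j; have rE k : (\matrix_(i, j) config_vec x i 0 j : M) k = config_vec x k 0.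
  by apply/funext => l; rewrite mxE.
rewrite !rE; have [->|ij] := eqVneq i j; first exact: config_vec_norm.
exact: ox.
Qed.

Definition config_frame (x : W) (ox : orthonormal_config x) : stiefel :=
  mk_frame (config_frame_subproof ox).

Lemma config_frameK x (ox : orthonormal_config x) : frame_config (config_frame ox) = x.
Proof.
by apply: config_vec_inj => i; rewrite frame_configE; apply/rowP => j; rewrite !mxE.
Qed.

Hypothesis nm : (n <= m.+1)%N.

Definition std_mx : M := \matrix_(i, j) ((i : nat) == j)%:R.

Lemma std_mx_ortho : ortho_mx std_mx.
Proof.
move=> i j; rewrite /dot (bigD1 (widen_ord nm i)) //= !mxE eqxx mul1r.
rewrite big1 ?addr0 => [|k ki]; first by rewrite eq_sym; congr (_%:R); congr nat_of_bool; exact: val_eqE.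
rewrite !mxE (_ : (i : nat) == k = false) ?mul0r //.
by apply: contraNF ki => /eqP ik; apply/eqP/val_inj.
Qed.

Definition std_frame : stiefel := mk_frame std_mx_ortho.

Lemma dot_std (v : 'I_m.+1 -> R) (i : 'I_n) : dot v (std_mx i) = v (widen_ord nm i).
Proof.
rewrite /dot (bigD1 (widen_ord nm i)) //= mxE eqxx mulr1 big1 ?addr0 // => k ki.
rewrite mxE (_ : (i : nat) == k = false) ?mulr0 //.
by apply: contraNF ki => /eqP ik; apply/eqP/val_inj.
Qed.

Section Step.
Variables (j : 'I_n) (f : cube 1 -> stiefel).
Hypothesis j3 : (j.+3 <= m.+1)%N.
Hypothesis cf : continuous f.
Hypothesis fb : forall t, cube_boundary t -> f t = std_frame.
Hypothesis fj : forall t (i : 'I_n), (i < j)%N -> frame_mx (f t) i = std_mx i.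

Let D (i : 'I_m.+1) := (j <= i)%N.

Fact step_norm t : dot (frame_mx (f t) j) (frame_mx (f t) j) = 1.
Proof. by rewrite frame_mx_ortho eqxx. Qed.

Fact step_supp t i : ~~ D i -> frame_mx (f t) j i = 0.
Proof.
rewrite /D -ltnNge => ij; have iN : (i < n)%N by exact: ltn_trans (ltn_ord j).
have -> : i = widen_ord nm (Ordinal iN) by apply: val_inj.
rewrite -dot_std -(fj t (i := Ordinal iN)) // frame_mx_ortho.
by rewrite -val_eqE /= gtn_eqF.
Qed.

(** The first [j] vectors being constant, the next one runs in the sphere of the last
    [m + 1 - j] coordinates, of dimension at least two, where its loop is null. The other
    vectors follow the homotopy by the rotations of [rot], which fix the first [j]
    vectors. *)
Lemma stiefel_step : exists f' : cube 1 -> stiefel,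
  [/\ continuous f', forall t, cube_boundary t -> f' t = std_frame,
      homotopic std_frame f f'
    & forall t (i : 'I_n), (i <= j)%N -> frame_mx (f' t) i = std_mx i].
Proof.
pose g t : supp_sphere D := mk_supp (step_norm t) (@step_supp t).
have cg : continuous g.
  by apply: cts_to_supp => i; exact: cts_entry (cts_comp cf cts_frame_mx).
pose e := g (corner 1).
have ge t : cube_boundary t -> g t = e.
  by move=> bt; apply: val_inj; rewrite /= !fb //; exact: corner_boundary.
have eE : supp_vec e = std_mx j by rewrite /e /supp_vec /= fb //; exact: corner_boundary.
have jl (k : 'I_3) : (j + k < m.+1)%N.
  by apply: leq_trans j3; have := ltn_ord k; rewrite -(ltn_add2l j) addn3.
have [||K [cK K0 K1 Kb]] := @supp_sphere_loop_null R _ D e g cg (erefl _) (ge _ top_boundary)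
    (fun k => Ordinal (jl k)).
- by move=> k l [/addnI/val_inj].
- by move=> k; exact: leq_addr.
pose H z : V := \row_i supp_vec (K z) i.
have HE z : H z 0 = supp_vec (K z) by apply/funext => i; rewrite mxE.
pose P (A : M) := ortho_mx A /\ forall i : 'I_n, (i < j)%N -> A i = std_mx i.
pose Q (b : V) := dot (b 0) (b 0) = 1 /\ forall i : 'I_m.+1, (i < j)%N -> b 0 i = 0.
pose tau (A : M) (b : V) : M := \matrix_(i, k) rot (A j) (b 0) (A i) k.
have tauE A b i : tau A b i = rot (A j) (b 0) (A i) by apply/funext => k; rewrite mxE.
have rowE (A : M) i : row i A 0 = A i by apply/funext => k; rewrite mxE.
have [||||||||L [cL L0 LH LP Lc]] := @homotopy_lifting_transport R M V (row j) P Q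
    (fun u v => 1 + dot (u 0) (v 0) != 0) tau _ _ _ 1 H (fun t => frame_mx (f t)).
- move=> b [b1 _]; have cU : continuous (fun z : V * V => 1 + dot (z.1 0) (z.2 0)).
    apply: cts_add; first exact: cts_cst.
    by apply: cts_dot => i; apply: cts_entry; [exact: cts_fst|exact: cts_snd].
  have := cU (b, b) [set x | x != 0]; apply.
  apply: open_nbhs_nbhs; split; first exact: open_neq.
  by rewrite /= b1; apply/eqP; lra.
- move=> A b [oA Aj] [b1 bj]; rewrite rowE => Ub.
  have Aj1 : dot (A j) (A j) = 1 by rewrite oA eqxx.
  split.
  + apply: at_mx => i k; rewrite (_ : (fun x => _) =
      (fun z : M * V => rot (z.1 j) (z.2 0) (z.1 i) k)); last first.
      by apply/funext => z; rewrite mxE.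
    apply: (@at_rot _ _ _ (fun z : M * V => z.1 j) (fun z => z.2 0) (fun z => z.1 i)) => // l;
      apply: at_cts; apply: cts_entry; [exact: cts_fst|exact: cts_snd|exact: cts_fst].
  + split=> [i i'|i ij]; first by rewrite !tauE dot_rot.
    rewrite tauE rot_fix; first exact: Aj.
      by rewrite oA -val_eqE /= gtn_eqF.
    by rewrite Aj // dot_std bj.
  + by apply/rowP => k; rewrite !mxE rot_move.
- move=> A [oA _]; apply/matrixP => i k.
  by rewrite mxE rowE rot_id // oA eqxx.
- by apply: cts_mx => a i; rewrite (_ : (fun x => _) = (fun x => supp_vec (K x) i)) ?(ord1 a);
    [exact: (cts_comp cK (@cts_supp_vec _ _ _ i))|apply/funext => x; rewrite mxE].
- exact: (cts_comp cf cts_frame_mx).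
- move=> z; split; rewrite HE ?supp_vec_norm // => i ij.
  by rewrite supp_vec_supp // /D -ltnNge.
- by move=> t; split; [exact: frame_mx_ortho|exact: fj].
- by move=> t; apply/rowP => i; rewrite !mxE K0.
have oL z : ortho_mx (L z) by have [] := LP z.
have Lb s t : cube_boundary t -> mk_frame (oL (s, t)) = std_frame.
  move=> bt; apply: val_inj => /=; rewrite Lc ?fb // => s'.
  by rewrite /H !Kb.
exists (fun t => mk_frame (oL (to_unit 1, t))); split.
- apply: cts_to_stiefel; apply: (cts_comp (f := fun t => (to_unit 1, t))) cL.
  by apply: cts_pair; [exact: cts_cst|exact: cts_id].
- by move=> t; exact: Lb.
- exists (fun z => mk_frame (oL z)); split=> //.
  + exact: cts_to_stiefel.
  + by move=> t; apply: val_inj; rewrite /= L0.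
- move=> t i; rewrite leq_eqVlt => /orP[/eqP/val_inj ->|ij]; last by have [_ ->] := LP (to_unit 1, t).
  by rewrite /frame_mx /= -rowE LH HE K1 eE.
Qed.

End Step.

Theorem stiefel_reduce (j : nat) (f : cube 1 -> stiefel) : (j <= n)%N -> (j.+2 <= m.+1)%N ->
  continuous f -> (forall t, cube_boundary t -> f t = std_frame) ->
  exists f' : cube 1 -> stiefel,
  [/\ continuous f', forall t, cube_boundary t -> f' t = std_frame,
      homotopic std_frame f f'
    & forall t (i : 'I_n), (i < j)%N -> frame_mx (f' t) i = std_mx i].
Proof.
elim: j => [_ _|j IH jn jm] cf fb.
  exists f; split=> //; exists (fun z => f z.2); split=> //.
    exact: (cts_comp (@cts_snd _ _) cf).
have [f1 [cf1 f1b ff1 f1j]] := IH (ltnW jn) (ltnW jm) cf fb.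
have [f2 [cf2 f2b f12 f2j]] := @stiefel_step (Ordinal jn) f1 jm cf1 f1b f1j.
exists f2; split=> //; first exact: homotopic_trans ff1 f12.
Qed.

(** Orthonormalising a loop of configurations and then straightening its first
    vectors. *)
Theorem config_reduce (j : nat) (f : cube 1 -> W) : (j <= n)%N -> (j.+2 <= m.+1)%N ->
  continuous f -> (forall t, cube_boundary t -> f t = frame_config std_frame) ->
  exists f' : cube 1 -> stiefel,
  [/\ continuous f', forall t, cube_boundary t -> f' t = std_frame,
      homotopic (frame_config std_frame) f (frame_config \o f')
    & forall t (i : 'I_n), (i < j)%N -> frame_mx (f' t) i = std_mx i].
Proof.
move=> jn jm cf fb.
pose g t := config_frame (gram_schmidt_orthonormal (f t)).
have gE t : frame_config (g t) = gram_schmidt (f t) by exact: config_frameK.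
have cg : continuous g.
  apply: cts_to_stiefel; apply: cts_mx => i k.
  rewrite (_ : (fun x => _) = (fun t => config_vec (gram_schmidt (f t)) i 0 k)).
    exact: cts_entry (cts_comp (cts_comp cf cts_gram_schmidt) (@cts_config_vec _ _ _ _ i)).
  by apply/funext => t; rewrite mxE.
have gb t : cube_boundary t -> g t = std_frame.
  move=> bt; apply: val_inj; apply/matrixP => i k.
  transitivity (config_vec (gram_schmidt (f t)) i 0 k); first by rewrite [LHS]mxE.
  rewrite fb // gram_schmidt_id; last exact: frame_config_orthonormal.
  by rewrite frame_configE mxE.
have [f' [cf' f'b gf' f'j]] := stiefel_reduce jn jm cg gb.
exists f'; split=> //.
apply: (homotopic_trans (g := frame_config \o g)).
  rewrite (_ : frame_config \o g = fun t => gram_schmidt (f t)); last by apply/funext => t; exact: gE.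
  by apply: homotopic_gram_schmidt => //; exact: frame_config_orthonormal.
exact: (homotopic_map cts_frame_config gf').
Qed.

End Stiefel.

(** * Configurations of fewer than [m] points *)

Section FewPoints.
Context {R : realType} {m n : nat}.
Local Notation cube := (@Defs.cube R).
Local Notation W := (config_sphere R m n n).
Hypothesis nm : (n <= m.+1)%N.

Lemma basis_config_image :
  basis_config R n nm = config_image (frame_config (std_frame (R := R) nm)).
Proof.
apply: val_inj; apply/funext => i; rewrite config_image_line frame_configE /=.
have -> : row i (frame_mx (std_frame (R := R) nm)) = delta_mx 0 (widen_ord nm i).
  by apply/rowP => j; rewrite !mxE /= -val_eqE eq_sym.
by rewrite (lineE (@delta_neq0 R m _)).
Qed.

Lemma flip_inj (e e' : 'I_n -> bool) (x : W) : flip e x = flip e' x -> e =1 e'.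
Proof.
move=> ee' i; have := congr1 (fun y => config_vec y i) ee'; rewrite !flipE => /eqP.
rewrite -subr_eq0 -scalerBl scaler_eq0 (negbTE (sphere_vec_neq0 _)) orbF subr_eq0.
by move=> /eqP/signr_inj.
Qed.

Lemma Z2_neq1M (a b : 'Z_2) : ((a * b)%g != 1%g) = (a != 1%g) (+) (b != 1%g).
Proof. by case: a => -[|[]] // ?; case: b => -[|[]]. Qed.

Lemma Z2_cases (a b : 'Z_2) : (a != 1%g) = (b != 1%g) -> a = b.
Proof. by case: a => -[|[]] // ?; case: b => -[|[]] // ? _; apply: val_inj. Qed.

Definition sign_of (g : {ffun 'I_n -> 'Z_2}) (i : 'I_n) : bool := g i != 1%g.

Lemma sign_ofM g h : sign_of (g * h)%g = fun i => sign_of g i (+) sign_of h i.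
Proof. by apply/funext => i; rewrite /sign_of ffunE Z2_neq1M. Qed.

Lemma sign_of1 : sign_of 1%g = fun=> false.
Proof. by apply/funext => i; rewrite /sign_of ffunE eqxx. Qed.

Let x0 := frame_config (std_frame (R := R) nm).
Let act (g : {ffun 'I_n -> 'Z_2} : groupType) (x : W) : W := flip (sign_of g) x.

Hypothesis n_small : (n < m)%N.

Let actM g h x : act (g * h)%g x = act g (act h x).
Proof. by rewrite /act flipM sign_ofM. Qed.

Definition single (i : 'I_n) : {ffun 'I_n -> 'Z_2} := [ffun j => if j == i then (1%R : 'Z_2) else 1%g].

Lemma sign_single i j : sign_of (single i) j = (j == i).
Proof. by rewrite /sign_of ffunE; case: (j == i). Qed.

(** A basis vector is turned to its opposite through the last coordinate direction,
    which is orthogonal to all the other vectors of the frame. *)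
Lemma reaches_single i : reaches (R := R) x0 act (single i).
Proof.
pose v (x : R) (k : 'I_m.+1) : R :=
  (1 - 2 * x) * (k == widen_ord nm i)%:R + x * (1 - x) * (k == ord_max)%:R.
have i_max : ord_max != widen_ord nm i.
  by rewrite -val_eqE /= gtn_eqF //; exact: ltn_trans n_small.
have v0 x : dot (v x) (v x) != 0.
  apply/eqP => /dot_eq0 h; have := congr1 (fun f => f (widen_ord nm i)) h.
  rewrite /v eqxx eq_sym (negbTE i_max) mulr0 addr0 mulr1 => h1.
  have := congr1 (fun f => f ord_max) h; rewrite /v eqxx (negbTE i_max) mulr0 add0r mulr1.
  have -> : x = 2^-1 by lra.
  by move=> /eqP; rewrite mulf_eq0 => /orP[] /eqP; lra.
pose A (x : R) : 'M[R]_(n, m.+1) :=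
  \matrix_(j, k) if j == i then unitize (v x) k else std_mx j k.
have AE x j : A x j = if j == i then unitize (v x) else std_mx j.
  by apply/funext => k; rewrite mxE; case: ifP.
have vj x (j : 'I_n) : j != i -> v x (widen_ord nm j) = 0.
  move=> ji; rewrite /v (_ : widen_ord nm j == widen_ord nm i = false).
    rewrite (_ : widen_ord nm j == ord_max = false); first by rewrite !mulr0 addr0.
    by rewrite -val_eqE /= ltn_eqF //; exact: ltn_trans (ltn_ord j) n_small.
  by apply/negbTE; rewrite -val_eqE.
have oA x : ortho_mx (A x).
  move=> j j'; rewrite !AE; case: (eqVneq j i) => ji; case: (eqVneq j' i) => j'i.
  - by rewrite unitize_norm // ji j'i eqxx.
  - by rewrite dot_std /unitize vj // mul0r ji eq_sym (negbTE j'i).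
  - by rewrite dotC dot_std /unitize vj // mul0r j'i (negbTE ji).
  - exact: std_mx_ortho.
have ee k : (k == widen_ord nm i)%:R = std_mx i k :> R by rewrite mxE -val_eqE eq_sym.
have A0 : A 0 = std_mx.
  apply/matrixP => j k; rewrite mxE; case: eqP => [->|//].
  have -> : v 0 = std_mx i by apply/funext => l; rewrite /v ee mulr0 subr0 mul1r !mul0r addr0.
  by rewrite unitize_id // std_mx_ortho // eqxx.
have A1 j k : A 1 j k = (-1) ^+ (j == i) * std_mx j k.
  rewrite mxE; case: eqP => [->|_]; last by rewrite expr0 mul1r.
  have -> : v 1 = fun l => -1 * std_mx i l by apply/funext => l; rewrite /v ee subrr mulr0 mul0r addr0 mulr1; congr (_ * _); lra.
  by rewrite expr1 unitize_id // dotZl dotZr std_mx_ortho // eqxx mulr1 mulrNN mulr1.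
exists (fun t : cube 1 => frame_config (mk_frame (oA (unit_val (t ord0))))); split.
- apply: (cts_comp (f := fun t : cube 1 => mk_frame (oA (unit_val (t ord0)))));
    last exact: cts_frame_config.
  apply: cts_to_stiefel; apply: cts_mx => j k.
  rewrite (_ : (fun x => _) = (fun t : cube 1 =>
    if j == i then unitize (v (unit_val (t ord0))) k else std_mx j k)); last first.
    by apply/funext => t; rewrite mxE.
  case: (j == i); last exact: cts_cst.
  apply: cts_unitize => // l; have ct := @cts_first R 0.
  apply: cts_add; apply: cts_mul; try exact: cts_cst.
    by apply: (cts_add (@cts_cst _ R 1)); apply: cts_opp; apply: cts_mul ct; exact: cts_cst.
  by apply: cts_mul => //; apply: (cts_add (@cts_cst _ R 1)); exact: (cts_opp ct).
- by congr frame_config; apply: val_inj; rewrite /= to_unit0 A0.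
- apply: config_vec_inj => j; rewrite flipE sign_single !frame_configE.
  by apply/rowP => k; rewrite [LHS]mxE [RHS]mxE [X in _ = _ * X]mxE /= to_unit1 A1.
Qed.

Lemma reaches_all g : reaches (R := R) x0 act g.
Proof.
have cact h : continuous (act h) by exact: cts_flip.
suff h k : forall g : {ffun 'I_n -> 'Z_2}, (forall i : 'I_n, (k <= i)%N -> g i = 1%g) ->
    reaches (R := R) x0 act g.
  by apply: (h n) => i; rewrite leqNgt ltn_ord.
elim: k => [|k IH] {}g gk.
  have -> : g = 1%g by apply/ffunP => i; rewrite ffunE gk.
  exists (fun=> x0); split=> //; first exact: cts_cst.
  by rewrite /act sign_of1 flip0.
have [kn|nk] := ltnP k n; last first.
  by apply: IH => i ki; apply: gk; have := leq_trans (ltn_ord i) nk; rewrite ltnNge ki.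
pose i := Ordinal kn; have [gi|gi] := boolP (sign_of g i); last first.
  apply: IH => j; rewrite leq_eqVlt => /orP[/eqP kj|]; last exact: gk.
  have -> : j = i by apply: val_inj.
  by apply/eqP; move: gi; rewrite /sign_of negbK.
have -> : g = (single i * (single i * g))%g.
  apply/ffunP => j; apply: Z2_cases; rewrite -!/(sign_of _ _) !sign_ofM.
  by rewrite addbA addbb.
apply: reachesM => //; first exact: reaches_single.
apply: IH => j; rewrite leq_eqVlt => /orP[/eqP kj|kj].
  have -> : j = i by apply: val_inj.
  by apply/eqP; rewrite -[_ == _]negbK -/(sign_of _ _) sign_ofM sign_single eqxx gi.
apply/eqP; rewrite -[_ == _]negbK -/(sign_of _ _) sign_ofM sign_single.
by rewrite /sign_of gk // eqxx /= addbF -val_eqE /= gtn_eqF.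
Qed.

(** All vectors of a loop of spherical configurations can be made constant; the deck group
    is that of sign changes. *)
Theorem fundamental_group_few_points :
  isomorphic (homotopy_group R 1 (basis_config R n nm)) ({ffun 'I_n -> 'Z_2} : groupType).
Proof.
rewrite basis_config_image.
apply: (fundamental_group_of_covering (config_covering n n) (act := act)) => //.
- by move=> g; exact: cts_flip.
- by move=> g x; exact: flip_image.
- by move=> x; rewrite /act sign_of1 flip0.
- move=> g h /flip_inj gh; apply/ffunP => i; apply: Z2_cases; exact: gh.
- move=> x /flip_fiber[e ->]; exists [ffun i => if e i then (1%R : 'Z_2) else 1%g].
  by congr flip; apply/funext => i; rewrite /sign_of ffunE; case: (e i).
- exact: reaches_all.
- move=> F cF F0 F1.
  have Fb t : cube_boundary t -> F t = x0 by move=> /cube1_boundary[] ->.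
  have [f' [cf' f'b Ff' f'n]] := config_reduce (leqnn n) (n_small : (n.+2 <= m.+1)%N) cF Fb.
  have -> : (fun=> config_image x0) = @config_image R m n n \o (frame_config \o f') :> (cube 1 -> _).
    apply/funext => t; rewrite /= (_ : f' t = std_frame nm) //.
    by apply: val_inj; apply/matrixP => i j; rewrite -[LHS]/(frame_mx (f' t) i j) f'n.
  exact: (homotopic_map (covering_continuous (config_covering n n)) Ff').
Qed.

End FewPoints.

(** * The Clifford algebra of Euclidean four-space *)

(** An element selects some of the four generators; it stands for their product in
    increasing order, a blade. Up to sign, blades multiply like elements of this group of
    exponent two. *)
Definition bits := (bool * bool * bool * bool)%type.
HB.instance Definition _ := GRing.Zmodule.on bits.
HB.instance Definition _ := Finite.on bits.

(** The sign [(-1) ^+ swap x y] is that of the sorting of the concatenation of two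
    increasing words in anticommuting letters. *)
Definition swap (x y : bits) : bool :=
  let: (((_, x1), x2), x3) := x in let: (((y0, y1), y2), _) := y in
  (x1 && y0) (+) (x2 && (y0 (+) y1)) (+) (x3 && (y0 (+) y1 (+) y2)).

Arguments swap : simpl never.

Lemma bits_addK (x : bits) : x + x = 0.
Proof. by case: x => [[[[] []] []] []]. Qed.

Lemma bits_addKK (x y : bits) : x + (x + y) = y.
Proof. by rewrite addrA bits_addK add0r. Qed.

Lemma swapDl x y z : swap (x + y) z = swap x z (+) swap y z.
Proof.
case: x => [[[x0 x1] x2] x3]; case: y => [[[y0 y1] y2] y3]; case: z => [[[z0 z1] z2] z3].
change (((x1 (+) y1) && z0) (+) ((x2 (+) y2) && (z0 (+) z1)) (+) ((x3 (+) y3) && (z0 (+) z1 (+) z2))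
  = swap (((x0, x1), x2), x3) (((z0, z1), z2), z3) (+) swap (((y0, y1), y2), y3) (((z0, z1), z2), z3)).
rewrite /swap; case: z0; case: z1; case: z2; rewrite ?andbT ?andbF ?addbF ?addFb //;
  by case: x1; case: x2; case: x3; case: y1; case: y2; case: y3.
Qed.

Lemma swapDr x y z : swap z (x + y) = swap z x (+) swap z y.
Proof.
case: x => [[[x0 x1] x2] x3]; case: y => [[[y0 y1] y2] y3]; case: z => [[[z0 z1] z2] z3].
change ((z1 && (x0 (+) y0)) (+) (z2 && ((x0 (+) y0) (+) (x1 (+) y1))) (+)
  (z3 && ((x0 (+) y0) (+) (x1 (+) y1) (+) (x2 (+) y2)))
  = swap (((z0, z1), z2), z3) (((x0, x1), x2), x3) (+) swap (((z0, z1), z2), z3) (((y0, y1), y2), y3)).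
rewrite /swap; case: z1; case: z2; case: z3; rewrite ?andTb ?andFb ?addbF ?addFb //;
  by case: x0; case: x1; case: x2; case: y0; case: y1; case: y2.
Qed.

Lemma swap0l z : swap 0 z = false.
Proof. by have := swapDl 0 0 z; rewrite addr0; case: (swap 0 z). Qed.

Lemma swap0r z : swap z 0 = false.
Proof. by have := swapDr 0 0 z; rewrite addr0; case: (swap z 0). Qed.

Definition anticomm x y := swap x y (+) swap y x.

(** The fifth letter is the product of the first four, so that all five square to
    one and anticommute. *)
Definition letter (k : nat) : bits :=
  match k with
  | 0 => (((true, false), false), false)
  | 1 => (((false, true), false), false)
  | 2 => (((false, false), true), false)
  | 3 => (((false, false), false), true)
  | _ => (((true, true), true), true)
  end.

Lemma swap_letter k : swap (letter k) (letter k) = false.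
Proof. by case: k => [|[|[|[]]]]. Qed.

Lemma letter_neq0 k : letter k != 0.
Proof. by case: k => [|[|[|[]]]]. Qed.

Lemma anticomm_letter a b : (a < 5)%N -> (b < 5)%N ->
  anticomm (letter a) (letter b) = (a != b).
Proof.
by case: a => [|[|[|[|[]]]]] // _; case: b => [|[|[|[|[]]]]].
Qed.

Lemma letter_inj a b : (a < 5)%N -> (b < 5)%N -> (letter a == letter b) = (a == b).
Proof.
by case: a => [|[|[|[|[]]]]] // _; case: b => [|[|[|[|[]]]]].
Qed.

(** The square of the blade of [K] is one or minus one according to [swap K K]. The blades
    of square one are the empty one and the five letters. *)
Lemma isotropic_letter (K : bits) : swap K K = false -> K != 0 ->
  exists2 a, (a < 5)%N & K = letter a.
Proof.
by case: K => [[[[] []] []] []] // _ _; [exists 4%N|exists 0%N|exists 1%N|exists 2%N|exists 3%N].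
Qed.

Lemma isotropic_add (K L : bits) : swap K K = false -> K != 0 ->
  swap L L = false -> L != 0 -> K + L != 0 -> swap (K + L) (K + L) = true.
Proof.
move=> K0 Kn L0 Ln; have [a a5 ->] := isotropic_letter K0 Kn.
have [b b5 ->] := isotropic_letter L0 Ln => ab.
rewrite swapDl !swapDr !swap_letter addbF addFb.
have : anticomm (letter a) (letter b) = true.
  by rewrite anticomm_letter //; apply: contraNneq ab => ->; rewrite bits_addK.
by [].
Qed.

(** The centre of the Clifford algebra will be scalar for this reason. *)
Lemma anticomm_nondegenerate (K : bits) :
  (forall k, (k < 4)%N -> anticomm (letter k) K = false) -> K = 0.
Proof.
move=> h; have := (h 0 isT, h 1 isT, h 2 isT, h 3 isT)%N.
by clear h; case: K => [[[[] []] []] []] [[[]]].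
Qed.

Section Clifford.
Context {R : realType}.

(** The Clifford algebra is the group algebra of [bits] with multiplication twisted by the
    bilinear form [swap]. *)
Definition cliff : Type := bits -> R.
HB.instance Definition _ := GRing.Lmodule.copy cliff (bits -> R^o).
HB.instance Definition _ := Topological.copy cliff (prod_topology (fun _ : bits => R)).

Local Notation sgn b := ((-1 : R) ^+ nat_of_bool b).

Lemma sgnK b : sgn b * sgn b = 1.
Proof. by rewrite -signr_addb addbb. Qed.

Implicit Types x y z U : cliff.
Implicit Types I K L : bits.

Definition cliff_mul x y : cliff :=
  fun K => \sum_I sgn (swap I (I + K)) * x I * y (I + K).

Definition blade K : cliff := fun L => (L == K)%:R.

Lemma bits_sum_shift (F : bits -> R) K : \sum_I F I = \sum_I F (K + I).
Proof.
rewrite (reindex (fun I => K + I)) //=.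
by exists (fun I => K + I) => I _; rewrite bits_addKK.
Qed.

Fact cliff_mulA : associative cliff_mul.
Proof.
move=> x y z; apply/funext => K; rewrite /cliff_mul.
transitivity (\sum_I \sum_B sgn (swap I (I + K) (+) swap B (B + (I + K))) *
    (x I * y B * z (B + (I + K)))).
  apply: eq_bigr => I _; rewrite mulr_sumr; apply: eq_bigr => B _.
  by rewrite signr_addb; ring.
symmetry.
transitivity (\sum_A \sum_I sgn (swap A (A + K) (+) swap I (I + A)) *
    (x I * y (I + A) * z (A + K))).
  apply: eq_bigr => A _; rewrite mulr_sumr mulr_suml; apply: eq_bigr => I _.
  by rewrite signr_addb; ring.
rewrite exchange_big /=; apply: eq_bigr => I _.
rewrite (bits_sum_shift _ I); apply: eq_bigr => B _.
rewrite bits_addKK; congr (_ * (_ * _ * z _)); last by rewrite [B + _]addrCA addrA.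
congr (_ ^+ nat_of_bool _); rewrite !swapDl !swapDr.
by case: (swap I I) (swap I B) (swap I K) (swap B I) (swap B B) (swap B K) => [] [] [] [] [] [].
Qed.

Lemma blade_mulE I x K : cliff_mul (blade I) x K = sgn (swap I (I + K)) * x (I + K).
Proof.
rewrite /cliff_mul (bigD1 I) //= /blade eqxx mulr1 big1 ?addr0 // => L /negbTE ->.
by rewrite mulr0 mul0r.
Qed.

Lemma mul_bladeE I x K : cliff_mul x (blade I) K = sgn (swap (I + K) I) * x (I + K).
Proof.
rewrite /cliff_mul (bigD1 (I + K)) //= /blade -[I + K + K]addrA bits_addK addr0 eqxx mulr1 big1 ?addr0 // => L LK.
rewrite (_ : L + K == I = false) ?mulr0 //; apply: contraNF LK => /eqP <-.
by rewrite -addrA bits_addK addr0.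
Qed.

Fact cliff_mul1x : left_id (blade 0) cliff_mul.
Proof. by move=> x; apply/funext => K; rewrite blade_mulE add0r swap0l mul1r. Qed.

Fact cliff_mulx1 : right_id (blade 0) cliff_mul.
Proof. by move=> x; apply/funext => K; rewrite mul_bladeE add0r swap0r mul1r. Qed.

Fact cliff_mulDl : left_distributive cliff_mul +%R.
Proof.
move=> x y z; apply/funext => K; rewrite /cliff_mul -[RHS]big_split /=.
by apply: eq_bigr => I _; rewrite -mulrDl -mulrDr.
Qed.

Fact cliff_mulDr : right_distributive cliff_mul +%R.
Proof.
move=> x y z; apply/funext => K; rewrite /cliff_mul -[RHS]big_split /=.
by apply: eq_bigr => I _; rewrite -mulrDr.
Qed.

Fact cliff_1neq0 : blade 0 != 0.
Proof.
apply/eqP => /(congr1 (fun f : cliff => f 0)) /eqP.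
by rewrite /blade eqxx [X in _ == X](_ : _ = 0) // oner_eq0.
Qed.

HB.instance Definition _ := GRing.Zmodule_isNzRing.Build cliff cliff_mulA
  cliff_mul1x cliff_mulx1 cliff_mulDl cliff_mulDr cliff_1neq0.

Fact cliff_scaleAl (a : R) x y : a *: (x * y) = a *: x * y.
Proof.
apply/funext => K; change (a * (cliff_mul x y K) = cliff_mul (a *: x) y K).
rewrite /cliff_mul mulr_sumr; apply: eq_bigr => I _.
change (a * (sgn (swap I (I + K)) * x I * y (I + K)) =
  sgn (swap I (I + K)) * (a * x I) * y (I + K)); ring.
Qed.

HB.instance Definition _ := GRing.Lmodule_isLalgebra.Build R cliff cliff_scaleAl.

Fact cliff_scaleAr (a : R) x y : a *: (x * y) = x * (a *: y).
Proof.
apply/funext => K; change (a * (cliff_mul x y K) = cliff_mul x (a *: y) K).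
rewrite /cliff_mul mulr_sumr; apply: eq_bigr => I _.
change (a * (sgn (swap I (I + K)) * x I * y (I + K)) =
  sgn (swap I (I + K)) * x I * (a * y (I + K))); ring.
Qed.

HB.instance Definition _ := GRing.Lalgebra_isAlgebra.Build R cliff cliff_scaleAr.

Lemma cliffD x y K : (x + y) K = x K + y K. Proof. by []. Qed.
Lemma cliffN x K : (- x) K = - x K. Proof. by []. Qed.
Lemma cliffZ (a : R) x K : (a *: x) K = a * x K. Proof. by []. Qed.
Lemma cliff0 K : (0 : cliff) K = 0. Proof. by []. Qed.
Lemma cliff1 K : (1 : cliff) K = (K == 0)%:R. Proof. by []. Qed.
Lemma cliffM x y K : (x * y) K = \sum_I sgn (swap I (I + K)) * x I * y (I + K).
Proof. by []. Qed.
Lemma cliff_bladeM I x K : (blade I * x) K = sgn (swap I (I + K)) * x (I + K).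
Proof. exact: blade_mulE. Qed.
Lemma cliff_Mblade I x K : (x * blade I) K = sgn (swap (I + K) I) * x (I + K).
Proof. exact: mul_bladeE. Qed.
Lemma cliff_sum (T : Type) (r : seq T) (P : pred T) (F : T -> cliff) K :
  (\sum_(i <- r | P i) F i) K = \sum_(i <- r | P i) F i K.
Proof. by elim/big_rec2: _ => // i a b _ <-. Qed.

Lemma bladeM I K : blade I * blade K = sgn (swap I K) *: blade (I + K).
Proof.
apply/funext => L; rewrite cliff_bladeM cliffZ /blade.
have -> : (I + L == K) = (L == I + K).
  by apply/eqP/eqP => [<-|->]; rewrite bits_addKK.
case: eqP => [->|_]; last by rewrite !mulr0.
by rewrite bits_addKK.
Qed.

(** The anti-automorphism that reverses blades and fixes the generators. It is the adjoint for
    the inner product in which blades are orthonormal ([dot_star]). *)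
Definition star x : cliff := fun K => sgn (swap K K) * x K.

Lemma starD x y : star (x + y) = star x + star y.
Proof. by apply/funext => K; rewrite cliffD -mulrDr. Qed.

Lemma starZ (a : R) x : star (a *: x) = a *: star x.
Proof. by apply/funext => K; rewrite cliffZ /star cliffZ; ring. Qed.

Lemma starK x : star (star x) = x.
Proof. by apply/funext => K; rewrite /star mulrA sgnK mul1r. Qed.

Lemma starM x y : star (x * y) = star y * star x.
Proof.
apply/funext => K; rewrite cliffM /star cliffM mulr_sumr (bits_sum_shift _ K).
apply: eq_bigr => I _; rewrite (addrC K I) -addrA bits_addK addr0.
set a := sgn _; set b := sgn (swap (I + K) I); set c := sgn (swap I (I + K)).
set d := sgn (swap I I); set e := sgn (swap (I + K) (I + K)).
suff -> : a * (b * x (I + K) * y I) = (a * b) * (y I * x (I + K)).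
  have -> : a * b = c * d * e.
    rewrite /a /b /c /d /e -!signr_addb; congr (_ ^+ nat_of_bool _).
    rewrite !swapDl !swapDr.
    by case: (swap K K) (swap I I) (swap I K) (swap K I) => [] [] [] [].
  by ring.
by ring.
Qed.

Lemma star_blade K : star (blade K) = sgn (swap K K) *: blade K.
Proof.
apply/funext => L; rewrite cliffZ /star /blade.
by case: eqP => [->|_]; rewrite ?mulr0.
Qed.

Lemma star1 : star 1 = 1.
Proof. by rewrite (_ : 1 = blade 0) // star_blade swap0l scale1r. Qed.

Lemma star_letter k : star (blade (letter k)) = blade (letter k).
Proof. by rewrite star_blade swap_letter expr0 scale1r. Qed.

Lemma dot_star x y : dot x y = (star x * y) 0.
Proof.
rewrite cliffM; apply: eq_bigr => I _.
by rewrite addr0 /star mulrA sgnK mul1r.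
Qed.

Lemma trM x y : (x * y) 0 = (y * x) 0.
Proof. by rewrite !cliffM; apply: eq_bigr => I _; rewrite !addr0; ring. Qed.

Lemma dot_blade K x : dot (blade K) x = x K.
Proof.
rewrite /dot (bigD1 K) //= /blade eqxx mul1r big1 ?addr0 // => L /negbTE ->.
by rewrite mul0r.
Qed.

Lemma dotDcl x y z : dot (x + y) z = dot x z + dot y z.
Proof. by rewrite !dot_star starD mulrDl. Qed.

Lemma dotZcl (a : R) x y : dot (a *: x) y = a * dot x y.
Proof. by rewrite !dot_star starZ -scalerAl. Qed.

Lemma dotZcr (a : R) x y : dot x (a *: y) = a * dot x y.
Proof. by rewrite dotC dotZcl dotC. Qed.

(** Commutation with a blade up to a sign is a condition on the support. *)
Lemma blade_commP (I : bits) (s : bool) x :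
  blade I * x = sgn s *: (x * blade I) <-> (forall K, anticomm I K != s -> x K = 0).
Proof.
have signs K : blade I * x = sgn s *: (x * blade I) ->
    sgn (swap I K) * x K = sgn (s (+) swap K I) * x K.
  move=> /(congr1 (fun f : cliff => f (I + K))).
  by rewrite cliffZ cliff_bladeM cliff_Mblade !bits_addKK mulrA -signr_addb.
split=> [h K ab|h].
  have := signs K h; rewrite /anticomm in ab.
  have -> : s (+) swap K I = ~~ swap I K.
    by move: ab; clear; case: s; case: (swap I K); case: (swap K I).
  case: (swap I K); rewrite /= ?expr0 ?expr1; by lra.
apply/funext => K; rewrite cliffZ cliff_bladeM cliff_Mblade mulrA -signr_addb.
have [ab|/h ->] := eqVneq (anticomm I (I + K)) s; last by rewrite !mulr0.
congr (_ ^+ nat_of_bool _ * _); move: ab; rewrite /anticomm.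
by clear; case: s; case: (swap I (I + K)); case: (swap (I + K) I).
Qed.

Lemma blade_comm_supp (I : bits) x :
  blade I * x = x * blade I <-> (forall K, anticomm I K -> x K = 0).
Proof.
split=> h; last first.
  have /blade_commP : forall K, anticomm I K != false -> x K = 0.
    by move=> K; rewrite eqbF_neg negbK; exact: h.
  by rewrite expr0 scale1r.
have /blade_commP hh : blade I * x = sgn false *: (x * blade I) by rewrite expr0 scale1r.
by move=> K IK; apply: hh; rewrite IK.
Qed.

Lemma central_scalar x :
  (forall k, (k < 4)%N -> blade (letter k) * x = x * blade (letter k)) -> x = x 0 *: 1.
Proof.
move=> h; apply/funext => K; rewrite cliffZ cliff1.
have [->|K0] := eqVneq K 0; first by rewrite mulr1.
rewrite mulr0; apply: contrapT => xK; case/eqP: K0.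
apply: anticomm_nondegenerate => k k4; apply/negP => ck; apply: xK.
by have /blade_comm_supp := h k k4; apply.
Qed.

(** [1 - U * star U] is a self-adjoint idempotent, and its trace is zero because that of
    [star U * U] is one; so its norm is zero. *)
Lemma unitary_sym U : star U * U = 1 -> U * star U = 1.
Proof.
move=> UU; set P := U * star U.
have PP : P * P = P by rewrite /P mulrA -(mulrA U) UU mulr1.
have sP : star P = P by rewrite /P starM starK.
have trP : P 0 = 1 by rewrite /P trM UU cliff1 eqxx.
have D0 : dot (1 - P) (1 - P) = 0.
  rewrite dot_star starD -scaleN1r starZ sP star1 scaleN1r.
  rewrite mulrBr mulr1 mulrBl mul1r PP subrr subr0.
  by rewrite cliffD cliffN trP cliff1 eqxx subrr.
by apply/eqP; rewrite eq_sym -subr_eq0; apply/eqP; exact: dot_eq0 D0.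
Qed.

Lemma unitary_norm U : star U * U = 1 -> dot U U = 1.
Proof. by move=> UU; rewrite dot_star UU cliff1 eqxx. Qed.

(** Self-adjoint elements without scalar part are supported on the nonempty blades of
    square one, that is, on the five letters; they form a Euclidean five-space. *)
Definition cvector x : Prop := star x = x /\ x 0 = 0.

Lemma cvectorP x : cvector x -> forall K, x K != 0 -> swap K K = false /\ K != 0.
Proof.
move=> [sx x0] K xK; split; last by apply: contraNneq xK => ->; rewrite x0.
have := congr1 (fun f : cliff => f K) sx; rewrite /star.
by case: (swap K K) => //; rewrite expr1 => h; case/eqP: xK; lra.
Qed.

(** A product of two distinct letters has square minus one, so the self-adjoint element
    [x * y + y * x] has no other coordinate than the scalar one. *)
Lemma clifford_relation x y : cvector x -> cvector y -> x * y + y * x = (2 * dot x y) *: 1.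
Proof.
move=> vx vy; apply/funext => K; rewrite cliffZ cliff1.
have [->|K0] := eqVneq K 0.
  have [sx _] := vx; rewrite mulr1 cliffD (trM y x) dot_star sx; ring.
rewrite mulr0; set z := x * y + y * x.
have sz : star z = z by rewrite /z starD !starM vx.1 vy.1 addrC.
have [sK|sK] := boolP (swap K K).
  by have := congr1 (fun f : cliff => f K) sz; rewrite /star sK expr1; lra.
have zero (u v : cliff) : cvector u -> cvector v -> (u * v) K = 0.
  move=> vu vv; rewrite cliffM big1 // => I _.
  have [->|uI] := eqVneq (u I) 0; first by rewrite mulr0 mul0r.
  have [->|vI] := eqVneq (v (I + K)) 0; first by rewrite mulr0.
  have [I1 I2] := cvectorP vu uI; have [L1 L2] := cvectorP vv vI.
  by have := isotropic_add I1 I2 L1 L2; rewrite bits_addKK (negbTE sK) => /(_ K0).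
by rewrite /z cliffD !zero // addr0.
Qed.

Lemma cvector_letter k : cvector (blade (letter k)).
Proof. by split; [exact: star_letter|rewrite /blade eq_sym (negbTE (letter_neq0 k))]. Qed.

Lemma cvectorD x y : cvector x -> cvector y -> cvector (x + y).
Proof. by move=> [a b] [c d]; split; [rewrite starD a c|rewrite cliffD b d addr0]. Qed.

Lemma cvectorZ (a : R) x : cvector x -> cvector (a *: x).
Proof. by move=> [sx x0]; split; [rewrite starZ sx|rewrite cliffZ x0 mulr0]. Qed.

Lemma cvector0 : cvector 0.
Proof. by split; [apply/funext => K; rewrite /star cliff0 mulr0|]. Qed.

Lemma cvector_conj U x : star U * U = 1 -> cvector x -> cvector (U * x * star U).
Proof.
move=> UU [sx x0]; split; first by rewrite !starM starK sx mulrA.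
by rewrite trM mulrA UU mul1r.
Qed.

Lemma dot_conj U x y : star U * U = 1 -> dot (U * x * star U) (U * y * star U) = dot x y.
Proof.
move=> UU; rewrite !dot_star !starM starK.
rewrite -!mulrA (mulrA (star U) U) UU mul1r trM -!mulrA.
by rewrite UU mulr1.
Qed.

Lemma cts_cliffM (Y : topologicalType) (f g : Y -> cliff) :
  (forall K, continuous (fun w => f w K)) -> (forall K, continuous (fun w => g w K)) ->
  forall K, continuous (fun w => (f w * g w) K).
Proof.
move=> cf cg K; apply: cts_sum => I; apply: cts_mul => //.
by apply: cts_mul => //; exact: cts_cst.
Qed.

Lemma cts_star (Y : topologicalType) (f : Y -> cliff) :
  (forall K, continuous (fun w => f w K)) -> forall K, continuous (fun w => star (f w) K).
Proof. by move=> cf K; apply: cts_mul => //; exact: cts_cst. Qed.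

Lemma cts_cliff (Y : topologicalType) (f : Y -> cliff) :
  (forall K, continuous (fun w => f w K)) -> continuous f.
Proof. by move=> cf; exact: cts_ptws. Qed.

Lemma cts_cliff_coord K : continuous (fun x : cliff => x K).
Proof. exact: (@proj_continuous bits (fun=> R) K). Qed.

End Clifford.

Arguments cliff : clear implicits.

(** * Orthonormal frames and unitary elements of the Clifford algebra *)

Section Words.
Context {R : realType}.
Local Notation cliff := (cliff R).
Local Notation sgn b := ((-1 : R) ^+ nat_of_bool b).
Implicit Types (w : nat -> cliff) (K : bits).

Definition optional (x : cliff) (b : bool) : cliff := if b then x else 1.

(** The product, in increasing order, of the elements selected by [K]. *)
Definition word w K : cliff :=
  optional (w 0%N) K.1.1.1 * (optional (w 1%N) K.1.1.2 *
    (optional (w 2%N) K.1.2 * optional (w 3%N) K.2)).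

(** Four elements that satisfy the relations of the generators: their words multiply like
    blades ([letter_word]). *)
Definition clifford_family w : Prop := [/\ forall k, (k < 4)%N -> w k * w k = 1,
  forall k l, (k < 4)%N -> (l < 4)%N -> k != l -> w k * w l = - (w l * w k)
  & forall k, (k < 4)%N -> star (w k) = w k].

Lemma optional_anticomm x y b z : x * y = - (y * x) ->
  x * (optional y b * z) = sgn b *: (optional y b * (x * z)).
Proof.
move=> xy; case: b; rewrite /optional ?expr0 ?expr1 ?scale1r ?mul1r //.
by rewrite mulrA xy scaleN1r mulNr mulrA.
Qed.

Lemma optional_same x b z : x * x = 1 -> x * (optional x b * z) = optional x (true (+) b) * z.
Proof. by move=> xx; case: b; rewrite /optional /= ?mul1r // mulrA xx mul1r. Qed.

Lemma optional_same1 x b : x * x = 1 -> x * optional x b = optional x (true (+) b).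
Proof. by move=> xx; case: b; rewrite /optional /= ?mulr1. Qed.

Lemma letter_word w k K : clifford_family w -> (k < 4)%N ->
  w k * word w K = sgn (swap (letter k) K) *: word w (letter k + K).
Proof.
move=> [w2 wa _]; case: K => [[[a b] c] d].
have aa i j (i4 : (i < 4)%N) (j4 : (j < 4)%N) (ij : i != j) b' z :=
  @optional_anticomm (w i) (w j) b' z (wa i j i4 j4 ij).
have os i (i4 : (i < 4)%N) b' z := @optional_same (w i) b' z (w2 i i4).
case: k => [|[|[|[|//]]]] _.
- have [-> ->] : letter 0%N + (((a, b), c), d) = (((~~ a, b), c), d) /\
    swap (letter 0%N) (((a, b), c), d) = false by case: a b c d => [] [] [] [].
  by rewrite /word /fst /snd (os 0%N isT) addTb expr0 scale1r.
- have [-> ->] : letter 1%N + (((a, b), c), d) = (((a, ~~ b), c), d) /\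
    swap (letter 1%N) (((a, b), c), d) = a by case: a b c d => [] [] [] [].
  by rewrite /word /fst /snd (aa 1 0 isT isT isT)%N (os 1%N isT) addTb.
- have [-> ->] : letter 2%N + (((a, b), c), d) = (((a, b), ~~ c), d) /\
    swap (letter 2%N) (((a, b), c), d) = a (+) b by case: a b c d => [] [] [] [].
  rewrite /word /fst /snd (aa 2 0 isT isT isT)%N (aa 2 1 isT isT isT)%N (os 2%N isT) addTb.
  by rewrite -!scalerAr scalerA -signr_addb.
- have [-> ->] : letter 3%N + (((a, b), c), d) = (((a, b), c), ~~ d) /\
    swap (letter 3%N) (((a, b), c), d) = a (+) b (+) c by case: a b c d => [] [] [] [].
  rewrite /word /fst /snd (aa 3 0 isT isT isT)%N (aa 3 1 isT isT isT)%N (aa 3 2 isT isT isT)%N.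
  rewrite (optional_same1 _ (w2 3%N isT)) addTb.
  by rewrite -!scalerAr !scalerA -!signr_addb addbA.
Qed.

Lemma optional_unitary x b z : x * x = 1 -> star x = x -> z * star z = 1 ->
  (optional x b * z) * star (optional x b * z) = 1.
Proof.
move=> xx sx zz; rewrite starM -mulrA (mulrA z) zz mul1r.
by case: b; rewrite /optional ?sx // star1 mulr1.
Qed.

Lemma word_unitary w K : clifford_family w -> word w K * star (word w K) = 1.
Proof.
move=> [w2 _ ws].
rewrite /word; do 3 (apply: optional_unitary; [exact: w2|exact: ws|]).
by case: (K.2); rewrite /optional ?ws ?w2 // star1 mulr1.
Qed.

(** The sum over all words of two families, on opposite sides, intertwines them: multiplication by one
    element of the family permutes the words up to sign. *)
Definition intertwiner w' w : cliff := \sum_K word w' K * star (word w K).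

Lemma intertwinerP w' w k : clifford_family w' -> clifford_family w -> (k < 4)%N ->
  w' k * intertwiner w' w = intertwiner w' w * w k.
Proof.
move=> cw' cw k4; rewrite /intertwiner mulr_sumr mulr_suml.
rewrite [RHS](reindex (fun K => letter k + K)) /=; last first.
  by exists (fun K => letter k + K) => K _; rewrite bits_addKK.
apply: eq_bigr => K _; rewrite mulrA letter_word // -scalerAl -mulrA; have [_ _ ws] := cw.
have -> : star (word w (letter k + K)) * w k = star (w k * word w (letter k + K)).
  by rewrite starM ws.
rewrite letter_word // bits_addKK swapDr swap_letter addFb.
by rewrite starZ -scalerAr.
Qed.

Lemma intertwiner_refl w : clifford_family w -> intertwiner w w = 16%:R.
Proof.
move=> cw; rewrite /intertwiner (eq_bigr (fun=> 1)) => [|K _]; last exact: word_unitary.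
by rewrite sumr_const card_prod !card_prod !card_bool.
Qed.

Lemma cts_word (Y : topologicalType) (w : Y -> nat -> cliff) K L :
  (forall k I, continuous (fun y => w y k I)) -> continuous (fun y => word (w y) K L).
Proof.
move=> cw; have co k b I : continuous (fun y => optional (w y k) b I).
  by case: b; [exact: cw|exact: cts_cst].
by move: L; do 3 (apply: cts_cliffM => //).
Qed.

Lemma cts_intertwiner (Y : topologicalType) (w' w : Y -> nat -> cliff) L :
  (forall k I, continuous (fun y => w' y k I)) -> (forall k I, continuous (fun y => w y k I)) ->
  continuous (fun y => intertwiner (w' y) (w y) L).
Proof.
move=> cw' cw; rewrite (_ : (fun y => _) =
    (fun y => \sum_K (word (w' y) K * star (word (w y) K)) L)); last first.
  by apply/funext => y; rewrite /intertwiner cliff_sum.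
apply: cts_sum => K; move: L; apply: cts_cliffM => L; first exact: cts_word.
by apply: cts_star => I; exact: cts_word.
Qed.

End Words.

Section Frames.
Context {R : realType} {m' o : nat}.
Hypothesis mo : (m' + o = 3)%N.
Local Notation cliff := (cliff R).
Local Notation m := m'.+1.
Local Notation M := ('M[R]_(m, m.+1)).

Lemma col_lt (j : 'I_m.+1) : (j + o < 5)%N.
Proof. by have := ltn_ord j; rewrite -(ltn_add2r o) !addSn mo. Qed.

Lemma row_lt (i : 'I_m) : (i + o < 4)%N.
Proof. by have := ltn_ord i; rewrite -(ltn_add2r o) !addSn mo. Qed.

Lemma offset_lt k : (k < o)%N -> (k < 4)%N.
Proof. by move=> ko; apply: leq_trans ko (leqW _); rewrite -mo leq_addl. Qed.

(** Euclidean space of dimension [m + 1] is placed on the last letters; the first [o]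
    letters are left over, and [m + o = 4]. *)
Definition emb (v : 'I_m.+1 -> R) : cliff := \sum_j v j *: blade (letter (j + o)).

Lemma embE v K : emb v K = \sum_j v j * (K == letter (j + o))%:R.
Proof. by rewrite /emb cliff_sum. Qed.

Lemma emb_letter v (j : 'I_m.+1) : emb v (letter (j + o)) = v j.
Proof.
rewrite embE (bigD1 j) //= eqxx mulr1 big1 ?addr0 // => i ij.
by rewrite letter_inj ?col_lt // eqn_add2r eq_sym val_eqE (negbTE ij) mulr0.
Qed.

Lemma emb_letter0 v k : (k < o)%N -> emb v (letter k) = 0.
Proof.
move=> ko; rewrite embE big1 // => j _; rewrite letter_inj ?col_lt ?(leqW (offset_lt ko)) //.
by rewrite ltn_eqF ?mulr0 // (leq_trans ko) // leq_addl.
Qed.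

Lemma dot_emb u (x : cliff) : dot (emb u) x = \sum_j u j * x (letter (j + o)).
Proof.
rewrite /emb; elim/big_rec2: _ => [|j s y _ IH].
  by rewrite /dot big1 // => K _; rewrite cliff0 mul0r.
by rewrite dotDcl dotZcl dot_blade IH.
Qed.

Lemma dot_emb2 u v : dot (emb u) (emb v) = dot u v.
Proof. by rewrite dot_emb; apply: eq_bigr => j _; rewrite emb_letter. Qed.

Lemma cvector_emb v : cvector (emb v).
Proof.
rewrite /emb; elim/big_rec: _ => [|j x _ cx]; first exact: cvector0.
by apply: cvectorD => //; apply: cvectorZ; exact: cvector_letter.
Qed.

Lemma emb_coords (x : cliff) : cvector x -> (forall k, (k < o)%N -> x (letter k) = 0) ->
  emb (fun j => x (letter (j + o))) = x.
Proof.
move=> vx x0; apply/funext => K; rewrite embE.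
transitivity (\sum_(j < m.+1) x K * (K == letter (j + o))%:R).
  by apply: eq_bigr => j _; case: eqP => [->|]; rewrite ?mulr0.
have [->|xK] := eqVneq (x K) 0; first by rewrite big1 // => j _; rewrite mul0r.
have [a a5 Ka] : exists2 a, (a < 5)%N & K = letter a.
  by have [K1 K2] := cvectorP vx xK; exact: isotropic_letter.
have oa : (o <= a)%N by rewrite leqNgt; apply: contra xK => ao; rewrite Ka x0.
have am : (a - o < m.+1)%N by rewrite ltn_subLR // addnC !addSn mo.
rewrite (bigD1 (Ordinal am)) //= subnK // -Ka eqxx mulr1 big1 ?addr0 // => j ja.
rewrite Ka letter_inj ?col_lt // (_ : a == _ = false) ?mulr0 //.
by apply: contraNF ja => /eqP aE; apply/eqP/val_inj; rewrite /= aE addnK.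
Qed.

(** A frame of Euclidean space, completed by the first [o] letters to a frame of four
    vectors in five-space. *)
Definition padded (A : M) (k : nat) : cliff :=
  if (k < o)%N then blade (letter k) else emb (A (inord (k - o))).

Lemma padded_row A (i : 'I_m) : padded A (i + o) = emb (A i).
Proof. by rewrite /padded ltnNge leq_addl addnK inord_val. Qed.

Lemma padded_cvector A k : cvector (padded A k).
Proof. by rewrite /padded; case: ifP => _; [exact: cvector_letter|exact: cvector_emb]. Qed.

Lemma dot_padded A k l : ortho_mx A -> (k < 4)%N -> (l < 4)%N ->
  dot (padded A k) (padded A l) = (k == l)%:R.
Proof.
move=> oA k4 l4; rewrite /padded; case: ltnP => ko; case: ltnP => lo.
- by rewrite dot_blade /blade letter_inj // leqW.
- by rewrite dot_blade emb_letter0 // ltn_eqF // (leq_trans ko).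
- by rewrite dotC dot_blade emb_letter0 // gtn_eqF // (leq_trans lo).
- rewrite dot_emb2 oA -val_eqE /= !inordK ?ltn_subLR // ?addnS ?(addnC o) ?mo //.
  by rewrite -(eqn_add2r o) !subnK.
Qed.

Lemma padded_family A : ortho_mx A -> clifford_family (padded A).
Proof.
move=> oA; split=> [k k4|k l k4 l4 kl|k k4].
- have := clifford_relation (padded_cvector A k) (padded_cvector A k).
  rewrite dot_padded // eqxx mulr1 -mulr2n -scaler_nat => h.
  by apply: (scalerI (a := 2%:R : R)) => //; rewrite pnatr_eq0.
- have := clifford_relation (padded_cvector A k) (padded_cvector A l).
  by rewrite dot_padded // (negbTE kl) mulr0 scale0r => /eqP; rewrite addr_eq0 => /eqP.
- by have [] := padded_cvector A k.
Qed.

(** The spin group of Euclidean space of dimension [m + 1]: in five-space it is the whole unitary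
    group, and in smaller dimensions the subgroup that fixes the first [o] letters. *)
Definition spin (U : cliff) : Prop := star U * U = 1 /\
  forall k, (k < o)%N -> blade (letter k) * U = U * blade (letter k).

(** The image of the standard frame under the rotation that [U] induces. *)
Definition spin_mx (U : cliff) : M :=
  \matrix_(i, j) (U * blade (letter (i + o)) * star U) (letter (j + o)).

Lemma spin_rows U i : spin U -> emb (spin_mx U i) = U * blade (letter (i + o)) * star U.
Proof.
move=> [UU Uk]; rewrite -[RHS]emb_coords.
- by congr emb; apply/funext => j; rewrite mxE.
- by apply: cvector_conj => //; exact: cvector_letter.
- move=> k ko; rewrite -dot_blade.
  have -> : blade (letter k) = U * blade (letter k) * star U :> cliff.
    by rewrite -Uk // -mulrA unitary_sym // mulr1.
  rewrite dot_conj // dot_blade /blade letter_inj //.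
  + by rewrite ltn_eqF // (leq_trans ko) // leq_addl.
  + exact: leqW (offset_lt ko).
  + exact: leqW (row_lt i).
Qed.

Lemma spin_mx_ortho U : spin U -> ortho_mx (spin_mx U).
Proof.
move=> sU i i'; rewrite -dot_emb2 !spin_rows //; have [UU _] := sU.
rewrite dot_conj // dot_blade /blade letter_inj ?(leqW (row_lt _)) //.
by rewrite eqn_add2r val_eqE.
Qed.

Lemma row_cases k : (k < 4)%N -> (k < o)%N \/ exists i : 'I_m, k = (i + o)%N.
Proof.
move=> k4; case: (ltnP k o) => ko; [by left|right].
have km : (k - o < m)%N by rewrite ltn_subLR // addnC !addSn mo.
by exists (Ordinal km); rewrite /= subnK.
Qed.

Lemma spin_mx_intertwines U k : spin U -> (k < 4)%N ->
  padded (spin_mx U) k * U = U * blade (letter k).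
Proof.
move=> sU /row_cases[ko|[i ->]]; have [UU Uk] := sU; first by rewrite /padded ko Uk.
by rewrite padded_row spin_rows // -mulrA UU mulr1.
Qed.

Lemma intertwines_spin_mx A U : star U * U = 1 ->
  (forall k, (k < 4)%N -> padded A k * U = U * blade (letter k)) ->
  spin U /\ spin_mx U = A.
Proof.
move=> UU h; have sU : spin U.
  by split=> // k ko; have := h k (offset_lt ko); rewrite /padded ko.
split=> //; apply/matrixP => i j; have := h _ (row_lt i); rewrite padded_row => hi.
have : emb (spin_mx U i) = emb (A i).
  by rewrite spin_rows // -hi -mulrA unitary_sym // mulr1.
by move=> /(congr1 (fun x : cliff => x (letter (j + o)))); rewrite !emb_letter.
Qed.

Lemma std_mx_padded k : (k < 4)%N -> padded std_mx k = blade (letter k).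
Proof.
move=> /row_cases[ko|[i ->]]; first by rewrite /padded ko.
rewrite padded_row; have nm : (m <= m.+1)%N by exact: leqnSn.
rewrite /emb (bigD1 (widen_ord nm i)) //= mxE eqxx scale1r big1 ?addr0 // => j ji.
rewrite mxE (_ : (i : nat) == j = false) ?scale0r //.
by apply: contraNF ji => /eqP ij; apply/eqP/val_inj.
Qed.

Lemma spin1 : spin 1.
Proof. by split=> [|k _]; rewrite ?star1 ?mulr1 ?mul1r. Qed.

Lemma spin_mx1 : spin_mx 1 = std_mx.
Proof.
have [] // := @intertwines_spin_mx std_mx 1; first by rewrite star1 mulr1.
by move=> k k4; rewrite std_mx_padded // mulr1 mul1r.
Qed.

Lemma cts_emb (Y : topologicalType) (v : Y -> 'I_m.+1 -> R) K :
  (forall j, continuous (fun y => v y j)) -> continuous (fun y => emb (v y) K).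
Proof.
move=> cv; rewrite (_ : (fun y => _) = (fun y => \sum_j v y j * (K == letter (j + o))%:R)).
  by apply: cts_sum => j; apply: cts_mul => //; exact: cts_cst.
by apply/funext => y; rewrite embE.
Qed.

Lemma cts_padded (Y : topologicalType) (A : Y -> M) k K :
  continuous A -> continuous (fun y => padded (A y) k K).
Proof.
move=> cA; rewrite /padded; case: (k < o)%N; first exact: cts_cst.
by apply: cts_emb => j; exact: cts_entry.
Qed.

Lemma cts_spin_mx (Y : topologicalType) (U : Y -> cliff) :
  (forall K, continuous (fun y => U y K)) -> continuous (fun y => spin_mx (U y)).
Proof.
move=> cU; apply: cts_mx => i j.
rewrite (_ : (fun y => _) =
    (fun y => (U y * blade (letter (i + o)) * star (U y)) (letter (j + o)))); last first.
  by apply/funext => y; rewrite mxE.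
move: (letter (j + o)); apply: cts_cliffM; last exact: cts_star.
by apply: cts_cliffM => // K; exact: cts_cst.
Qed.

Definition spin_transport (A : M) (U : cliff) (A' : M) : cliff :=
  let S := intertwiner (padded A') (padded A) * U in (Num.sqrt (dot S S))^-1 *: S.

(** The transported element, before normalisation, intertwines the letters with a frame,
    so [star S * S] commutes with the letters: it is scalar, and [S] is a multiple of a
    unitary element. *)
Lemma spin_transportP A U A' : ortho_mx A -> ortho_mx A' -> star U * U = 1 ->
  (forall k, (k < 4)%N -> padded A k * U = U * blade (letter k)) ->
  intertwiner (padded A') (padded A) != 0 ->
  let S := intertwiner (padded A') (padded A) * U in
  [/\ dot S S != 0, star (spin_transport A U A') * spin_transport A U A' = 1
    & forall k, (k < 4)%N ->
        padded A' k * spin_transport A U A' = spin_transport A U A' * blade (letter k)].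
Proof.
move=> oA oA' UU h Mn0 S.
have hS k : (k < 4)%N -> padded A' k * S = S * blade (letter k).
  move=> k4; rewrite /S mulrA intertwinerP //; try exact: padded_family.
  by rewrite -mulrA h // mulrA.
have SS : star S * S = dot S S *: 1.
  rewrite dot_star; apply: central_scalar => k k4; rewrite -mulrA -hS // !mulrA; congr (_ * _).
  by rewrite -star_letter -starM -hS // starM; have [-> _] := padded_cvector A' k.
have S0 : dot S S != 0.
  apply/eqP => /dot_eq0 SE; case/eqP: Mn0.
  have : S * star U = 0 by rewrite (_ : S = 0) ?mul0r.
  by rewrite /S -mulrA unitary_sym // mulr1.
split=> // [|k k4]; last by rewrite /spin_transport -scalerAr -/S hS // scalerAl.
rewrite /spin_transport -/S starZ -scalerAl -scalerAr scalerA SS scalerA.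
by rewrite -invfM -expr2 sqr_sqrtr ?dot_ge0 // mulVf // scale1r.
Qed.

Lemma spin_transport_refl A U : ortho_mx A -> star U * U = 1 -> spin_transport A U A = U.
Proof.
move=> oA UU; rewrite /spin_transport intertwiner_refl; last exact: padded_family.
have -> : 16%:R * U = 16%:R *: U by rewrite -[in RHS](mul1r U) scalerAl scaler_nat.
rewrite dotZcl dotZcr unitary_norm // mulr1 -expr2 sqrtr_sqr ger0_norm ?ler0n //.
by rewrite scalerA mulVf ?scale1r // pnatr_eq0.
Qed.

End Frames.

(** * The spin covering of the space of configurations *)

Section SpinCovering.
Context {R : realType} {m' o : nat}.
Hypothesis mo : (m' + o = 3)%N.
Local Notation cliff := (cliff R).
Local Notation m := m'.+1.
Local Notation M := ('M[R]_(m, m.+1)).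
Local Notation W := (config_sphere R m m m).
Local Notation pad := (@padded R m' o).
Local Notation sgn b := ((-1 : R) ^+ nat_of_bool b).

Lemma at_pair (Y X Z : topologicalType) (f : Y -> X) (g : Y -> Z) (w : Y) :
  {for w, continuous f} -> {for w, continuous g} ->
  {for w, continuous (fun y => (f y, g y))}.
Proof. by move=> cf cg; exact: (cvg_pair cf cg). Qed.

Lemma at_cliff (Y : topologicalType) (f : Y -> cliff) (w : Y) :
  (forall K, {for w, continuous (fun y => f y K)}) -> {for w, continuous f}.
Proof.
move=> cf; apply/(@cvg_sup (prod_topology (fun _ : bits => R)) bits
  (fun i => Topological.class (initial_topology (fun g : bits -> R => g i)))
  (f @ w) (f w)) => K A [_ [[B oB <-] BK /filterS]]; apply.
by apply: (cf K); exact: open_nbhs_nbhs.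
Qed.

Lemma cliff_neq0_dot (x : cliff) : (x != 0) = (dot x x != 0).
Proof.
apply/idP/idP; apply: contra => /eqP x0; apply/eqP; last by rewrite x0 /dot big1 // => i _; rewrite cliff0 mulr0.
exact: dot_eq0.
Qed.

(** The matrix of the orthonormalised configuration. *)
Definition gs_mx (x : W) : M := frame_mx (config_frame (gram_schmidt_orthonormal x)).

Lemma gs_mx_ortho x : ortho_mx (gs_mx x).
Proof. exact: frame_mx_ortho. Qed.

Lemma gs_mxE x i j : gs_mx x i j = config_vec (gram_schmidt x) i 0 j.
Proof. by rewrite mxE. Qed.

Lemma cts_gs_mx : continuous gs_mx.
Proof.
apply: cts_mx => i j; rewrite (_ : (fun x => _) = (fun x => config_vec (gram_schmidt x) i 0 j)).
  exact: cts_entry (cts_comp cts_gram_schmidt (@cts_config_vec _ _ _ _ i)).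
by apply/funext => x; rewrite gs_mxE.
Qed.

Lemma gs_mx_frame (x : stiefel) : gs_mx (frame_config x) = frame_mx x.
Proof.
apply/matrixP => i j; rewrite gs_mxE gram_schmidt_id; last exact: frame_config_orthonormal.
by rewrite frame_configE mxE.
Qed.

Lemma gs_mx_flip e x i : gs_mx (flip e x) i = fun j => sgn (e i) * gs_mx x i j.
Proof. by apply/funext => j; rewrite !gs_mxE gram_schmidt_flip flipE mxE. Qed.

(** The second component is one of the two lifts of the orthonormalised configuration to
    the spin group. *)
Definition spin_rel (z : W * cliff) : Prop := star z.2 * z.2 = 1 /\
  forall k, (k < 4)%N -> pad (gs_mx z.1) k * z.2 = z.2 * blade (letter k).

Definition spin_cover : topologicalType := [set z : W * cliff | spin_rel z].

Definition spin_base (z : spin_cover) : W := (val z).1.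
Definition spin_elt (z : spin_cover) : cliff := (val z).2.

Lemma spin_coverP z : spin_rel (spin_base z, spin_elt z).
Proof. by rewrite -surjective_pairing; exact: (set_mem (valP z)). Qed.

Definition mk_spin (z : W * cliff) (hz : spin_rel z) : spin_cover :=
  exist (fun z => z \in [set z : W * cliff | spin_rel z]) z (mem_set hz).

Lemma cts_spin_val : continuous (fun z : spin_cover => val z).
Proof. exact: initial_continuous. Qed.

Lemma cts_spin_base : continuous spin_base.
Proof. exact: (cts_comp cts_spin_val (@cts_fst _ _)). Qed.

Lemma cts_spin_elt K : continuous (fun z => spin_elt z K).
Proof. exact: (cts_comp (cts_comp cts_spin_val (@cts_snd _ _)) (@cts_cliff_coord _ K)). Qed.

Lemma cts_to_spin (Y : topologicalType) (f : Y -> spin_cover) :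
  continuous (fun y => spin_base (f y)) ->
  (forall K, continuous (fun y => spin_elt (f y) K)) -> continuous f.
Proof.
move=> cb ce; apply: continuous_comp_initial.
rewrite (_ : _ \o _ = (fun y => (spin_base (f y), spin_elt (f y)))).
  by apply: cts_pair => //; exact: cts_cliff.
by apply/funext => y /=; rewrite -surjective_pairing.
Qed.

Lemma spin_cover_inj (z z' : spin_cover) :
  spin_base z = spin_base z' -> spin_elt z = spin_elt z' -> z = z'.
Proof.
move=> b e; apply: val_inj; rewrite [val z]surjective_pairing [val z']surjective_pairing.
by congr (_, _).
Qed.

(** Two configurations are close when the intertwiner of their frames is nonzero; it is 16
    on the diagonal. Two lifts of a path differ by a scalar of square one, since only
    scalars commute with all letters. *)
Theorem spin_covering : covering (R := R) spin_base.
Proof.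
split; first exact: cts_spin_base.
- move=> p H f cH cf Hf.
  pose U (A A' : W) := intertwiner (pad (gs_mx A')) (pad (gs_mx A)) != 0.
  pose tau (z : W * cliff) (A' : W) : W * cliff :=
    (A', @spin_transport R m' o (gs_mx z.1) z.2 (gs_mx A')).
  have cI L : continuous (fun z : W * W =>
      intertwiner (pad (gs_mx z.2)) (pad (gs_mx z.1)) L).
    apply: cts_intertwiner => k K; apply: cts_padded.
      exact: (cts_comp (@cts_snd _ _) cts_gs_mx).
    exact: (cts_comp (@cts_fst _ _) cts_gs_mx).
  have [||||||||L [cL L0 LH LP Lc]] := @homotopy_lifting_transport R (W * cliff)%type W fst
      spin_rel setT U tau _ _ _ p H (fun t => val (f t)).
  + move=> A _.
    pose D (z : W * W) := dot (intertwiner (pad (gs_mx z.2)) (pad (gs_mx z.1)))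
      (intertwiner (pad (gs_mx z.2)) (pad (gs_mx z.1))).
    have cD : continuous D by exact: cts_dot.
    have D0 : nbhs (D (A, A)) [set x | x != 0].
      apply: open_nbhs_nbhs; split; first exact: open_neq.
      rewrite /= /D intertwiner_refl; last exact: padded_family (gs_mx_ortho A).
      rewrite -scaler_nat dotZcl dotZcr unitary_norm ?star1 ?mulr1 //.
      by rewrite mulf_neq0 // pnatr_eq0.
    have sub : [set z | D z != 0] `<=` [set z | U z.1 z.2].
      by move=> z /=; rewrite /U cliff_neq0_dot.
    exact: (filterS (F := nbhs (A, A)) sub (cD (A, A) _ D0)).
  + move=> [A V] A' [VV AV] _ UA.
    have [S0 TT AT] := spin_transportP mo (gs_mx_ortho A) (gs_mx_ortho A') VV AV UA.
    split=> //; apply: (@at_pair _ _ _ (fun z : (W * cliff) * W => z.2)).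
      by apply: at_cts; exact: cts_snd.
    apply: (@at_cliff _ (fun z : (W * cliff) * W => @spin_transport R m' o (gs_mx z.1.1) z.1.2 (gs_mx z.2))) => K.
    pose S (z : (W * cliff) * W) := intertwiner (pad (gs_mx z.2)) (pad (gs_mx z.1.1)) * z.1.2.
    have cS K' : continuous (fun z => S z K').
      move: K'; apply: cts_cliffM => K'.
        apply: (cts_comp (f := fun z : (W * cliff) * W => (z.1.1, z.2)) _ (cI K')).
        by apply: cts_pair; [exact: (cts_comp (@cts_fst _ _) (@cts_fst _ _))|exact: cts_snd].
      exact: (cts_comp (cts_comp (@cts_fst _ _) (@cts_snd _ _)) (@cts_cliff_coord _ K')).
    apply: (@at_mul R _ (fun z => (Num.sqrt (dot (S z) (S z)))^-1) (fun z => S z K)).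
      apply: at_inv; last exact: sqrt_dot_neq0.
      by apply: at_cts; apply: cts_sqrt; exact: cts_dot.
    exact: at_cts (cS K).
  + move=> [A V] [VV AV]; rewrite /tau /= spin_transport_refl //; exact: gs_mx_ortho.
  + exact: cH.
  + exact: (cts_comp cf cts_spin_val).
  + by [].
  + by move=> t; exact: (set_mem (valP (f t))).
  + exact: Hf.
  exists (fun z => mk_spin (LP z)); split.
  + exact: continuous_comp_initial.
  + by move=> t; apply: val_inj => /=.
  + exact: LH.
  + by move=> t Ht s; apply: val_inj => /=; exact: Lc.
- move=> u v cu cv uv uv0 s; apply: spin_cover_inj; first exact: uv.
  pose g s' := dot (spin_elt (u s')) (spin_elt (v s')).
  have ug s' : spin_elt (v s') = g s' *: spin_elt (u s') /\ g s' ^+ 2 = 1.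
    have [U1 Uk] := spin_coverP (u s'); have [V1 Vk] := spin_coverP (v s').
    rewrite /= in U1 Uk V1 Vk; rewrite -uv in Vk.
    have c : star (spin_elt (u s')) * spin_elt (v s') = g s' *: 1.
      rewrite /g dot_star; apply: central_scalar => k k4.
      rewrite -mulrA -Vk // !mulrA; congr (_ * _).
      rewrite -star_letter -starM -Uk // starM.
      by have [-> _] := @padded_cvector R m' o (gs_mx (spin_base (u s'))) k.
    have vE : spin_elt (v s') = g s' *: spin_elt (u s').
      rewrite -[LHS]mul1r -(unitary_sym U1) -mulrA c -scalerAr mulr1 //.
    split=> //; have := unitary_norm V1; rewrite {1}vE dotZcl -/(g s').
    by rewrite expr2.
  have cg : continuous g.
    by apply: cts_dot => K; [exact: cts_comp cu (@cts_spin_elt K)|exact: cts_comp cv (@cts_spin_elt K)].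
  have [-> _] := ug s.
  rewrite (square_one_constant cg) ?scale1r //; first by move=> s'; have [] := ug s'.
  by rewrite /g -uv0 unitary_norm //; have [] := spin_coverP (u (to_unit 0)).
Qed.

End SpinCovering.

(** * The group of signed blades and the fundamental group *)

(** A blade of square one is the product of two blades of square minus one, and these can
    be chosen to commute with the first two letters. *)
Lemma quaternion_split (K : bits) : swap K K = false -> exists L : bits,
  [/\ swap L L, swap (K + L) (K + L), anticomm (letter 0%N) L = false
    & anticomm (letter 1%N) L = false].
Proof.
pose L1 : bits := (((false, false), true), true).
pose L2 : bits := (((true, true), true), false).
pose L3 : bits := (((true, true), false), true).
case: K => [[[[] []] []] []] // _; by [exists L1; split|exists L2; split|exists L3; split].
Qed.

Section SignedBlades.
Context {R : realType}.
Local Notation cliff := (cliff R).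
Local Notation sgn b := ((-1 : R) ^+ nat_of_bool b).

Lemma anticommDl x y z : anticomm (x + y) z = anticomm x z (+) anticomm y z.
Proof.
rewrite /anticomm swapDl swapDr.
by case: (swap x z) (swap y z) (swap z x) (swap z y) => [] [] [] [].
Qed.

Lemma anticommC x y : anticomm x y = anticomm y x.
Proof. by rewrite /anticomm addbC. Qed.

Lemma anticommDr x y z : anticomm z (x + y) = anticomm z x (+) anticomm z y.
Proof. by rewrite anticommC anticommDl !(anticommC z). Qed.

Definition signed_mul (x y : bool * bits) : bool * bits :=
  (x.1 (+) y.1 (+) swap x.2 y.2, x.2 + y.2).

Definition signed_blade (x : bool * bits) : cliff := sgn x.1 *: blade x.2.

Lemma signed_bladeM x y : signed_blade (signed_mul x y) = signed_blade x * signed_blade y.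
Proof.
rewrite /signed_blade /= -scalerAl -scalerAr bladeM !scalerA -!signr_addb.
by rewrite ?addbA.
Qed.

Lemma signed_blade_unitary x : star (signed_blade x) * signed_blade x = 1.
Proof.
rewrite /signed_blade starZ star_blade -!scalerAl -scalerAr !scalerA bladeM scalerA.
rewrite bits_addK -!signr_addb; case: (x.1); case: (swap _ _);
  by rewrite /= ?expr0 ?scale1r.
Qed.

Lemma signed_blade_inj : injective signed_blade.
Proof.
move=> [s K] [s' K'] /(congr1 (fun f : cliff => f K)).
rewrite /signed_blade !cliffZ /blade /= eqxx mulr1.
case: eqP => [<-|_]; first by rewrite mulr1 => /signr_inj ->.
by rewrite mulr0 => /eqP; rewrite signr_eq0.
Qed.

Lemma star_signed_blade s K : star (signed_blade (s, K)) = signed_blade (s (+) swap K K, K).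
Proof. by rewrite /signed_blade starZ star_blade scalerA -signr_addb. Qed.

Lemma blade_signed K x : blade K * signed_blade x =
  sgn (anticomm K x.2) *: (signed_blade x * blade K).
Proof.
rewrite /signed_blade -scalerAl -scalerAr !bladeM !scalerA -!signr_addb (addrC K).
congr (_ ^+ nat_of_bool _ *: _); rewrite /anticomm.
by case: (x.1) (swap K x.2) (swap x.2 K) => [] [] [].
Qed.

End SignedBlades.

Lemma segment_sq_gt0 (R : realType) (x : R) : 0 < (1 - x) ^+ 2 + x ^+ 2.
Proof. by nra. Qed.

Section SpinGroup.
Context {R : realType} {m' o : nat}.
Hypothesis mo : (m' + o = 3)%N.
Local Notation cube := (@Defs.cube R).
Local Notation cliff := (cliff R).
Local Notation m := m'.+1.
Local Notation W := (config_sphere R m m m).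
Local Notation pad := (@padded R m' o).
Local Notation E := (@spin_cover R m' o).
Local Notation spin := (@spin R o).
Local Notation spin_rel := (@spin_rel R m' o).
Local Notation sgn b := ((-1 : R) ^+ nat_of_bool b).
Hypothesis nm : (m <= m.+1)%N.

Lemma spin_config_rel (U : cliff) (sU : spin U) :
  spin_rel (frame_config (mk_frame (spin_mx_ortho mo sU)), U).
Proof.
split; first by case: sU.
by move=> k k4; rewrite gs_mx_frame /=; exact: spin_mx_intertwines.
Qed.

Definition spin_config (U : cliff) (sU : spin U) : E := mk_spin (spin_config_rel sU).

Lemma spin_config_base U (sU : spin U) :
  spin_base (spin_config sU) = frame_config (mk_frame (spin_mx_ortho mo sU)).
Proof. by []. Qed.

Lemma cts_spin_config (Y : topologicalType) (U : Y -> cliff) (sU : forall y, spin (U y)) :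
  (forall K, continuous (fun y => U y K)) -> continuous (fun y => spin_config (sU y)).
Proof.
move=> cU; apply: cts_to_spin => //.
apply: (cts_comp (f := fun y => mk_frame (spin_mx_ortho mo (sU y)))); last exact: cts_frame_config.
by apply: cts_to_stiefel; exact: cts_spin_mx.
Qed.

Let x0 : W := frame_config (std_frame nm).
Let e0 : E := spin_config (@spin1 R o).

Lemma spin_base1 : spin_base e0 = x0.
Proof. by rewrite spin_config_base; congr frame_config; apply: val_inj; exact: spin_mx1. Qed.

(* Through [phi], [G] is the group of signed blades that commute with the first [o]
   letters. *)
Variable G : groupType.
Variable phi : G -> bool * bits.
Hypothesis phiM : forall g h, phi (g * h)%g = signed_mul (phi g) (phi h).
Hypothesis phi_inj : injective phi.
Hypothesis phi_off : forall g k, (k < o)%N -> anticomm (letter k) (phi g).2 = false.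
Hypothesis phi_surj : forall x : bool * bits,
  (forall k, (k < o)%N -> anticomm (letter k) x.2 = false) -> exists g, phi g = x.

Let el (g : G) : cliff := signed_blade (phi g).

Lemma phi1 : phi 1%g = (false, 0).
Proof.
have := phiM 1%g 1%g; rewrite mulg1; case: (phi 1%g) => s K [-> ].
move=> /(congr1 (fun x => K + x)); rewrite bits_addKK bits_addK => <-.
by rewrite swap0l addbF addbb.
Qed.

Definition flips (g : G) (i : 'I_m) : bool := anticomm (letter (i + o)) (phi g).2.

(** Multiplication of the unitary element by a blade changes the signs of the letters that
    the blade anticommutes with. *)
Fact act_rel g (z : E) : spin_rel (flip (flips g) (spin_base z), spin_elt z * star (el g)).
Proof.
have [UU Uk] := spin_coverP z; rewrite /= in UU Uk.
have gg : star (el g) * el g = 1 by exact: signed_blade_unitary.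
have gg' := unitary_sym gg.
split; first by rewrite /= starM starK -mulrA (mulrA (star (spin_elt z))) UU mul1r.
move=> k k4 /=.
have [s [padE bE]] : exists s, pad (gs_mx (flip (flips g) (spin_base z))) k =
    sgn s *: pad (gs_mx (spin_base z)) k /\
    blade (letter k) * el g = sgn s *: (el g * blade (letter k)).
  exists (anticomm (letter k) (phi g).2); split; last exact: blade_signed.
  have [ko|[i ->]] := row_cases mo k4.
    by rewrite phi_off // expr0 scale1r /padded ko.
  rewrite !padded_row gs_mx_flip -/(flips g i).
  apply/funext => K; rewrite cliffZ !embE mulr_sumr.
  by apply: eq_bigr => j _; rewrite mulrA.
have bE' : star (el g) * blade (letter k) = sgn s *: (blade (letter k) * star (el g)).
  rewrite -[LHS]mulr1 -gg' -mulrA (mulrA (blade _)) bE -scalerAl -scalerAr.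
  by rewrite !mulrA gg mul1r.
by rewrite padE -scalerAl mulrA Uk // -!mulrA bE' -scalerAr.
Qed.

Definition act (g : G) (z : E) : E := mk_spin (act_rel g z).

Lemma act_base g z : spin_base (act g z) = flip (flips g) (spin_base z). Proof. by []. Qed.
Lemma act_elt g z : spin_elt (act g z) = spin_elt z * star (el g). Proof. by []. Qed.

Lemma cts_act g : continuous (act g).
Proof.
apply: cts_to_spin; first exact: (cts_comp (@cts_spin_base _ _ _) (@cts_flip _ _ _ _)).
apply: cts_cliffM => K; first exact: cts_spin_elt.
exact: cts_cst.
Qed.

Lemma actM g h z : act (g * h)%g z = act g (act h z).
Proof.
apply: spin_cover_inj.
  rewrite !act_base flipM; congr flip; apply/funext => i.
  by rewrite /flips phiM /= anticommDr.
by rewrite !act_elt /el phiM signed_bladeM starM mulrA.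
Qed.

Lemma act_image g z : config_image (spin_base (act g z)) = config_image (spin_base z).
Proof. exact: flip_image. Qed.

Lemma act1 z : act 1%g z = z.
Proof.
apply: spin_cover_inj.
  rewrite act_base -[RHS]flip0; congr flip; apply/funext => i.
  by rewrite /flips phi1 /= /anticomm swap0l swap0r.
rewrite act_elt /el phi1 /signed_blade expr0 scale1r (_ : blade 0 = 1) //.
by rewrite star1 mulr1.
Qed.

Lemma act_free g h : act g e0 = act h e0 -> g = h.
Proof.
move=> /(congr1 (@spin_elt _ _ _)); rewrite !act_elt !mul1r => /(congr1 (@star R)).
by rewrite !starK => /signed_blade_inj/phi_inj.
Qed.

(** If a frame differs from the standard one by signs, its lifts commute up to sign with
    all letters, and this forces their support to be a single blade. *)
Lemma act_trans z : config_image (spin_base z) = config_image (spin_base e0) ->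
  exists g, z = act g e0.
Proof.
rewrite spin_base1 => /flip_fiber[e ze].
have [UU Uk] := spin_coverP z; rewrite /= ze in UU Uk.
set U := spin_elt z in UU Uk.
pose s k := if (k < o)%N then false else e (inord (k - o)).
have supp k K : (k < 4)%N -> anticomm (letter k) K != s k -> U K = 0.
  move=> k4; have : blade (letter k) * U = sgn (s k) *: (U * blade (letter k)).
    rewrite -Uk // scalerAl /s; congr (_ * _); have [ko|[i ->]] := row_cases mo k4.
      by rewrite ko /padded ko expr0 scale1r.
    rewrite ltnNge leq_addl addnK inord_val padded_row gs_mx_flip gs_mx_frame.
    rewrite -(std_mx_padded mo (row_lt mo i)) padded_row; apply/funext => L; rewrite cliffZ !embE mulr_sumr.
    by apply: eq_bigr => j _; rewrite !mulrA -signr_addb addbb mul1r.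
  by move=> /blade_commP; apply.
have U1 := unitary_norm UU.
have [K UK] : exists K, U K != 0.
  apply: contrapT => U0; have /eqP := U1; rewrite /dot big1 => [|K _]; first by rewrite eq_sym oner_eq0.
  have [->|UK] := eqVneq (U K) 0; first by rewrite mul0r.
  by case: U0; exists K.
have aK k : (k < 4)%N -> anticomm (letter k) K = s k.
  by move=> k4; apply/eqP; apply: contraNT UK => /supp ->.
have UE : U = U K *: blade K.
  apply/funext => L; rewrite cliffZ /blade; case: eqP => [->|LK]; first by rewrite mulr1.
  rewrite mulr0; apply: contrapT => /eqP UL; apply: LK.
  have : K + L = 0.
    apply: anticomm_nondegenerate => k k4; rewrite anticommDr aK //.
    have -> : anticomm (letter k) L = s k by apply/eqP; apply: contraNT UL => /supp ->.
    by rewrite addbb.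
  by move=> /(congr1 (fun x => K + x)); rewrite bits_addKK addr0.
have [b Ub] : exists b : bool, U = signed_blade (b, K).
  have : U K ^+ 2 == 1.
    by rewrite -U1 {2 3}UE dotZcl dotZcr dot_blade /blade eqxx mulr1 expr2.
  rewrite sqrf_eq1 => /orP[] /eqP uK; rewrite UE uK.
    by exists false; rewrite /signed_blade expr0.
  by exists true; rewrite /signed_blade expr1.
have [|g gE] := phi_surj (x := (b (+) swap K K, K)).
  by move=> k ko; rewrite /= aK ?(offset_lt mo ko) // /s ko.
exists g; apply: spin_cover_inj.
  rewrite act_base spin_base1 ze; congr flip; apply/funext => i.
  rewrite /flips gE /= aK ?row_lt // /s ltnNge leq_addl addnK inord_val //.
by rewrite act_elt mul1r /el gE star_signed_blade -addbA addbb addbF.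
Qed.

(** An element [h] of square minus one is joined to the identity by the normalised segment
    [(1 - x) + x * h], which has [(1 - x) ^ 2 + x ^ 2] for squared norm. *)
Lemma reaches_root g : swap (phi g).2 (phi g).2 -> reaches (R := R) e0 act g.
Proof.
move=> q1; pose h := star (el g).
have hh : star h * h = 1 by rewrite /h starK unitary_sym //; exact: signed_blade_unitary.
have sh : star h = - h.
  rewrite /h starK /el; case: (phi g) q1 => s K /= q1.
  by rewrite star_signed_blade q1 /signed_blade addbT /= signrN scaleNr opprK.
have h2 : h * h = -1 by rewrite -[LHS]opprK -mulNr -sh hh.
pose S (x : R) : cliff := (1 - x) *: 1 + x *: h.
have SS x : star (S x) * S x = ((1 - x) ^+ 2 + x ^+ 2) *: 1.
  rewrite /S starD !starZ star1 sh mulrDl !mulrDr -!scalerAl -!scalerAr !mul1r mulr1.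
  rewrite !mulNr h2 opprK !scalerN !scalerA scalerDl -!expr2 addrA.
  by rewrite [x * (1 - x)]mulrC addrK.
have pos (x : R) := segment_sq_gt0 x.
pose r (x : R) : R := Num.sqrt ((1 - x) ^+ 2 + x ^+ 2).
have r0 (x : R) : r x != 0 by rewrite /r gt_eqF // sqrtr_gt0 pos.
pose U x : cliff := (r x)^-1 *: S x.
have sU x : spin (U x).
  split.
    rewrite /U starZ -scalerAl -scalerAr SS !scalerA -invfM -expr2 sqr_sqrtr ?ltW //.
    by rewrite mulVf ?scale1r // gt_eqF.
  move=> k ko; have hk : blade (letter k) * h = h * blade (letter k).
    rewrite /h /el; case E : (phi g) => [s K]; rewrite star_signed_blade blade_signed /=.
    by have := phi_off g ko; rewrite E /= => ->; rewrite expr0 scale1r.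
  by rewrite /U /S -scalerAl -scalerAr mulrDl mulrDr -!scalerAl -!scalerAr hk mulr1 mul1r.
have U0 : U 0 = 1.
  by rewrite /U /r /S subr0 expr1n expr0n /= addr0 sqrtr1 invr1 !scale1r scale0r addr0.
have U1 : U 1 = h.
  by rewrite /U /r /S subrr expr1n expr0n /= add0r sqrtr1 invr1 !scale1r scale0r add0r.
exists (fun t : cube 1 => spin_config (sU (unit_val (t ord0)))).
split.
- apply: cts_spin_config => K; have ct := @cts_first R 0.
  have c1 : continuous (fun t : cube 1 => 1 - unit_val (t ord0)).
    by apply: (cts_add (@cts_cst _ R 1)); exact: cts_opp.
  apply: cts_mul.
    apply: cts_inv => [|t]; last exact: r0.
    apply: cts_sqrt; rewrite (_ : (fun t => _) = (fun t : cube 1 =>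
      (1 - unit_val (t ord0)) * (1 - unit_val (t ord0)) + unit_val (t ord0) * unit_val (t ord0))).
      by apply: cts_add; apply: cts_mul.
    by apply/funext => t; rewrite !expr2.
  by apply: cts_add; apply: cts_mul => //; exact: cts_cst.
- have E1 : U (unit_val (corner 1 ord0)) = 1 by rewrite /corner to_unit0 U0.
  apply: spin_cover_inj => //; rewrite !spin_config_base; congr frame_config.
  by apply: val_inj => /=; rewrite E1.
- have E1 : U (unit_val (top ord0)) = h by rewrite /top to_unit1 U1.
  apply: spin_cover_inj; last by rewrite act_elt mul1r.
  rewrite act_base spin_base1 spin_config_base; apply: config_vec_inj => i.
  rewrite flipE !frame_configE; apply/rowP => j; rewrite [LHS]mxE [RHS]mxE [X in _ = _ * X]mxE /frame_mx /= E1.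
  have hs : h * blade (letter (i + o)) * star h = sgn (flips g i) *: blade (letter (i + o)).
    rewrite /h starK -mulrA /el blade_signed -/(flips g i) -scalerAr mulrA.
    by rewrite signed_blade_unitary mul1r.
  rewrite mxE hs cliffZ; congr (_ * _).
  by rewrite -(std_mx_padded mo (row_lt mo i)) padded_row (emb_letter mo).
Qed.

Hypothesis o2 : (o <= 2)%N.

Lemma reaches_signed g : reaches (R := R) e0 act g.
Proof.
have [q1|q0] := boolP (swap (phi g).2 (phi g).2); first exact: reaches_root.
have [L [qL qKL L0 L1]] := quaternion_split (negbTE q0).
have [|h hE] := phi_surj (x := (false, L)).
  by move=> k ko; have := leq_trans ko o2; case: k {ko} => [|[|]].
have hV : (phi h^-1%g).2 = L.
  have := phiM h h^-1%g; rewrite mulgV phi1 hE => /(congr1 snd) /= /(congr1 (fun x => L + x)).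
  by rewrite bits_addKK addr0.
have -> : g = (g * h^-1 * h)%g by rewrite -mulgA mulVg mulg1.
apply: (reachesM cts_act actM); apply: reaches_root; last by rewrite hE.
by rewrite phiM /= hV.
Qed.

Hypothesis m'1 : (0 < m')%N.

Let proj (z : E) := config_image (spin_base z).

Let proj_covering : covering (R := R) proj.
Proof. exact: covering_comp (spin_covering mo) (config_covering m m). Qed.

(** The lift commutes with the first two letters, so it is a combination of the four even
    blades in the last three letters: a quaternion. The elements of norm one of that
    four-dimensional space are a three-sphere of unitary elements, in which the loop is
    null. *)
Lemma spin_loop_null (U : cube 1 -> cliff) (f : cube 1 -> stiefel) :
  (forall K, continuous (fun t => U t K)) -> U (corner 1) = 1 -> U top = 1 ->
  (forall t, star (U t) * U t = 1) ->
  (forall t k, (k < 4)%N -> pad (frame_mx (f t)) k * U t = U t * blade (letter k)) ->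
  (forall t k, (k < 2)%N -> pad (frame_mx (f t)) k = blade (letter k)) ->
  homotopic x0 (frame_config \o f) (fun=> x0).
Proof.
move=> cU U0 U1 UU Uk fk.
pose D (K : bits) := ~~ anticomm (letter 0%N) K && ~~ anticomm (letter 1%N) K.
have comm_supp (x : cliff) : (forall K, ~~ D K -> x K = 0) <->
    (forall k, (k < 2)%N -> blade (letter k) * x = x * blade (letter k)).
  split=> [xD [|[|//]] _|h K].
  - by apply/blade_comm_supp => K aK; apply: xD; rewrite /D aK.
  - by apply/blade_comm_supp => K aK; apply: xD; rewrite /D aK andbF.
  - have /blade_comm_supp h0 := h 0%N isT; have /blade_comm_supp h1 := h 1%N isT.
    by rewrite /D negb_and !negbK => /orP[/h0|/h1].
have UD t : forall K, ~~ D K -> U t K = 0.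
  by apply/comm_supp => k k2; rewrite -Uk ?fk // (leq_trans k2).
have unit_D (x : cliff) : dot x x = 1 -> (forall K, ~~ D K -> x K = 0) -> star x * x = 1.
  move=> x1 /comm_supp xD; have sxD : forall k, (k < 2)%N ->
      blade (letter k) * (star x * x) = star x * x * blade (letter k).
    move=> k k2; rewrite -mulrA -xD // !mulrA; congr (_ * _).
    by rewrite -star_letter -!starM xD.
  have /comm_supp supp := sxD.
  apply/funext => K; rewrite cliff1; have [->|K0] := eqVneq K 0; first by rewrite -dot_star.
  have [/supp //|DK] := boolP (~~ D K).
  have qK : swap K K.
    by clear -DK K0; move: DK K0; rewrite /D; case: K => [[[[] []] []] []].
  have := congr1 (fun x : cliff => x K) (starM (star x) x); rewrite starK /star qK expr1.
  by move=> h; apply: eqN_eq0; rewrite -[LHS]h mulN1r.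
pose g t : supp_sphere D := mk_supp (unitary_norm (UU t)) (UD t).
have cg : continuous g by apply: cts_to_supp => K; exact: cU.
pose e := g (corner 1).
have gtop : g top = e by apply: val_inj; rewrite /= U1 U0.
pose L3 (k : 'I_3) : bits := match nat_of_ord k with
  | 0 => 0 | 1 => (((false, false), true), true) | _ => (((true, true), true), false) end.
have [||K [cK K0 K1 Kb]] := @supp_sphere_loop_null R _ D e g cg (erefl _) gtop L3.
- by move=> [[|[|[|k]]] p] [[|[|[|l]]] p'] // _; apply: val_inj.
- by move=> [[|[|[|k]]] p].
have sK z : spin (supp_vec (K z)).
  have KD := @supp_vec_supp _ _ _ (K z).
  split; first exact: unit_D (supp_vec_norm _) KD.
  by move/comm_supp: KD => KD k ko; apply: KD; exact: leq_trans ko o2.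
have eE : supp_vec e = 1 :> cliff := U0.
have frame1 z : supp_vec (K z) = 1 :> cliff -> frame_config (mk_frame (spin_mx_ortho mo (sK z))) = x0.
  by move=> K1'; congr frame_config; apply: val_inj => /=; rewrite K1'; exact: spin_mx1.
exists (fun z => frame_config (mk_frame (spin_mx_ortho mo (sK z)))); split.
- apply: (cts_comp (f := fun z => mk_frame (spin_mx_ortho mo (sK z)))); last exact: cts_frame_config.
  apply: cts_to_stiefel; apply: cts_spin_mx => L.
  exact: (cts_comp cK (@cts_supp_vec _ _ _ L)).
- move=> t; congr frame_config; apply: val_inj => /=.
  have [_ UE] := intertwines_spin_mx mo (UU t) (Uk t).
  by rewrite K0; exact: UE.
- by move=> t; apply: frame1; rewrite K1 eE.
- by move=> s t bt; apply: frame1; rewrite Kb // eE.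
Qed.

(** The first [m - 2] vectors of the loop of configurations are made constant, and the
    resulting homotopy in projective configurations is lifted again, to a closed loop. *)
Lemma spin_loops_null (F : cube 1 -> E) : continuous F ->
  F (corner 1) = e0 -> F top = e0 ->
  homotopic (proj e0) (proj \o F) (fun=> proj e0).
Proof.
move=> cF F0 F1.
have pe : proj e0 = config_image x0 by rewrite /proj spin_base1.
pose A t := spin_base (F t).
have cA : continuous A := cts_comp cF (@cts_spin_base _ _ _).
have Ab t : cube_boundary t -> A t = x0.
  by move=> /cube1_boundary[] ->; rewrite /A ?F0 ?F1 spin_base1.
have [||f [cf fb Af fj]] := @config_reduce R m m nm m'.-1 A _ _ cA Ab.
- by rewrite (leq_trans (leq_pred _)).
- by rewrite -(ltn_predK m'1) /= !ltnS.
have cimage := covering_continuous (config_covering (R := R) (m := m) m m).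
have Af' := homotopic_map cimage Af.
rewrite pe; apply: (homotopic_trans Af').
have cframe : continuous (frame_config \o f) := cts_comp cf (@cts_frame_config _ _ _).
have [|F' [cF' F'f F'0]] := @lift_cube _ _ _ _ proj_covering 1
    (@config_image R m m m \o (frame_config \o f)) e0 (cts_comp cframe cimage).
  by rewrite /= fb ?pe //; exact: corner_boundary.
have F'1 : F' top = e0.
  have AF' : homotopic (proj e0) (proj \o F) (proj \o F').
    rewrite pe (_ : proj \o F' = @config_image R m m m \o (frame_config \o f)) //.
    by apply/funext => t; rewrite /= F'f.
  have [H [_ H0 H1 Hb]] := lift_homotopic proj_covering (erefl _) cF cF' F0 F'0 AF'.
  by rewrite -H1 Hb //; exact: top_boundary.
have baseE t : spin_base (F' t) = frame_config (f t).
  apply: (unique_cube (config_covering m m) (u := fun t => spin_base (F' t))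
    (v := frame_config \o f) (t0 := corner 1)) => //.
  - exact: (cts_comp cF' (@cts_spin_base _ _ _)).
  - by rewrite F'0 spin_base1 /= fb //; exact: corner_boundary.
apply: (homotopic_map cimage); apply: (@spin_loop_null (fun t => spin_elt (F' t))).
- by move=> K; exact: (cts_comp cF' (@cts_spin_elt _ _ _ K)).
- by rewrite F'0.
- by rewrite F'1.
- by move=> t; have [] := spin_coverP (F' t).
- by move=> t k k4; have [_ /(_ k k4)] := spin_coverP (F' t); rewrite /= baseE gs_mx_frame.
- move=> t k k2; have [ko|[i kE]] := row_cases mo (leq_trans k2 (isT : 2 <= 4)%N).
    by rewrite /padded ko.
  rewrite kE -(std_mx_padded mo (row_lt mo i)) !padded_row; congr emb.
  apply: fj; rewrite -(ltn_add2r o) -kE; apply: leq_trans k2 _.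
  by rewrite -ltnS -addSn (ltn_predK m'1) mo.
Qed.

(** The covering is the spin covering followed by that of projective configurations. *)
Theorem fundamental_group_spin : isomorphic (homotopy_group R 1 (basis_config R m nm)) G.
Proof.
rewrite basis_config_image -/x0 -spin_base1.
apply: (fundamental_group_of_covering proj_covering (e0 := e0) (act := act)).
- exact: cts_act.
- exact: actM.
- exact: act_image.
- exact: act1.
- exact: act_free.
- exact: act_trans.
- exact: reaches_signed.
- exact: spin_loops_null.
Qed.

End SpinGroup.

(** * Identification of the groups of signed blades *)

Definition signed : Type := (bool * bits)%type.
HB.instance Definition _ := Finite.on signed.

Definition signed_inv (x : signed) : signed := (x.1 (+) swap x.2 x.2, x.2).

Fact signed_mulA : associative (signed_mul : signed -> signed -> signed).
Proof.
move=> [s K] [t L] [u N]; rewrite /signed_mul /= addrA; congr (_, _).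
rewrite swapDl swapDr.
by case: s t u (swap K L) (swap K N) (swap L N) => [] [] [] [] [] [].
Qed.

Fact signed_mul1 : left_id ((false, 0) : signed) (signed_mul : signed -> signed -> signed).
Proof. by move=> [s K]; rewrite /signed_mul /= swap0l addbF add0r. Qed.

Fact signed_mulV : left_inverse ((false, 0) : signed) signed_inv
  (signed_mul : signed -> signed -> signed).
Proof.
move=> [s K]; rewrite /signed_mul /= bits_addK; congr (_, _).
by case: s (swap K K) => [] [].
Qed.

HB.instance Definition _ := Finite_isGroup.Build signed signed_mulA signed_mul1 signed_mulV.

Section FiniteGroups.
Local Open Scope group_scope.

Lemma signedM (x y : signed) : x * y = signed_mul x y. Proof. by []. Qed.

Lemma signed1 : 1 = (false, 0%R) :> signed. Proof. by []. Qed.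

Lemma signed_comm (x y : signed) : x * y = y * x <-> anticomm x.2 y.2 = false.
Proof.
case: x y => [s K] [t L]; rewrite !signedM /signed_mul /anticomm /=; split.
  by move=> [+ _]; case: s t (swap K L) (swap L K) => [] [] [] [].
move=> h; congr (_, _); last exact: addrC.
by move: h; case: s t (swap K L) (swap L K) => [] [] [] [].
Qed.

Definition commutant (A B : bits) : {set signed} :=
  [set x | ~~ anticomm A x.2 && ~~ anticomm B x.2].

Lemma commutant_group_set A B : group_set (commutant A B).
Proof.
apply/group_setP; split.
  by rewrite inE signed1 /= /anticomm !swap0l !swap0r.
move=> x y; rewrite !inE !signedM /= !anticommDr.
by move=> /andP[/negbTE-> /negbTE->] /andP[/negbTE-> /negbTE->].
Qed.

Canonical commutant_group A B := Group (commutant_group_set A B).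

(** Up to sign, [quat_i] is the product of the third and fourth letters and [quat_j] that
    of the last two. *)
Definition quat_i : bits := (((false, false), true), true).
Definition quat_j : bits := (((true, true), true), false).

Definition quaternions : {group signed} := commutant_group (letter 0) (letter 1).
Definition coquaternions : {group signed} := commutant_group quat_i quat_j.

Lemma uniq_card_ge (s : seq signed) (A : {set signed}) :
  uniq s -> all (fun x => x \in A) s -> (size s <= #|A|)%N.
Proof.
move=> us /allP sA; rewrite -(card_uniqP us); apply: subset_leq_card.
by apply/fintype.subsetP => x /sA.
Qed.

Lemma joing_generates (x y : signed) (H : {group signed}) :
  x \in H -> y \in H ->
  (forall z, z \in H -> exists i j, z = x ^+ i * y ^+ j) -> <[x]> <*> <[y]> = H.
Proof.
move=> xH yH gen; apply/eqP; rewrite finset.eqEsubset join_subG !cycle_subG xH yH /=.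
apply/fintype.subsetP => z /gen[i [j ->]]; apply: groupM.
  by rewrite (fintype.subsetP (joing_subl _ _)) // mem_cycle.
by rewrite (fintype.subsetP (joing_subr _ _)) // mem_cycle.
Qed.

Definition signed_list (r : seq bits) : seq signed :=
  [seq (false, K) | K <- r] ++ [seq (true, K) | K <- r].

Lemma homg_Q8 (gT : finGroupType) (x y : gT) (H : {group gT}) :
  <[x]> <*> <[y]> = H -> x ^+ 4 = 1 -> y ^+ 2 = x ^+ 2 -> x ^ y = x^-1 -> H \homg 'Q_8.
Proof.
move=> defH x4 y2 xy; rewrite (@Grp_quaternion 3) //; apply/existsP; exists (x, y) => /=.
by rewrite !xpair_eqE defH eqxx x4 y2 xy !eqxx.
Qed.

Lemma homg_D8 (gT : finGroupType) (x y : gT) (H : {group gT}) :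
  <[x]> <*> <[y]> = H -> x ^+ 4 = 1 -> y ^+ 2 = 1 -> x ^ y = x^-1 -> H \homg 'D_8.
Proof.
move=> defH x4 y2 xy; rewrite (@Grp_2dihedral 3) //; apply/existsP; exists (x, y) => /=.
by rewrite !xpair_eqE defH eqxx x4 y2 xy !eqxx.
Qed.

Lemma quaternions_isog : quaternions \isog 'Q_8.
Proof.
have card8 : (8 <= #|quaternions|)%N.
  apply: (@uniq_card_ge (signed_list [:: 0%R; quat_i; quat_j; quat_i + quat_j]%R)) => //.
  by rewrite /= !inE.
rewrite isogEcard (@card_quaternion 3) // card8 andbT.
apply: (@homg_Q8 _ ((false, quat_i) : signed) ((false, quat_j) : signed)) => //.
apply: joing_generates; rewrite ?inE //= => -[s K]; rewrite inE /=.
case: K => [[[[] []] []] []] //= _.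
- by case: s; [exists 2%N, 1%N|exists 0%N, 1%N].
- by case: s; [exists 1%N, 1%N|exists 3%N, 1%N].
- by case: s; [exists 3%N, 0%N|exists 1%N, 0%N].
- by case: s; [exists 2%N, 0%N|exists 0%N, 0%N].
Qed.

Lemma coquaternions_isog : coquaternions \isog 'D_8.
Proof.
have card8 : (8 <= #|coquaternions|)%N.
  apply: (@uniq_card_ge (signed_list [:: 0%R; letter 0; letter 1; letter 0 + letter 1]%R)) => //.
  by rewrite /= !inE.
rewrite isogEcard (@card_2dihedral 3) // card8 andbT.
apply: (@homg_D8 _ ((false, (letter 0 + letter 1)%R) : signed) ((false, letter 0) : signed)) => //.
apply: joing_generates; rewrite ?inE //= => -[s K]; rewrite inE /=.
case: K => [[[[] []] []] []] //= _.
- by case: s; [exists 3%N, 0%N|exists 1%N, 0%N].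
- by case: s; [exists 2%N, 1%N|exists 0%N, 1%N].
- by case: s; [exists 1%N, 1%N|exists 3%N, 1%N].
- by case: s; [exists 2%N, 0%N|exists 0%N, 0%N].
Qed.

Lemma commutants_commute x y : x \in quaternions -> y \in coquaternions -> x * y = y * x.
Proof.
case: x y => [s K] [t L]; rewrite !inE /= => hK hL; apply/signed_comm => /=.
by move: hK hL; case: K => [[[[] []] []] []] //= _; case: L => [[[[] []] []] []].
Qed.

Lemma signed_cprod : quaternions \* coquaternions = finset.setTfor signed.
Proof.
rewrite cprodE; last first.
  by apply/centsP => x xc y yq; symmetry; exact: commutants_commute.
apply/setP => -[s K]; rewrite [RHS]inE.
suff [L [hL hKL]] : exists L, ((false, L) : signed) \in quaternions /\
    ((s (+) swap L (L + K)%R, (L + K)%R) : signed) \in coquaternions.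
  apply/mulsgP; exists ((false, L) : signed) ((s (+) swap L (L + K)%R, (L + K)%R) : signed) => //.
  by rewrite signedM /signed_mul /= -addbA addbb addbF bits_addKK.
case: K => [[[[] []] []] []];
  by [exists 0%R; rewrite !inE|exists quat_i; rewrite !inE|exists quat_j; rewrite !inE
     |exists (quat_i + quat_j)%R; rewrite !inE].
Qed.

Lemma center_quaternions x : (x \in 'Z(quaternions)) = (x.2 == 0%R).
Proof.
apply/centerP/idP => [[xq xc]|/eqP x0].
  have ci := xc ((false, quat_i) : signed); have cj := xc ((false, quat_j) : signed).
  have /signed_comm /= {}ci := ci (ltac:(by rewrite inE)).
  have /signed_comm /= {}cj := cj (ltac:(by rewrite inE)).
  move: xq ci cj; rewrite inE; case: (x.2) => [[[[] []] []] []] //.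
split; first by rewrite inE x0.
by move=> y _; apply/signed_comm; rewrite x0 /anticomm swap0l swap0r.
Qed.

Lemma center_coquaternions x : (x \in 'Z(coquaternions)) = (x.2 == 0%R).
Proof.
apply/centerP/idP => [[xq xc]|/eqP x0].
  have ci := xc ((false, letter 0) : signed); have cj := xc ((false, letter 1) : signed).
  have /signed_comm /= {}ci := ci (ltac:(by rewrite inE)).
  have /signed_comm /= {}cj := cj (ltac:(by rewrite inE)).
  move: xq ci cj; rewrite inE; case: (x.2) => [[[[] []] []] []] //.
split; first by rewrite inE x0.
by move=> y _; apply/signed_comm; rewrite x0 /anticomm swap0l swap0r.
Qed.

(** Automorphisms of the centre extend to the group, as those of a group of order two are
    trivial. *)
Lemma center_Aut_full (gT : finGroupType) (G : {group gT}) : #|'Z(G)| = 2%N ->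
  Aut_in (Aut G) 'Z(G) \isog Aut 'Z(G).
Proof.
move=> Z2; apply/(Aut_sub_fullP (center_sub G)) => h injh hZ.
exists (idm_morphism G); split; [exact: injm_idm|exact: morphim_idm|].
move=> z zZ; have [->|z1] := eqVneq z 1; first by rewrite !morph1.
have Zz : [set 1; z]%SET = 'Z(G).
  apply/eqP; rewrite eqEcard Z2 cards2 eq_sym z1 andbT.
  by apply/fintype.subsetP => y /set2P[] -> //; exact: group1.
have hzZ : h z \in [set 1; z]%SET.
  have : h z \in h @* 'Z(G) by rewrite mem_morphim.
  by rewrite Zz hZ.
move: hzZ; rewrite !inE => /orP[|/eqP -> //].
by rewrite (morph_injm_eq1 injh) // (negbTE z1).
Qed.

(** The quaternions and their commutant generate the group and meet in the common centre
    of order two. *)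
Lemma signed_isog : finset.setTfor signed \isog finset.setTfor Q8_central_D8.
Proof.
apply: isog_xcprod quaternions_isog coquaternions_isog signed_cprod _.
  have card2 : #|'Z(quaternions)| = 2%N.
    rewrite (_ : 'Z(quaternions) = [set (false, 0%R); (true, 0%R)]%SET) ?cards2 //.
    apply/setP => -[s K]; rewrite center_quaternions !inE !xpair_eqE.
    by case: s; rewrite /= ?orbF.
  apply: center_Aut_full; have [f injf defQ] := isogP quaternions_isog.
  by rewrite -defQ -injm_center // card_injm // center_sub.
by apply/setP => x; rewrite center_quaternions center_coquaternions.
Qed.

End FiniteGroups.

(** * The theorem *)

Section Targets.
Local Open Scope group_scope.

Lemma isog_embedding (gT : finGroupType) (H : {group signed}) :
  H \isog finset.setTfor gT -> exists phi : gT -> signed,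
  [/\ {morph phi : x y / x * y}, injective phi, forall g, phi g \in H
    & forall x, x \in H -> exists g, phi g = x].
Proof.
move=> /isog_symr/isogP[f injf fH]; exists f; split.
- by move=> x y; rewrite morphM ?inE.
- by move=> x y; apply: (injmP injf); rewrite inE.
- by move=> g; rewrite -fH mem_morphim ?inE.
- by move=> x; rewrite -fH => /morphimP[g _ _ ->]; exists g.
Qed.

Lemma quaternionsP (x : signed) : reflect
  (forall k, (k < 2)%N -> anticomm (letter k) x.2 = false) (x \in quaternions).
Proof.
rewrite inE; apply: (iffP andP) => [[/negbTE h0 /negbTE h1] [|[|]] //|h].
by split; rewrite h.
Qed.

(** The group of order two generated by the first letter, which is central in the group of
    blades that commute with that letter, and which meets the quaternions trivially: the
    first letter anticommutes with the second. *)
Definition central_unit (e : 'Z_2) : signed := if e != 1 then (false, letter 0) else 1.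

Lemma central_unitM : {morph central_unit : x y / x * y}.
Proof.
move=> x y; rewrite /central_unit Z2_neq1M.
by case: (x != 1) (y != 1) => [] [].
Qed.

Lemma central_unit_commute e x : x \in quaternions -> central_unit e * x = x * central_unit e.
Proof.
move=> /quaternionsP xq; apply/signed_comm; rewrite /central_unit; case: (e != 1).
  exact: xq.
by rewrite /anticomm swap0l swap0r.
Qed.

End Targets.

Section FundamentalGroups.
Context {R : realType}.

Lemma fundamental_group_2 (nm : (2 <= 3)%N) :
  isomorphic (homotopy_group R 1 (basis_config R (m := 2) 2 nm)) ('Q_8 : groupType).
Proof.
have [phi [phiM phiI phiH phiS]] := isog_embedding quaternions_isog.
apply: (@fundamental_group_spin R 1 2 erefl nm 'Q_8 phi) => //.
- by move=> g k; exact/quaternionsP.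
- by move=> x xq; apply: phiS; exact/quaternionsP.
Qed.

Lemma fundamental_group_3 (nm : (3 <= 4)%N) :
  isomorphic (homotopy_group R 1 (basis_config R (m := 3) 3 nm)) (('Q_8 * 'Z_2)%type : groupType).
Proof.
have [phi [phiM phiI phiH phiS]] := isog_embedding quaternions_isog.
pose psi (x : ('Q_8 * 'Z_2)%type) : signed := (phi x.1 * central_unit x.2)%g.
(* Anticommutation with the second letter detects the factor of order two. *)
have psi_pi x : anticomm (letter 1) (psi x).2 = (x.2 != 1%g).
  have /quaternionsP/(_ 1%N isT) h := phiH x.1.
  rewrite /psi signedM /= anticommDr h /central_unit.
  by case: (x.2 != 1%g).
apply: (@fundamental_group_spin R 2 1 erefl nm ('Q_8 * 'Z_2)%type psi) => //.
- move=> [a e] [b f]; rewrite /psi /= phiM central_unitM.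
  rewrite -[RHS]signedM -!mulgA (mulgA (central_unit e)).
  by rewrite (central_unit_commute e (phiH b)) -mulgA.
- move=> [a e] [b f] ab; have ef : e = f.
    by apply: Z2_cases; have := psi_pi (a, e); rewrite ab psi_pi.
  by move: ab; rewrite /psi /= ef => h; have /phiI -> := @mulIg _ (central_unit f) _ _ h.
- move=> g [|//] _; have /quaternionsP/(_ 0%N isT) h := phiH g.1.
  rewrite /psi signedM /= anticommDr h /central_unit.
  by case: (g.2 != 1%g); rewrite /anticomm ?swap0l ?swap0r.
- move=> x x0; have {}x0 := x0 0%N isT.
  pose e : 'Z_2 := if anticomm (letter 1) x.2 then Zp1 else 1%g.
  have [|a aE] := phiS ((x : signed) * central_unit e)%g.
    apply/quaternionsP => -[|[|//]] _; rewrite signedM /= anticommDr ?x0 /central_unit /e.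
      by case: (anticomm (letter 1) x.2); rewrite /anticomm ?swap0l ?swap0r.
    by case E: (anticomm (letter 1) x.2) => //=; rewrite /anticomm ?swap0l ?swap0r.
  exists (a, e); rewrite /psi /= aE -mulgA -central_unitM.
  have -> : (e * e)%g = 1%g by apply: Z2_cases; rewrite Z2_neq1M addbb eqxx.
  by rewrite [central_unit 1%g]/central_unit eqxx mulg1.
Qed.

Lemma fundamental_group_4 (nm : (4 <= 5)%N) :
  isomorphic (homotopy_group R 1 (basis_config R (m := 4) 4 nm)) (Q8_central_D8 : groupType).
Proof.
have [phi [phiM phiI phiH phiS]] := isog_embedding signed_isog.
apply: (@fundamental_group_spin R 3 0 erefl nm Q8_central_D8 phi) => //.
by move=> x _; apply: phiS; rewrite inE.
Qed.

End FundamentalGroups.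

Theorem theorem1p3 (R : realType) (m n k : nat)
    (m_ge1 : (1 <= m)%N) (k_ge1 : (1 <= k)%N) (k_le_n : (k <= n)%N) :
  (forall (p : nat) (x : config_sphere R m k n),
      isomorphic (homotopy_group R p.+2 (config_image x))
                 (homotopy_group R p.+2 x))
  /\
  (forall n_le : (n <= m.+1)%N,
      let pi1 := homotopy_group R 1 (basis_config R k n_le) in
      [/\ k = n -> (n <= m - 1)%N -> isomorphic pi1 {ffun 'I_n -> 'Z_2},
          k = n -> n = m -> m = 2%N -> isomorphic pi1 'Q_8,
          k = n -> n = m -> m = 3%N -> isomorphic pi1 ('Q_8 * 'Z_2)%type
        & k = n -> n = m -> m = 4%N -> isomorphic pi1 Q8_central_D8]).
Proof.
split=> [p x|n_le pi1].
  by apply: isomorphic_sym; exact: covering_higher_homotopy (config_covering k n) x p.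
split=> kn; rewrite /pi1.
- move=> nm; subst k; apply: fundamental_group_few_points.
  by rewrite -(prednK m_ge1) ltnS -subn1.
- by move=> nm m2; subst k n m; exact: fundamental_group_2.
- by move=> nm m3; subst k n m; exact: fundamental_group_3.
- by move=> nm m4; subst k n m; exact: fundamental_group_4.
Qed.
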